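(* Let $\alpha\in(0,1)$, let $A$ be a constant, and let $f$ and $g$ be Laplace-transformable functions satisfying $$ {}^{ABC}D^{\alpha}_{0+}f(t)-A\,(f\ast f)(t)=g(t). $$ Then the Laplace transform of $f$ is given by $$ \hat{f}(s)=\frac{\frac{B(\alpha)}{1-\alpha}\cdot\frac{s^{\alpha}}{s^{\alpha}+\frac{\alpha}{1-\alpha}}\pm\sqrt{\left(\frac{B(\alpha)}{1-\alpha}\cdot\frac{s^{\alpha}}{s^{\alpha}+\frac{\alpha}{1-\alpha}}\right)^2-4A\left(\hat{g}(s)+\frac{B(\alpha)}{1-\alpha}\cdot\frac{s^{\alpha-1}}{s^{\alpha}+\frac{\alpha}{1-\alpha}}f(0)\right)}}{2A}, $$ where $\hat f,\hat g$ denote Laplace transforms. The right-hand side depends only on $g$ and $f(0)$, so taking inverse Laplace transforms gives an explicit formula for $f(t)$.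
   Context: The Mittag-Leffler function is $E_\alpha(x)=\sum_{n=0}^\infty \frac{x^n}{\Gamma(\alpha n+1)}$. $B$ is a fixed normalisation function with real, strictly positive values and $B(0)=B(1)=1$. The ABC fractional derivative is $$ {}^{ABC}D^{\alpha}_{0+}f(t)=\frac{B(\alpha)}{1-\alpha}\int_0^t f'(x)E_\alpha\Big(\frac{-\alpha}{1-\alpha}(t-x)^{\alpha}\Big)\,\mathrm{d}x. $$ The operation $\ast$ is the (Laplace) convolution $(f\ast f)(t)=\int_0^t f(x)f(t-x)\,\mathrm{d}x$, and $\hat f(s)=\int_0^\infty e^{-st}f(t)\,\mathrm{d}t$. A function is Laplace-transformable if it has a well-defined Laplace transform. *)

(* Defs.v *)
From HB Require Import structures.
From mathcomp Require Import all_boot all_order all_algebra.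
From mathcomp Require Import all_classical all_reals all_analysis.
From mathcomp Require Export complex.

Set Implicit Arguments.
Unset Strict Implicit.
Unset Printing Implicit Defensive.

Import Order.TTheory GRing.Theory Num.Theory.
Import numFieldNormedType.Exports.

Local Open Scope classical_set_scope.
Local Open Scope ring_scope.
Local Open Scope complex_scope.

Section Defs.
Variable R : realType.
Notation mu := (@lebesgue_measure R).
Implicit Types (f g F : R -> R[i]) (s z a : R[i]) (t T x alpha : R).

(* Complex-valued functions of a real variable are differentiated and
   integrated componentwise. *)
Definition Re_fun F : R -> R := fun x => complex.Re (F x).
Definition Im_fun F : R -> R := fun x => complex.Im (F x).

Definition cderivable F x : Prop :=
  derivable (Re_fun F) x 1 /\ derivable (Im_fun F) x 1.

Definition cderive1 F : R -> R[i] :=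
  fun x => derive1 (Re_fun F) x +i* derive1 (Im_fun F) x.

Definition cintegrable (D : set R) F : Prop :=
  mu.-integrable D (EFin \o Re_fun F) /\ mu.-integrable D (EFin \o Im_fun F).

Definition cintegral (D : set R) F : R[i] :=
  (\int[mu]_(x in D) Re_fun F x) +i* (\int[mu]_(x in D) Im_fun F x).

Definition cexp z : R[i] :=
  (expR (complex.Re z) * cos (complex.Im z)) +i*
  (expR (complex.Re z) * sin (complex.Im z)).

(* Principal argument, with values in ]-pi, pi]; junk value at 0. *)
Definition carg z : R :=
  let t := acos (complex.Re z / complex.Re `|z|) in
  if 0 <= complex.Im z then t else - t.

Definition clog z : R[i] := ln (complex.Re `|z|) +i* carg z.

(* Principal branch, meaningful for z != 0. *)
Definition cpow z alpha : R[i] := cexp (alpha%:C * clog z).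

(* Euler's Gamma function, meaningful for x > 0. *)
Definition Gamma x : R :=
  \int[mu]_(t in `]0, +oo[) (t `^ (x - 1) * expR (- t)).

Definition mittag_leffler alpha x : R :=
  limn (series (fun n : nat => x ^+ n / Gamma (alpha * n%:R + 1))).

Definition convolution f g : R -> R[i] :=
  fun t => cintegral `[0, t] (fun x => f x * g (t - x)).

(* The Laplace integral is read as an improper integral
   lim_(T -> +oo) \int_0^T, so that absolute convergence is not required. *)
Definition laplace_trunc f s T : R[i] :=
  cintegral `[0, T] (fun t => cexp (- s * t%:C) * f t).

Definition laplace_cvg f s : Prop :=
  (forall T, 0 < T -> cintegrable `[0, T] f) /\
  cvg (complex.Re (laplace_trunc f s T) @[T --> +oo]) /\
  cvg (complex.Im (laplace_trunc f s T) @[T --> +oo]).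

Definition laplace f s : R[i] :=
  lim (complex.Re (laplace_trunc f s T) @[T --> +oo]) +i*
  lim (complex.Im (laplace_trunc f s T) @[T --> +oo]).

Definition laplace_transformable f : Prop := exists s, laplace_cvg f s.

Definition inverse_laplace (G : R[i] -> R[i]) f : Prop :=
  exists sigma : R, forall s, sigma < complex.Re s ->
    laplace_cvg f s /\ laplace f s = G s.

(* The functions on [0, +oo[ for which the formula defining the ABC derivative
   makes sense: f is differentiable on ]0, +oo[ and continuous at 0, with f'
   integrable on bounded intervals. *)
Definition ABC_domain f : Prop :=
  [/\ forall t, 0 < t -> cderivable f t,
      Re_fun f x @[x --> 0^'+] --> complex.Re (f 0),
      Im_fun f x @[x --> 0^'+] --> complex.Im (f 0)
    & forall T, 0 < T -> cintegrable `[0, T] (cderive1 f)].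

Definition ABC (B : R -> R) alpha f : R -> R[i] := fun t =>
  (B alpha / (1 - alpha))%:C *
  cintegral `[0, t] (fun x => cderive1 f x *
    (mittag_leffler alpha (- alpha / (1 - alpha) * (t - x) `^ alpha))%:C).

Definition ABC_symbol (B : R -> R) alpha (beta : R) s : R[i] :=
  (B alpha / (1 - alpha))%:C *
  (cpow s beta / (cpow s alpha + (alpha / (1 - alpha))%:C)).

(* The right-hand side of the formula for the transform of f, as a function of
   G (the transform of g), f0 (the value f(0)) and the sign (-1) ^+ b replacing
   the +- in front of the square root. *)
Definition laplace_solution (B : R -> R) alpha (A : R[i]) (G : R[i] -> R[i])
    (f0 : R[i]) (b : bool) s : R[i] :=
  (ABC_symbol B alpha alpha s +
   (-1) ^+ b *
   sqrtc (ABC_symbol B alpha alpha s ^+ 2 -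
          4 * A * (G s + ABC_symbol B alpha (alpha - 1) s * f0))) /
  (2 * A).

End Defs.

(* Main.v *)
Require Import Defs.
From HB Require Import structures.
From mathcomp Require Import all_boot all_order all_algebra.
From mathcomp Require Import all_classical all_reals all_analysis.
From mathcomp Require Import measurable_realfun.
From mathcomp Require Import ring lra.
Import Order.TTheory GRing.Theory Num.Theory.
Import numFieldNormedType.Exports.
Local Open Scope classical_set_scope.
Local Open Scope ring_scope.
Local Open Scope complex_scope.

Set Implicit Arguments.
Unset Strict Implicit.
Unset Printing Implicit Defensive.

(** Write c = B(al) / (1 - al), lam = al / (1 - al), k(t) = t^(al-1) / Gamma(al)
and e(t) = E_al(- lam t^al), so that the ABC derivative of f is c f' * e, where
* is convolution on [0, t].

The kernel e is the resolvent of k: the terms of the Mittag-Leffler series are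
Riemann-Liouville kernels, two such kernels convolve to a third one by the Beta
integral (rl_kernel_conv), and summing the series gives e + lam k * e = 1
(mlfun_resolvent).  Put q = c f' * e = g + A f * f.  Then q + lam k * q =
c f' * (e + lam k * e) = c f' * 1 = c (f - f(0)), an identity that no longer
contains e.  Formally its Laplace transform is
  c F - c f(0) / s = (G + A F^2) (1 + lam s^(-al)),
with F and G the transforms of f and g.  After multiplication by
s^al / (s^al + lam) this is a quadratic equation for F, whose solution is the
formula of the theorem.

Three points need an argument.
- The transforms F and G are improper integrals that may converge only
  conditionally, so that the transform of f * f need not converge and the
  convolution theorem does not apply.  The weight e^(-st) is multiplicative and
  therefore passes inside the convolutions; the weighted identity is integrated
  twice over [0, T] and divided by T.  Each occurrence of F or G is then the
  limit of an average, because the average over [0, T] of u(x) v(T - x) tends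
  to the product of the limits of u and v at infinity (conv_cesaro).  This
  proves laplace_transformed_equation.
- The derivative f' exists everywhere on the open half-line and is integrable
  but not assumed continuous; f - f(0) is nevertheless its integral
  (increment_eq_integral0).
- The transform of k at a complex s is s^(-al).  On a vertical line both sides
  solve the same linear differential equation in Im s, and on the real axis the
  value is a change of variables (gamma_trig, laplace_kernel).

For each s one of the two roots is F(s), and sgn records which one; this is the
first assertion.  Convergence of a Laplace integral at s0 propagates to
Re s > Re s0 (laplace_half_plane), which gives the second.  The third is Lerch's
theorem: if a transform vanishes on a half-plane, then the weighted primitive of
the function has vanishing exponential moments and hence is zero
(exponential_moments_eq0, laplace_unique). *)

(** * Affine changes of variables on the line *)

Section Affine.
Variable R : realType.
Notation mu := (@lebesgue_measure R).

(** The image of Lebesgue measure under phi has constant density r; the instances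
below are dilations (r = 1 / c), translations and reflections (r = 1). *)
Definition image_density (phi : R -> R) (r : R) :=
  measurable_fun setT (phi : measurableTypeR R -> measurableTypeR R) /\
  forall A : set R, measurable A -> mu (phi @^-1` A) = (r%:E * mu A)%E.

(** c times the image measure agrees with Lebesgue measure on half-open
intervals, which determine it. *)
Lemma image_density_affine (c d : R) : 0 < c ->
  image_density (fun x => c * x + d) c^-1.
Proof.
move=> c0.
have mphi : measurable_fun setT (fun x : R => c * x + d).
  by apply: measurable_funD => //; exact: measurable_funM.
split => // A mA.
pose phi := (fun x : R => c * x + d) : measurableTypeR R -> measurableTypeR R.
have mphi' : measurable_fun setT phi by exact: mphi.
pose k : {nonneg R} := NngNum (ltW c0).
have -> : mu A = mscale k (pushforward mu phi) A.
  move=> m; apply: (@lebesgue_measure_unique _ (mscale k (pushforward mu phi))) => //= X [[a b]] _ <-.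
  rewrite /mscale /= /pushforward.
  have -> : phi @^-1` [set` `]a, b] ] = [set` `](a - d) / c, (b - d) / c]].
    apply/seteqP; split => x; rewrite /phi /= !in_itv/= ltr_pdivrMr// ler_pdivlMr//
      ltrBlDr lerBrDr mulrC //.
  rewrite !lebesgue_measure_itv/= !lte_fin ltr_pM2r ?invr_gt0// ltrD2r.
  case: ifPn => ab; last by rewrite mule0.
  by rewrite -!EFinB -EFinM -mulrBl opprB addrA subrK mulrCA divff ?mulr1// gt_eqF.
rewrite /mscale /= muleA -EFinM mulVf ?mul1e// gt_eqF//.
Qed.

Lemma image_density_reflect (h : R) : image_density (fun x => h - x) 1.
Proof.
have [mphi ephi] := image_density_affine (- h) ltr01.
have E : (fun x => h - x) = (-%R \o (fun x : R => 1 * x - h)).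
  by apply/funext => x /=; rewrite mul1r opprB.
split; first by apply: measurable_funB.
move=> A mA; rewrite E comp_preimage ephi; last first.
  by rewrite -[_ @^-1` _]setTI; exact: (@oppr_measurable R setT).
by rewrite invr1 !mul1e; exact: lebesgue_measureN.
Qed.

Lemma ge0_integral_image_density (phi : R -> R) (r : R) (f : R -> \bar R) :
  0 <= r -> image_density phi r -> measurable_fun [set: measurableTypeR R] f -> (forall x, 0 <= f x)%E ->
  (\int[mu]_x f (phi x) = r%:E * \int[mu]_x f x)%E.
Proof.
move=> r0 [mphi ephi] mf f0.
rewrite -[X in integral _ X](preimage_setT phi).
rewrite -(@ge0_integral_pushforward _ _ (measurableTypeR R) (measurableTypeR R) _ phi mphi mu setT f)//.
pose k : {nonneg R} := NngNum r0.
rewrite -[RHS](ge0_integral_mscale mu measurableT k mf)//.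
by apply: eq_measure_integral => A mA _; exact: ephi.
Qed.

Lemma integrable_image_density (phi : R -> R) (r : R) (f : R -> R) :
  0 <= r -> image_density phi r -> mu.-integrable setT (EFin \o f) ->
  mu.-integrable setT (EFin \o (f \o phi)).
Proof.
move=> r0 [mphi ephi] /integrableP[mf foo]; apply/integrableP; split.
  exact: (measurableT_comp mf mphi).
rewrite (@ge0_integral_image_density phi r (fun x => `|(f x)%:E|%E))//.
  by rewrite lte_mul_pinfty.
exact: measurableT_comp.
Qed.

(** The positive and negative parts may both have infinite integral; the case
analysis checks that oo - oo is treated alike on both sides. *)
Lemma integral_image_density (phi : R -> R) (r : R) (f : R -> \bar R) :
  0 <= r -> image_density phi r -> measurable_fun [set: measurableTypeR R] f ->
  (\int[mu]_x f (phi x) = r%:E * \int[mu]_x f x)%E.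
Proof.
move=> r0 dphi mf; rewrite integralE [in RHS]integralE.
have -> : (fun x => f (phi x))^\+%E = (fun x => f^\+%E (phi x)) by exact: funepos_comp.
have -> : (fun x => f (phi x))^\-%E = (fun x => f^\-%E (phi x)) by exact: funeneg_comp.
rewrite !(ge0_integral_image_density r0 dphi)//; last 2 first.
- exact: measurable_funeneg.
- exact: measurable_funepos.
move: r0; rewrite le_eqVlt => /predU1P[<-|rp]; first by rewrite !mul0e sube0.
have : (0 <= \int[mu]_x f^\+ x)%E by exact: integral_ge0.
have : (0 <= \int[mu]_x f^\- x)%E by exact: integral_ge0.
move: (\int[mu]_x f^\+ x)%E (\int[mu]_x f^\- x)%E => [u| |] [v| |] //= _ _.
- by apply: (congr1 (@EFin R) (_ : r * u - r * v = r * (u - v))); rewrite mulrBr.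
- by rewrite gt0_muley ?lte_fin//= gt0_muleNy ?lte_fin.
- by rewrite gt0_muley ?lte_fin.
- by rewrite gt0_muley ?lte_fin//= gt0_muleNy ?lte_fin.
Qed.

Lemma Rintegral_image_density (phi : R -> R) (r : R) (f : R -> R) :
  0 <= r -> image_density phi r -> measurable_fun [set: measurableTypeR R] f ->
  \int[mu]_x f (phi x) = r * \int[mu]_x f x.
Proof.
move=> r0 dphi mf; rewrite /Rintegral.
rewrite (@integral_image_density phi r (EFin \o f))//; last exact/measurable_EFinP.
case: (\int[mu]_x (EFin \o f) x)%E => [y| |]; first by rewrite -EFinM.
- by rewrite mulry; have [_|_|_] := sgrP r; rewrite ?mul0e ?mul1e ?mulN1e /= mulr0.
- by rewrite mulrNy; have [_|_|_] := sgrP r; rewrite ?mul0e ?mul1e ?mulN1e /= mulr0.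
Qed.

End Affine.

(** * Integration of complex-valued functions *)

Section ComplexAlgebra.
Variable R : realType.
Implicit Types z w : R[i].
Notation Re := complex.Re.
Notation Im := complex.Im.

Lemma complexP z w : Re z = Re w -> Im z = Im w -> z = w.
Proof. by case: z => a b; case: w => c d /= -> ->. Qed.

Lemma cReD z w : Re (z + w) = Re z + Re w. Proof. by case: z; case: w. Qed.
Lemma cImD z w : Im (z + w) = Im z + Im w. Proof. by case: z; case: w. Qed.
Lemma cReN z : Re (- z) = - Re z. Proof. by case: z. Qed.
Lemma cImN z : Im (- z) = - Im z. Proof. by case: z. Qed.
Lemma cReM z w : Re (z * w) = Re z * Re w - Im z * Im w.
Proof. by case: z; case: w. Qed.
Lemma cImM z w : Im (z * w) = Re z * Im w + Im z * Re w.
Proof. by case: z; case: w. Qed.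
Lemma cReZ (r : R) z : Re (r%:C * z) = r * Re z.
Proof. by rewrite cReM /= mul0r subr0. Qed.
Lemma cImZ (r : R) z : Im (r%:C * z) = r * Im z.
Proof. by rewrite cImM /= mul0r addr0. Qed.
Definition cE := (cReD, cImD, cReN, cImN, cReM, cImM).

End ComplexAlgebra.

Section ComplexIntegral.
Variable R : realType.
Notation mu := (@lebesgue_measure R).
Notation Re := complex.Re.
Notation Im := complex.Im.
Implicit Types (F G H : R -> R[i]) (D : set R) (a b : R -> R).

Lemma integrableMb D a b (M : R) : measurable D ->
  mu.-integrable D (EFin \o a) -> measurable_fun D b ->
  (forall x, D x -> `|b x| <= M) -> mu.-integrable D (EFin \o (fun x => a x * b x)).
Proof.
move=> mD ai mb bM.
have -> : EFin \o (fun x => a x * b x) = ((EFin \o a) \* (EFin \o b))%E.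
  by apply/funext => x /=; rewrite EFinM.
apply: integrableMl => //.
exists M; split; first exact: num_real.
by move=> y My x Dx /=; rewrite (le_trans (bM x Dx))// ltW.
Qed.

Lemma RintegrableD D a b : measurable D ->
  mu.-integrable D (EFin \o a) -> mu.-integrable D (EFin \o b) ->
  mu.-integrable D (EFin \o (fun x => a x + b x)).
Proof.
move=> mD ai bi; have -> : EFin \o (fun x => a x + b x) = ((EFin \o a) \+ (EFin \o b))%E by [].
exact: integrableD.
Qed.

Lemma RintegrableN D a : measurable D ->
  mu.-integrable D (EFin \o a) -> mu.-integrable D (EFin \o (fun x => - a x)).
Proof.
move=> mD ai; have -> : EFin \o (fun x => - a x) = (-%E \o (EFin \o a))%E by [].
exact: integrableN.
Qed.

Lemma RintegrableB D a b : measurable D ->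
  mu.-integrable D (EFin \o a) -> mu.-integrable D (EFin \o b) ->
  mu.-integrable D (EFin \o (fun x => a x - b x)).
Proof. by move=> mD ai bi; apply: RintegrableD => //; apply: RintegrableN. Qed.

Lemma RintegrableZl D a (k : R) : measurable D ->
  mu.-integrable D (EFin \o a) -> mu.-integrable D (EFin \o (fun x => k * a x)).
Proof.
move=> mD ai.
have -> : EFin \o (fun x => k * a x) = (fun x => k%:E * (EFin \o a) x)%E.
  by apply/funext => x /=; rewrite EFinM.
exact: integrableZl.
Qed.

Lemma cintegrable_comp D F (f g : R -> R) :
  mu.-integrable D (EFin \o f) -> mu.-integrable D (EFin \o g) ->
  (forall x, Re (F x) = f x) -> (forall x, Im (F x) = g x) -> cintegrable D F.
Proof.
move=> fi gi Ef Eg; split.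
- by have -> : Re_fun F = f by apply/funext => x; exact: Ef.
- by have -> : Im_fun F = g by apply/funext => x; exact: Eg.
Qed.

Lemma cintegrableD D F G : measurable D -> cintegrable D F -> cintegrable D G ->
  cintegrable D (fun x => F x + G x).
Proof.
move=> mD [F1 F2] [G1 G2].
apply: (cintegrable_comp (RintegrableD mD F1 G1) (RintegrableD mD F2 G2)) => x;
by rewrite cE.
Qed.

Lemma cintegrableN D F : measurable D -> cintegrable D F ->
  cintegrable D (fun x => - F x).
Proof.
move=> mD [F1 F2].
by apply: (cintegrable_comp (RintegrableN mD F1) (RintegrableN mD F2)) => x; rewrite cE.
Qed.

Lemma cintegrableB D F G : measurable D -> cintegrable D F -> cintegrable D G ->
  cintegrable D (fun x => F x - G x).
Proof. by move=> mD Fi Gi; apply: cintegrableD => //; apply: cintegrableN. Qed.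

Lemma cintegrableZl D F (k : R[i]) : measurable D -> cintegrable D F ->
  cintegrable D (fun x => k * F x).
Proof.
move=> mD [F1 F2].
apply: (cintegrable_comp
  (RintegrableB mD (RintegrableZl (Re k) mD F1) (RintegrableZl (Im k) mD F2))
  (RintegrableD mD (RintegrableZl (Re k) mD F2) (RintegrableZl (Im k) mD F1))) => x;
by rewrite cE.
Qed.

Definition cmeasurable D F := measurable_fun (D : set (measurableTypeR R)) (Re_fun F) /\
  measurable_fun (D : set (measurableTypeR R)) (Im_fun F).
Definition cbounded D F (M : R) := forall x, D x -> `|Re (F x)| <= M /\ `|Im (F x)| <= M.

Lemma cintegrable_meas D F : cintegrable D F -> cmeasurable D F.
Proof.
by move=> [F1 F2]; split; [have := measurable_int _ F1|have := measurable_int _ F2];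
  move/measurable_EFinP.
Qed.

Lemma cintegrableMb D F G (M : R) : measurable D -> cintegrable D F ->
  cmeasurable D G -> cbounded D G M -> cintegrable D (fun x => F x * G x).
Proof.
move=> mD [F1 F2] [G1 G2] GM.
have G1M x : D x -> `|Re_fun G x| <= M by move=> /GM[].
have G2M x : D x -> `|Im_fun G x| <= M by move=> /GM[].
apply: (cintegrable_comp
  (RintegrableB mD (integrableMb mD F1 G1 G1M) (integrableMb mD F2 G2 G2M))
  (RintegrableD mD (integrableMb mD F1 G2 G2M) (integrableMb mD F2 G1 G1M))) => x;
by rewrite cE.
Qed.

Lemma eq_cintegral D F G : (forall x, D x -> F x = G x) -> cintegral D F = cintegral D G.
Proof.
move=> FG; rewrite /cintegral; congr Complex; apply: eq_Rintegral => x;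
by rewrite inE /Re_fun /Im_fun => /FG ->.
Qed.

Lemma eq_cintegrable D F G : measurable D -> (forall x, D x -> F x = G x) ->
  cintegrable D F -> cintegrable D G.
Proof.
move=> mD FG [F1 F2]; split; [apply: eq_integrable F1|apply: eq_integrable F2] => //;
by move=> x; rewrite inE /Re_fun /Im_fun/= => /FG ->.
Qed.

Lemma cintegrableS D E F : measurable D -> measurable E -> E `<=` D ->
  cintegrable D F -> cintegrable E F.
Proof.
by move=> mD mE ED [F1 F2]; split; [exact: integrableS F1|exact: integrableS F2].
Qed.

Lemma cintegralD D F G : measurable D -> cintegrable D F -> cintegrable D G ->
  cintegral D (fun x => F x + G x) = cintegral D F + cintegral D G.
Proof.
move=> mD [F1 F2] [G1 G2]; apply: complexP; rewrite cE /= -RintegralD//;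
by apply: eq_Rintegral => x _; rewrite /Re_fun /Im_fun cE.
Qed.

Lemma cintegralZl D F (k : R[i]) : measurable D -> cintegrable D F ->
  cintegral D (fun x => k * F x) = k * cintegral D F.
Proof.
move=> mD [F1 F2]; apply: complexP; rewrite cE /=.
- rewrite -!RintegralZl// -RintegralB//; last 2 first.
  + exact: (RintegrableZl (Re k) mD F1).
  + exact: (RintegrableZl (Im k) mD F2).
  by apply: eq_Rintegral => x _; rewrite /Re_fun /Im_fun cE.
- rewrite -!RintegralZl// -RintegralD//; last 2 first.
  + exact: (RintegrableZl (Re k) mD F2).
  + exact: (RintegrableZl (Im k) mD F1).
  by apply: eq_Rintegral => x _; rewrite /Re_fun /Im_fun cE.
Qed.

Lemma cintegralZr D F (k : R[i]) : measurable D -> cintegrable D F ->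
  cintegral D (fun x => F x * k) = cintegral D F * k.
Proof.
move=> mD Fi; rewrite mulrC -cintegralZl//; apply: eq_cintegral => x _; exact: mulrC.
Qed.

Lemma cintegralN D F : measurable D -> cintegrable D F ->
  cintegral D (fun x => - F x) = - cintegral D F.
Proof.
move=> mD Fi; rewrite -mulN1r -cintegralZl//; apply: eq_cintegral => x _.
by rewrite mulN1r.
Qed.

Lemma cintegralB D F G : measurable D -> cintegrable D F -> cintegrable D G ->
  cintegral D (fun x => F x - G x) = cintegral D F - cintegral D G.
Proof.
by move=> mD Fi Gi; rewrite cintegralD// ?cintegralN//; apply: cintegrableN.
Qed.

(** Extension by zero outside D, which turns convolution on [0, t] into
convolution on the whole line. *)
Definition cutoff D F : R -> R[i] := fun x => if x \in D then F x else 0.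

Lemma Re_fun_cut D F : Re_fun (cutoff D F) = (Re_fun F) \_ D.
Proof. by apply/funext => x; rewrite /Re_fun patchE /cutoff; case: ifP. Qed.
Lemma Im_fun_cut D F : Im_fun (cutoff D F) = (Im_fun F) \_ D.
Proof. by apply/funext => x; rewrite /Im_fun patchE /cutoff; case: ifP. Qed.

Lemma cintegral_mkcond D F : cintegral D F = cintegral setT (cutoff D F).
Proof.
by rewrite /cintegral Re_fun_cut Im_fun_cut; congr Complex; exact: Rintegral_mkcond.
Qed.

Lemma cintegrable_mkcond D F : measurable D ->
  cintegrable D F -> cintegrable setT (cutoff D F).
Proof.
move=> mD [F1 F2]; split; rewrite ?Re_fun_cut ?Im_fun_cut -restrict_EFin.
- have mD' : measurable (D : set (measurableTypeR R)) := mD.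
  have := (@integrable_mkcond _ _ _ mu _ (EFin \o Re_fun F) mD').1 F1.
  by [].
- have mD' : measurable (D : set (measurableTypeR R)) := mD.
  exact: (@integrable_mkcond _ _ _ mu _ (EFin \o Im_fun F) mD').1 F2.
Qed.

Lemma cmeasurable_cut D F : measurable D -> cmeasurable D F -> cmeasurable setT (cutoff D F).
Proof.
move=> mD [F1 F2]; split; rewrite ?Re_fun_cut ?Im_fun_cut;
exact/(measurable_restrictT _ mD).
Qed.

Lemma cintegral_reflect F (h : R) : cmeasurable setT F ->
  cintegral setT (fun x => F (h - x)) = cintegral setT F.
Proof.
move=> [F1 F2]; rewrite /cintegral /Re_fun /Im_fun.
by congr Complex;
 [rewrite (Rintegral_image_density ler01 (image_density_reflect h) F1)
 |rewrite (Rintegral_image_density ler01 (image_density_reflect h) F2)];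
 rewrite mul1r.
Qed.

Lemma image_density_shift (h : R) : image_density (fun x : R => x + h) 1.
Proof.
have := image_density_affine h (@ltr01 R); rewrite invr1.
by have -> : (fun x : R => 1 * x + h) = (fun x => x + h) by apply/funext => x; rewrite mul1r.
Qed.

Lemma cintegral_shift F (h : R) : cmeasurable setT F ->
  cintegral setT (fun x => F (x + h)) = cintegral setT F.
Proof.
move=> [F1 F2]; rewrite /cintegral /Re_fun /Im_fun.
by congr Complex;
 [rewrite (Rintegral_image_density ler01 (image_density_shift h) F1)
 |rewrite (Rintegral_image_density ler01 (image_density_shift h) F2)];
 rewrite mul1r.
Qed.

End ComplexIntegral.

(** * Associativity of convolution *)

Section ConvolutionOnTheLine.
Variable R : realType.
Notation mu := (@lebesgue_measure R).
Notation Re := complex.Re.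
Notation Im := complex.Im.
Implicit Types (A B C : R -> R[i]).

(** Tonelli: integrating in y first bounds the integral by
M times the product of the norms of a and b.  With c = 1 this is the integrand of
a convolution on the line, and with general c the integrand behind
associativity. *)
Lemma integrable_convolution_triple (a b c : R -> R) (t M : R) :
  mu.-integrable setT (EFin \o a) -> mu.-integrable setT (EFin \o b) ->
  measurable_fun [set: measurableTypeR R] c -> (forall x, `|c x| <= M) ->
  (mu \x mu)%E.-integrable setT
    (EFin \o (fun p : R * R => a p.1 * b (p.2 - p.1) * c (t - p.2))).
Proof.
move=> ai bi mc cM.
have ma : measurable_fun [set: measurableTypeR R] a.
  by apply/measurable_EFinP; exact: measurable_int ai.
have mb : measurable_fun [set: measurableTypeR R] b.
  by apply/measurable_EFinP; exact: measurable_int bi.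
have mf : measurable_fun [set: (measurableTypeR R * measurableTypeR R)%type]
    (EFin \o (fun p : R * R => a p.1 * b (p.2 - p.1) * c (t - p.2))).
  apply/measurable_EFinP; apply: measurable_funM; first apply: measurable_funM.
  - exact: measurableT_comp.
  - by apply: (measurableT_comp mb); apply: measurable_funB.
  - by apply: (measurableT_comp mc); apply: measurable_funB.
have mbx x : measurable_fun [set: measurableTypeR R] (fun y => b (y - x)).
  by apply: (measurableT_comp mb); apply: measurable_funB.
have mct : measurable_fun [set: measurableTypeR R] (fun y => c (t - y)).
  by apply: (measurableT_comp mc); apply: measurable_funB.
apply/(integrable12ltyP _ _ mf).
have M0 : 0 <= M by exact: le_trans (cM 0).
have := bi => /integrableP[_ boo].
pose K := \int[mu]_x `|b x|.
have bK : (\int[mu]_x `|(b x)%:E| = K%:E)%E.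
  rewrite /K /Rintegral fineK// ge0_fin_numE// ?integral_ge0//.
apply: (@le_lt_trans _ _ (\int[mu]_x (`|(a x)%:E| * (M * K)%:E))%E).
  apply: ge0_le_integral => //.
  - by move=> x _; exact: integral_ge0.
  - apply: (@measurable_fun_fubini_tonelli_F _ _ _ _ _ mu (fun p => `|(a p.1 * b (p.2 - p.1) * c (t - p.2))%:E|%E)) => //.
    exact: measurableT_comp.
  - apply: emeasurable_funM => //; apply: measurableT_comp => //; exact/measurable_EFinP.
  - move=> x _.
    apply: (@le_trans _ _ (\int[mu]_y ((`|a x| * M)%:E * `|(b (y - x))%:E|))%E).
      apply: ge0_le_integral => //.
      + apply: measurableT_comp => //; apply/measurable_EFinP.
        apply: measurable_funM; first apply: measurable_funM.
        * exact: (@measurable_cst _ _ (measurableTypeR R) R setT (a x)).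
        * exact: mbx.
        * exact: mct.
      + apply: emeasurable_funM; first exact: (@measurable_cst _ _ (measurableTypeR R) _ setT).
        by apply: measurableT_comp => //; apply/measurable_EFinP; exact: mbx.
      + move=> y _ /=; rewrite -EFinM lee_fin !normrM -mulrA [leRHS]mulrAC -mulrA.
        by rewrite !ler_wpM2l.
    rewrite ge0_integralZl//; last 2 first.
    - by apply: measurableT_comp => //; apply/measurable_EFinP; exact: mbx.
    - by rewrite lee_fin mulr_ge0.
    have := @ge0_integral_image_density R (fun y => y + (- x)) 1 (fun y => `|(b y)%:E|%E) ler01.
    move=> -> //; last 2 first.
    - exact: image_density_shift.
    - by apply: measurableT_comp => //; exact/measurable_EFinP.
    by rewrite mul1e bK -EFinM -EFinM mulrA.
have MK0 : (0 <= (M * K)%:E)%E by rewrite lee_fin mulr_ge0// Rintegral_ge0.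
rewrite ge0_integralZr//; last first.
  by apply: measurableT_comp => //; exact/measurable_EFinP.
have /integrableP[_ aoo] := ai.
rewrite muleC; apply: lte_mul_pinfty => //.
Qed.

Lemma Rintegral_fubini (f : R * R -> R) : (mu \x mu)%E.-integrable setT (EFin \o f) ->
  [/\ \int[mu]_x \int[mu]_y f (x, y) = \int[mu]_y \int[mu]_x f (x, y),
      measurable_fun [set: measurableTypeR R] (fun y => \int[mu]_x f (x, y)) &
      {ae mu, forall y, mu.-integrable setT (EFin \o (fun x => f (x, y)))}].
Proof.
move=> fi.
have aeF : Filter (almost_everywhere mu) := ae_filter_ringOfSetsType mu.
have mF := measurable_fubini_F fi.
have mG := measurable_fubini_G fi.
have a1 := ae_integrable1 fi.
have a2 := ae_integrable2 fi.
have mG' : measurable_fun [set: measurableTypeR R] (fun y => \int[mu]_x f (x, y)).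
  exact: (measurableT_comp (@fine_measurable R setT measurableT) mG).
have mF' : measurable_fun [set: measurableTypeR R] (fun x => \int[mu]_y f (x, y)).
  exact: (measurableT_comp (@fine_measurable R setT measurableT) mF).
split; [|exact: mG'|exact: a2].
have E1 : (\int[mu]_x (\int[mu]_y f (x, y))%:E = \int[mu]_x \int[mu]_y (f (x, y))%:E)%E.
  apply: ae_eq_integral => //; first exact/measurable_EFinP.
  apply: filterS a1 => x xi _; rewrite /Rintegral fineK//.
  exact: (@integrable_fin_num _ _ _ mu setT).
have E2 : (\int[mu]_y (\int[mu]_x f (x, y))%:E = \int[mu]_y \int[mu]_x (f (x, y))%:E)%E.
  apply: ae_eq_integral => //; first exact/measurable_EFinP.
  apply: filterS a2 => x xi _; rewrite /Rintegral fineK//.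
  exact: (@integrable_fin_num _ _ _ mu setT).
rewrite {1}/Rintegral E1 {1}/Rintegral E2.
by have := Fubini fi => /= ->.
Qed.

Lemma ae_eq_cintegral A B : cmeasurable setT A -> cmeasurable setT B ->
  {ae mu, forall x, A x = B x} -> cintegral setT A = cintegral setT B.
Proof.
have aeF : Filter (almost_everywhere mu) := ae_filter_ringOfSetsType mu.
move=> [A1 A2] [B1 B2] AB; rewrite /cintegral /Rintegral; congr Complex; congr fine;
apply: ae_eq_integral => //; try exact/measurable_EFinP;
by apply: filterS AB => x ABx _; rewrite /Re_fun /Im_fun ABx.
Qed.

(** Both sides are iterated integrals of A x * B (y - x) * C (t - y).  On the
left the inner integral exists for almost every y only, which suffices because
the outer one ignores null sets. *)
Lemma convolution_line_assoc A B C (t M : R) :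
  cintegrable setT A -> cintegrable setT B -> cmeasurable setT C -> cbounded setT C M ->
  cintegral setT (fun y => cintegral setT (fun x => A x * B (y - x)) * C (t - y)) =
  cintegral setT (fun x => A x * cintegral setT (fun y => B y * C (t - x - y))).
Proof.
move=> Ai Bi mC CM; have [A1 A2] := Ai; have [B1 B2] := Bi; have [C1 C2] := mC.
have aeF : Filter (almost_everywhere mu) := ae_filter_ringOfSetsType mu.
pose Phi (p : R * R) := A p.1 * B (p.2 - p.1) * C (t - p.2).
pose Psi (p : R * R) := A p.1 * B (p.2 - p.1).
have C1M x : `|Re_fun C x| <= M by have [] := CM x I.
have C2M x : `|Im_fun C x| <= M by have [] := CM x I.
have iD (f g : R * R -> R) : (mu \x mu)%E.-integrable setT (EFin \o f) ->
    (mu \x mu)%E.-integrable setT (EFin \o g) ->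
    (mu \x mu)%E.-integrable setT (EFin \o (fun p => f p + g p)).
  by move=> fi gi; have := integrableD measurableT fi gi.
have iB (f g : R * R -> R) : (mu \x mu)%E.-integrable setT (EFin \o f) ->
    (mu \x mu)%E.-integrable setT (EFin \o g) ->
    (mu \x mu)%E.-integrable setT (EFin \o (fun p => f p - g p)).
  by move=> fi gi; have := integrableB measurableT fi gi.
have PhiR : (mu \x mu)%E.-integrable setT (EFin \o (fun p => Re (Phi p))).
  have := iB _ _ (iB _ _ (integrable_convolution_triple t A1 B1 C1 C1M) (integrable_convolution_triple t A2 B2 C1 C1M))
    (iD _ _ (integrable_convolution_triple t A1 B2 C2 C2M) (integrable_convolution_triple t A2 B1 C2 C2M)).
  congr (integrable _ _ (EFin \o _)); apply/funext => p.
  by rewrite /Phi !cE /Re_fun /Im_fun mulrBl mulrDl.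
have PhiI : (mu \x mu)%E.-integrable setT (EFin \o (fun p => Im (Phi p))).
  have := iD _ _ (iB _ _ (integrable_convolution_triple t A1 B1 C2 C2M) (integrable_convolution_triple t A2 B2 C2 C2M))
    (iD _ _ (integrable_convolution_triple t A1 B2 C1 C1M) (integrable_convolution_triple t A2 B1 C1 C1M)).
  congr (integrable _ _ (EFin \o _)); apply/funext => p.
  by rewrite /Phi !cE /Re_fun /Im_fun mulrBl mulrDl.
have m1 : measurable_fun [set: measurableTypeR R] (fun _ : R => 1 : R) by [].
have b1 (x : R) : `|1 : R| <= 1 by rewrite normr1.
have PsiR : (mu \x mu)%E.-integrable setT (EFin \o (fun p => Re (Psi p))).
  have := iB _ _ (integrable_convolution_triple 0 A1 B1 m1 b1) (integrable_convolution_triple 0 A2 B2 m1 b1).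
  congr (integrable _ _ (EFin \o _)); apply/funext => p.
  by rewrite /Psi !cE /Re_fun /Im_fun !mulr1.
have PsiI : (mu \x mu)%E.-integrable setT (EFin \o (fun p => Im (Psi p))).
  have := iD _ _ (integrable_convolution_triple 0 A1 B2 m1 b1) (integrable_convolution_triple 0 A2 B1 m1 b1).
  congr (integrable _ _ (EFin \o _)); apply/funext => p.
  by rewrite /Psi !cE /Re_fun /Im_fun !mulr1.
have [FR mR _] := Rintegral_fubini PhiR.
have [FI mI _] := Rintegral_fubini PhiI.
have [_ mR' aR] := Rintegral_fubini PsiR.
have [_ mI' aI] := Rintegral_fubini PsiI.
have mCt : cmeasurable setT (fun y => C (t - y)).
  by split; [apply: (measurableT_comp C1)|apply: (measurableT_comp C2)];
    apply: measurable_funB.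
have [mCt1 mCt2] := mCt.
transitivity (cintegral setT (fun y => cintegral setT (fun x => Phi (x, y)))).
  apply: ae_eq_cintegral.
  - split.
    + have -> : Re_fun (fun y => cintegral setT (fun x => A x * B (y - x)) * C (t - y)) =
        (fun y => \int[mu]_x Re (Psi (x, y)) * Re_fun (fun y => C (t - y)) y -
                  \int[mu]_x Im (Psi (x, y)) * Im_fun (fun y => C (t - y)) y).
        by apply/funext => y; rewrite /Re_fun /Im_fun cE.
      by apply: measurable_funB; apply: measurable_funM.
    + have -> : Im_fun (fun y => cintegral setT (fun x => A x * B (y - x)) * C (t - y)) =
        (fun y => \int[mu]_x Re (Psi (x, y)) * Im_fun (fun y => C (t - y)) y +
                  \int[mu]_x Im (Psi (x, y)) * Re_fun (fun y => C (t - y)) y).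
        by apply/funext => y; rewrite /Re_fun /Im_fun cE.
      by apply: measurable_funD; apply: measurable_funM.
  - by split.
  - apply: filterS2 aR aI => y yR yI.
    by rewrite -cintegralZr; [exact: erefl|exact: measurableT|exact: (conj yR yI)].
transitivity (cintegral setT (fun x => cintegral setT (fun y => Phi (x, y)))).
  by rewrite /cintegral /Re_fun /Im_fun/= FR FI.
apply: eq_cintegral => x _.
pose F z := B z * C (t - x - z).
have mF : cmeasurable setT F.
  have mCx : cmeasurable setT (fun z => C (t - x - z)).
    by split; [apply: (measurableT_comp C1)|apply: (measurableT_comp C2)];
    apply: measurable_funB.
  apply: cintegrable_meas; apply: (@cintegrableMb _ _ _ _ M measurableT Bi mCx).
  by move=> z _; apply: CM.
rewrite -(cintegral_shift (- x) mF) -cintegralZl; last 2 first.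
- exact: measurableT.
- apply: (@eq_cintegrable _ _ (fun y => B (y - x) * C (t - y)) _ measurableT).
    by move=> y _; rewrite /F opprB [_ + (x - y)]addrA subrK.
  apply: (@cintegrableMb _ _ (fun y => B (y - x)) _ M measurableT _ mCt); last by move=> y _; apply: CM.
  split; have := image_density_shift (- x).
  + by move=> /(integrable_image_density ler01)/(_ B1).
  + by move=> /(integrable_image_density ler01)/(_ B2).
by apply: eq_cintegral => y _; rewrite /Phi /F /= mulrA opprB [_ + (x - y)]addrA subrK.
Qed.

End ConvolutionOnTheLine.

Section Convolution.
Variable R : realType.
Notation mu := (@lebesgue_measure R).
Implicit Types (a b c : R -> R[i]) (t y M : R).

Lemma cut_itvE a t x : cutoff `[0, t] a x = if 0 <= x <= t then a x else 0.
Proof. by rewrite /cutoff mem_setE in_itv. Qed.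

Lemma convolution_line a b t y : y <= t ->
  convolution a b y = cintegral setT (fun x => cutoff `[0, t] a x * cutoff `[0, t] b (y - x)).
Proof.
move=> yt; rewrite /convolution cintegral_mkcond; apply: eq_cintegral => x _.
rewrite !cut_itvE; case: (boolP (0 <= x <= y)) => [/andP[x0 xy]|].
  rewrite x0 (le_trans xy yt) /= subr_ge0 xy /= lerBlDl.
  by rewrite (le_trans yt)// lerDr.
case: (boolP (0 <= x <= t)) => [/andP[x0 xt]|]; last by rewrite mul0r.
by rewrite x0 /= -subr_ge0 => /negbTE ->; rewrite mulr0.
Qed.

Lemma convolution_lt0 a b t y : y < 0 ->
  cintegral setT (fun x => cutoff `[0, t] a x * cutoff `[0, t] b (y - x)) = 0.
Proof.
move=> y0; rewrite (@eq_cintegral _ _ _ (fun=> 0)).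
  by rewrite /cintegral /Re_fun /Im_fun /= /Rintegral integral0.
move=> x _; rewrite !cut_itvE; case: ifPn => [/andP[x0 xt]|]; last by rewrite mul0r.
by rewrite subr_ge0 leNgt (lt_le_trans y0 x0) mulr0.
Qed.

Lemma convolution_line0 a b t y : y <= t ->
  cintegral setT (fun x => cutoff `[0, t] a x * cutoff `[0, t] b (y - x)) =
  if 0 <= y then convolution a b y else 0.
Proof.
move=> yt; case: ifPn => [y0|]; first by rewrite (convolution_line _ _ yt).
by rewrite -ltNge; exact: convolution_lt0.
Qed.

Lemma convolution_comm a b t : cmeasurable `[0, t] a -> cmeasurable `[0, t] b ->
  convolution a b t = convolution b a t.
Proof.
move=> ma mb; rewrite !(convolution_line _ _ (lexx t)).
have [A1 A2] := @cmeasurable_cut _ `[0, t] a (measurable_itv _) ma.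
have [B1 B2] := @cmeasurable_cut _ `[0, t] b (measurable_itv _) mb.
have mr : measurable_fun [set: measurableTypeR R] (fun x : R => t - x) by apply: measurable_funB.
have B1' : measurable_fun [set: measurableTypeR R] (fun x => Re_fun (cutoff `[0, t] b) (t - x)) by exact: (measurableT_comp B1).
have B2' : measurable_fun [set: measurableTypeR R] (fun x => Im_fun (cutoff `[0, t] b) (t - x)) by exact: (measurableT_comp B2).
rewrite -(cintegral_reflect t); last first.
  split.
  - rewrite (_ : Re_fun _ = fun x => Re_fun (cutoff `[0, t] a) x * Re_fun (cutoff `[0, t] b) (t - x)
     - Im_fun (cutoff `[0, t] a) x * Im_fun (cutoff `[0, t] b) (t - x)); last first.
      by apply/funext => x; rewrite /Re_fun /Im_fun cE.
    by apply: measurable_funB; apply: measurable_funM.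
  - rewrite (_ : Im_fun _ = fun x => Re_fun (cutoff `[0, t] a) x * Im_fun (cutoff `[0, t] b) (t - x)
     + Im_fun (cutoff `[0, t] a) x * Re_fun (cutoff `[0, t] b) (t - x)); last first.
      by apply/funext => x; rewrite /Re_fun /Im_fun cE.
    by apply: measurable_funD; apply: measurable_funM.
by apply: eq_cintegral => x _; rewrite mulrC opprB addrC subrK.
Qed.

(** Cutting all three functions off at t changes neither iterated convolution at
the point t, so associativity on the line applies. *)
Lemma convolution_assoc a b c t M :
  cintegrable `[0, t] a -> cintegrable `[0, t] b ->
  cmeasurable `[0, t] c -> cbounded `[0, t] c M ->
  convolution (convolution a b) c t = convolution a (convolution b c) t.
Proof.
move=> ai bi mc cM.
have CM : cbounded setT (cutoff `[0, t] c) (Num.max M 0).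
  move=> x _; rewrite cut_itvE; case: ifPn => [xt|_ /=]; last by rewrite normr0 le_max lexx orbT.
  have [] : `|complex.Re (c x)| <= M /\ `|complex.Im (c x)| <= M.
    by apply: cM; rewrite /= in_itv.
  by rewrite !le_max => -> ->.
have mI : measurable (`[0, t]%classic : set (measurableTypeR R)) by exact: measurable_itv.
have := @convolution_line_assoc _ (cutoff `[0, t] a) (cutoff `[0, t] b) (cutoff `[0, t] c) t _
  (cintegrable_mkcond mI ai) (cintegrable_mkcond mI bi) (cmeasurable_cut mI mc) CM.
rewrite (convolution_line (convolution a b) c (lexx t)) (convolution_line a (convolution b c) (lexx t)) => E.
rewrite [LHS](_ : _ = cintegral setT (fun y =>
   cintegral setT (fun x => cutoff `[0, t] a x * cutoff `[0, t] b (y - x)) * cutoff `[0, t] c (t - y))).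
  rewrite E; apply: eq_cintegral => x _.
  rewrite [cutoff `[0, t] a x]cut_itvE; case: ifPn => [/andP[x0 xt]|]; last by rewrite !mul0r.
  rewrite convolution_line0; last by rewrite lerBlDr lerDl.
  by rewrite subr_ge0 xt cut_itvE subr_ge0 xt lerBlDr lerDl x0.
apply: eq_cintegral => y _.
rewrite [cutoff `[0, t] c (t - y)]cut_itvE.
case: ifPn => [/andP[]|]; last by rewrite !mulr0.
rewrite subr_ge0 lerBlDr lerDl => yt y0.
by rewrite convolution_line0// y0 cut_itvE y0 yt.
Qed.

End Convolution.

(** * Exponential weights and primitives *)

Section Exponentials.
Variable R : realType.
Notation mu := (@lebesgue_measure R).
Notation Re := complex.Re.
Notation Im := complex.Im.
Implicit Types (p q s z w : R[i]) (t x y T : R).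

Lemma Rintegral_derivative (F f : R -> R) T : 0 <= T ->
  (forall x : R, is_derive x 1 F (f x)) -> continuous f ->
  mu.-integrable `[0, T] (EFin \o f) /\ \int[mu]_(x in `[0, T]) f x = F T - F 0.
Proof.
move=> T0 dF cf.
have fi : mu.-integrable `[0, T] (EFin \o f).
  apply: continuous_compact_integrable; first exact: segment_compact.
  exact: continuous_subspaceT.
split => //; move: T0; rewrite le_eqVlt => /predU1P[<-|T0].
  by rewrite set_itv1 Rintegral_set1 subrr.
rewrite /Rintegral (@continuous_FTC2 _ f F 0 T)//.
- exact: continuous_subspaceT.
- have cF : continuous F.
    by move=> x; apply/differentiable_continuous/derivable1_diffP; have [] := dF x.
  split => //.
  + by apply: cvg_at_right_filter; exact: cF.
  + by apply: cvg_at_left_filter; exact: cF.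
- by move=> x _; rewrite derive1E; have [_ ->] := dF x.
Qed.

Lemma cexpD z w : cexp (z + w) = cexp z * cexp w.
Proof.
apply: complexP; rewrite cE /= !cE expRD ?cosD ?sinD; ring.
Qed.

(** The Laplace weight e^(-pt).  It is multiplicative in t, hence commutes with
convolution. *)
Definition expw p t : R[i] := cexp (- p * t%:C).

Lemma Re_expw p t : Re (expw p t) = expR (- (Re p * t)) * cos (Im p * t).
Proof. by rewrite /expw /cexp /= !cE /= mulr0 subr0 mulNr mulr0 add0r mulNr cosN. Qed.
Lemma Im_expw p t : Im (expw p t) = - (expR (- (Re p * t)) * sin (Im p * t)).
Proof. by rewrite /expw /cexp /= !cE /= mulr0 subr0 mulNr mulr0 add0r mulNr sinN mulrN. Qed.

Lemma expw0 p : expw p 0 = 1.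
Proof. by apply: complexP; rewrite ?Re_expw ?Im_expw !mulr0 oppr0 expR0 ?cos0 ?sin0 ?mulr1 ?mulr0 ?oppr0. Qed.

Lemma expwD p x y : expw p (x + y) = expw p x * expw p y.
Proof. by rewrite /expw -cexpD rmorphD /= mulrDr. Qed.

Lemma expwDl p q x : expw (p + q) x = expw p x * expw q x.
Proof. by rewrite /expw -cexpD opprD mulrDl. Qed.

Lemma expw_bound p t : `|Re (expw p t)| <= expR (- (Re p * t)) /\
  `|Im (expw p t)| <= expR (- (Re p * t)).
Proof.
rewrite Re_expw Im_expw normrN !normrM ger0_norm ?expR_ge0//.
split; rewrite ler_piMr ?expR_ge0// ler_norml.
- by rewrite cos_geN1 cos_le1.
- by rewrite sin_geN1 sin_le1.
Qed.

Lemma is_derive_Re_expw p x : is_derive x 1 (Re_fun (expw p)) (Re (- p * expw p x)).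
Proof.
rewrite (_ : Re_fun _ = (fun t => expR (- (Re p * t)) * cos (Im p * t))); last first.
  by apply/funext => t; rewrite -Re_expw.
have d1 : is_derive x 1 (fun t : R => - (Re p * t)) (- Re p).
  by apply: is_derive_eq; rewrite scaler1.
have d2 : is_derive x 1 (fun t : R => Im p * t) (Im p).
  by apply: is_derive_eq; rewrite scaler1.
have d3 := @is_derive1_comp _ (@expR R) (fun t : R => - (Re p * t)) x _ _ (is_derive_expR _) d1.
have d4 := @is_derive1_comp _ (@cos R) (fun t : R => Im p * t) x _ _ (is_derive_cos _) d2.
apply: is_derive_eq.
rewrite !cE Re_expw Im_expw /GRing.scale /=; ring.
Qed.

Lemma is_derive_Im_expw p x : is_derive x 1 (Im_fun (expw p)) (Im (- p * expw p x)).
Proof.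
rewrite (_ : Im_fun _ = (fun t => - (expR (- (Re p * t)) * sin (Im p * t)))); last first.
  by apply/funext => t; rewrite -Im_expw.
have d1 : is_derive x 1 (fun t : R => - (Re p * t)) (- Re p).
  by apply: is_derive_eq; rewrite scaler1.
have d2 : is_derive x 1 (fun t : R => Im p * t) (Im p).
  by apply: is_derive_eq; rewrite scaler1.
have d3 := @is_derive1_comp _ (@expR R) (fun t : R => - (Re p * t)) x _ _ (is_derive_expR _) d1.
have d4 := @is_derive1_comp _ (@sin R) (fun t : R => Im p * t) x _ _ (is_derive_sin _) d2.
apply: is_derive_eq.
rewrite !cE Re_expw Im_expw /GRing.scale /=; ring.
Qed.

Lemma continuous_Re_expw p : continuous (Re_fun (expw p)).
Proof.
move=> x; apply/differentiable_continuous/derivable1_diffP.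
by have [] := is_derive_Re_expw p x.
Qed.

Lemma continuous_Im_expw p : continuous (Im_fun (expw p)).
Proof.
move=> x; apply/differentiable_continuous/derivable1_diffP.
by have [] := is_derive_Im_expw p x.
Qed.

Lemma cmeasurable_expw p (D : set R) : measurable D -> cmeasurable D (expw p).
Proof.
move=> mD; split; apply: measurable_funTS; apply: continuous_measurable_fun.
- exact: continuous_Re_expw.
- exact: continuous_Im_expw.
Qed.

Lemma cbounded_expw p T : cbounded `[0, T] (expw p) (expR (`|Re p| * `|T|)).
Proof.
move=> t /=; rewrite in_itv /= => /andP[t0 tT].
have [] := expw_bound p t.
have h : expR (- (Re p * t)) <= expR (`|Re p| * `|T|).
  rewrite ler_expR (le_trans (ler_norm _))// normrN normrM ler_wpM2l//.
  by rewrite !ger0_norm// (le_trans t0).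
by move=> h1 h2; split; exact: le_trans h.
Qed.

Lemma integral_expw p T : 0 <= T ->
  cintegrable `[0, T] (fun x => p * expw p x) /\
  cintegral `[0, T] (fun x => p * expw p x) = 1 - expw p T.
Proof.
move=> T0.
have cR : continuous (fun x => Re (- p * expw p x)).
  move=> x; rewrite (_ : (fun _ => _) = (fun x => Re (- p) * Re_fun (expw p) x - Im (- p) * Im_fun (expw p) x)).
    by apply: cvgB; apply: cvgM; [exact: cvg_cst|exact: continuous_Re_expw|exact: cvg_cst|exact: continuous_Im_expw].
  by apply/funext => y; rewrite cReM.
have cI : continuous (fun x => Im (- p * expw p x)).
  move=> x; rewrite (_ : (fun _ => _) = (fun x => Re (- p) * Im_fun (expw p) x + Im (- p) * Re_fun (expw p) x)).
    by apply: cvgD; apply: cvgM; [exact: cvg_cst|exact: continuous_Im_expw|exact: cvg_cst|exact: continuous_Re_expw].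
  by apply/funext => y; rewrite cImM.
have [i1 e1] := Rintegral_derivative T0 (is_derive_Re_expw p) cR.
have [i2 e2] := Rintegral_derivative T0 (is_derive_Im_expw p) cI.
have ni : cintegrable `[0, T] (fun x => - p * expw p x) by split.
have pi : cintegrable `[0, T] (fun x => p * expw p x).
  apply: (@eq_cintegrable _ _ (fun x => - (- p * expw p x)) _ (measurable_itv _)).
    by move=> x _; rewrite mulNr opprK.
  exact: cintegrableN.
split; first exact: pi.
have : cintegral `[0, T] (fun x => - p * expw p x) = expw p T - 1.
  apply: complexP.
  - by apply: (etrans e1); rewrite /Re_fun expw0 cE.
  - by apply: (etrans e2); rewrite /Im_fun expw0 cE.
move=> /(congr1 -%R); rewrite opprB => <-.
rewrite -cintegralN; [|exact: measurable_itv|exact: ni].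
by apply: eq_cintegral => x _; rewrite mulNr opprK.
Qed.

End Exponentials.

Section Primitive.
Variable R : realType.
Notation mu := (@lebesgue_measure R).
Notation Re := complex.Re.
Notation Im := complex.Im.
Implicit Types (u v a b : R -> R[i]) (p q s z w : R[i]) (t x y T M : R).

(** Integration is convolution with the constant function 1 (convolution_one), so
that its rules follow from associativity and commutativity of convolution. *)
Definition prim u t : R[i] := cintegral `[0, t] u.
Definition unitfun : R -> R[i] := fun=> 1.

Lemma convolution_one u t : convolution u unitfun t = prim u t.
Proof. by apply: eq_cintegral => x _; rewrite mulr1. Qed.

Lemma subset_itv0 t T : t <= T -> `[0, t]%classic `<=` `[0, T]%classic.
Proof. by move=> tT x; rewrite /= !in_itv /= => /andP[-> /le_trans]; apply. Qed.

Lemma cintegrable_sub u t T : t <= T -> cintegrable `[0, T] u -> cintegrable `[0, t] u.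
Proof. by move=> tT; apply: cintegrableS; [exact: measurable_itv..|exact: subset_itv0]. Qed.

Lemma cmeasurableS (D E : set R) u : measurable D -> E `<=` D -> cmeasurable D u -> cmeasurable E u.
Proof. by move=> mD ED [u1 u2]; split; [exact: measurable_funS u1|exact: measurable_funS u2]. Qed.

Lemma within_continuous_prim u T : 0 <= T -> cintegrable `[0, T] u ->
  {within `[0, T], continuous (Re_fun (prim u))} /\
  {within `[0, T], continuous (Im_fun (prim u))}.
Proof.
by move=> T0 [u1 u2]; split; [exact: (parameterized_integral_continuous T0 u1)|
  exact: (parameterized_integral_continuous T0 u2)].
Qed.

Lemma cmeasurable_prim u T : cintegrable `[0, T] u -> cmeasurable `[0, T] (prim u).
Proof.
have [T0 ui|T0 _] := leP 0 T; last first.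
  by rewrite set_itv_ge ?bnd_simp -?ltNge//; split; exact: measurable_fun_set0.
have [u1 u2] := within_continuous_prim T0 ui.
by split; apply: subspace_continuous_measurable_fun => //.
Qed.

Lemma Rintegral_norm_le (f : R -> R) t T : t <= T -> mu.-integrable `[0, T] (EFin \o f) ->
  `|\int[mu]_(x in `[0, t]) f x| <= \int[mu]_(x in `[0, T]) `|f x|.
Proof.
move=> tT fi.
have fit : mu.-integrable `[0, t] (EFin \o f).
  by apply: integrableS fi => //; exact: subset_itv0.
apply: (le_trans (le_normr_Rintegral _ fit)) => //.
have ni := integrable_norm fi.
have nit := integrable_norm fit.
rewrite /Rintegral fine_le//.
- exact: (@integrable_fin_num _ _ _ mu _ _ _ nit).
- exact: (@integrable_fin_num _ _ _ mu _ _ _ ni).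
apply: ge0_subset_integral => //; last exact: subset_itv0.
by have := measurable_int _ ni.
Qed.

Lemma cbounded_prim u T : cintegrable `[0, T] u -> exists M, cbounded `[0, T] (prim u) M.
Proof.
move=> [u1 u2]; exists (Num.max (\int[mu]_(x in `[0, T]) `|Re_fun u x|)
   (\int[mu]_(x in `[0, T]) `|Im_fun u x|)).
move=> x; rewrite /= in_itv /= => /andP[_ xT].
by rewrite !le_max !Rintegral_norm_le ?orbT.
Qed.

Lemma bounded_cintegrable u T M : cmeasurable `[0, T] u -> cbounded `[0, T] u M ->
  cintegrable `[0, T] u.
Proof.
move=> [u1 u2] uM.
have fin : (mu `[0%R, T]%classic < +oo)%E.
  by rewrite lebesgue_measure_itv/=; case: ifPn => // _; rewrite -EFinB ltry.
split; apply: measurable_bounded_integrable => //; exists M; split; [exact: num_real| |exact: num_real|].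
- by move=> y My x Dx; have [h1 _] := uM x Dx; exact: (le_trans h1 (ltW My)).
- by move=> y My x Dx; have [_ h2] := uM x Dx; exact: (le_trans h2 (ltW My)).
Qed.

Lemma cintegrable_prim u T : cintegrable `[0, T] u -> cintegrable `[0, T] (prim u).
Proof.
move=> ui; have [M uM] := cbounded_prim ui.
exact: bounded_cintegrable (cmeasurable_prim ui) uM.
Qed.

Lemma unitfun_props T : [/\ cmeasurable `[0, T] unitfun, cbounded `[0, T] unitfun 1 & cintegrable `[0, T] unitfun].
Proof.
have m : cmeasurable `[0, T] unitfun by split; exact: measurable_cst.
have b : cbounded `[0, T] unitfun 1 by move=> x _; rewrite /= normr1 normr0.
by split => //; exact: bounded_cintegrable m b.
Qed.

Lemma prim_convolution a b t : cintegrable `[0, t] a -> cintegrable `[0, t] b ->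
  prim (convolution a b) t = convolution a (prim b) t.
Proof.
move=> ai bi; have [m1 b1 i1] := unitfun_props t.
rewrite -convolution_one (convolution_assoc ai bi m1 b1).
by apply: eq_cintegral => x _; rewrite convolution_one.
Qed.

Lemma cintegrable_expw_mul p u T : cintegrable `[0, T] u ->
  cintegrable `[0, T] (fun x => expw p x * u x).
Proof.
move=> ui; have := cintegrableMb (measurable_itv _) ui (cmeasurable_expw p (measurable_itv _)) (@cbounded_expw _ p T).
by apply: eq_cintegrable => // x _; rewrite mulrC.
Qed.

(** e^(-pt) = e^(-px) e^(-p(t-x)) under the integral sign. *)
Lemma convolution_expw p a b t M : 0 <= t ->
  cintegrable `[0, t] a -> cmeasurable `[0, t] b -> cbounded `[0, t] b M ->
  convolution (fun x => expw p x * a x) (fun x => expw p x * b x) t =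
  expw p t * convolution a b t.
Proof.
move=> t0 ai [mb1 mb2] bM.
have bi : cintegrable `[0, t] (fun x => a x * b (t - x)).
  apply: (cintegrableMb (G := fun x => b (t - x)) (M := M) (measurable_itv _) ai).
    have sub : (fun x => t - x) @` `[0, t]%classic `<=` `[0, t]%classic.
      move=> _ [x /= xt <-]; move: xt; rewrite !in_itv /= subr_ge0 lerBlDr lerDl.
      by rewrite andbC.
    by split; [apply: (measurable_comp _ sub mb1)|apply: (measurable_comp _ sub mb2)];
      [exact: measurable_itv|apply: measurable_funB|exact: measurable_itv|apply: measurable_funB].
  move=> x /= xt; apply: bM; move: xt; rewrite /= !in_itv /= subr_ge0 lerBlDr lerDl.
  by rewrite andbC.
rewrite /convolution -cintegralZl; [|exact: measurable_itv|exact: bi].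
apply: eq_cintegral => x _.
have -> : expw p t = expw p x * expw p (t - x) by rewrite -expwD addrC subrK.
ring.
Qed.

(** Integration by parts for a u that is merely integrable: with w the function
p e^(-p(T-y)), the right-hand side is e^(-pT) prim u + (u * 1) * w at T, and 1 * w
at T - x is e^(-px) - e^(-pT). *)
Lemma integral_expw_mul p u T : 0 <= T -> cintegrable `[0, T] u ->
  prim (fun x => expw p x * u x) T =
  expw p T * prim u T + p * prim (fun x => expw p x * prim u x) T.
Proof.
move=> T0 ui.
pose w y := p * expw p (T - y).
have sub (t : R) : (fun x => t - x) @` `[0, t]%classic `<=` `[0, t]%classic.
  move=> _ [x /= xt <-]; move: xt; rewrite !in_itv /= subr_ge0 lerBlDr lerDl.
  by rewrite andbC.
have mw : cmeasurable `[0, T] w.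
  have [h1 h2] := cmeasurable_expw p (measurable_itv `[0, T]).
  have m1 : measurable_fun `[0, T] (fun y => Re_fun (expw p) (T - y)).
    by apply: (measurable_comp _ (sub T) h1); [exact: measurable_itv|apply: measurable_funB].
  have m2 : measurable_fun `[0, T] (fun y => Im_fun (expw p) (T - y)).
    by apply: (measurable_comp _ (sub T) h2); [exact: measurable_itv|apply: measurable_funB].
  split.
  - rewrite (_ : Re_fun w = fun y => Re p * Re_fun (expw p) (T - y) - Im p * Im_fun (expw p) (T - y)).
      by apply: measurable_funB; apply: measurable_funM => //; exact: measurable_cst.
    by apply/funext => y; rewrite /Re_fun /w cE.
  - rewrite (_ : Im_fun w = fun y => Re p * Im_fun (expw p) (T - y) + Im p * Re_fun (expw p) (T - y)).
      by apply: measurable_funD; apply: measurable_funM => //; exact: measurable_cst.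
    by apply/funext => y; rewrite /Im_fun /w cE.
pose M0 := expR (`|Re p| * `|T|).
have bw : cbounded `[0, T] w ((`|Re p| + `|Im p|) * M0).
  move=> y Dy; have [] : `|Re (expw p (T - y))| <= M0 /\ `|Im (expw p (T - y))| <= M0.
    by apply: cbounded_expw; apply: sub; exists y.
  move=> h1 h2; rewrite /w !cE mulrDl; split.
  + by apply: (le_trans (ler_normB _ _)); rewrite (normrM (Re p)) (normrM (Im p)); apply: lerD; apply: ler_wpM2l.
  + by apply: (le_trans (ler_normD _ _)); rewrite (normrM (Re p)) (normrM (Im p)); apply: lerD; apply: ler_wpM2l.
have wi : cintegrable `[0, T] w by exact: bounded_cintegrable mw bw.
have [m1 b1 i1] := unitfun_props T.
have pw x : 0 <= x <= T -> prim w (T - x) = expw p x - expw p T.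
  move=> /andP[x0 xT]; have Tx0 : 0 <= T - x by rewrite subr_ge0.
  have [zi ze] := integral_expw (- p) Tx0.
  have eN y : expw p (T - y) = expw p T * expw (- p) y.
    rewrite expwD; congr (_ * _); apply: complexP; rewrite ?Re_expw ?Im_expw !cE.
    - by rewrite !mulrN !mulNr !cosN.
    - by rewrite !mulrN !mulNr !sinN.
  transitivity (cintegral `[0, T - x] (fun y => - expw p T * (- p * expw (- p) y))).
    by apply: eq_cintegral => y _; rewrite /w eN; ring.
  rewrite cintegralZl; [|exact: measurable_itv|exact: zi].
  rewrite ze mulrBr mulr1 mulNr -eN opprB addrC opprK.
  by rewrite addrCA subrr addr0.
have -> : prim (fun x => expw p x * u x) T =
    expw p T * prim u T + convolution u (convolution unitfun w) T.
  rewrite (_ : convolution u (convolution unitfun w) T = cintegral `[0, T] (fun x => u x * (expw p x - expw p T))); last first.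
    apply: eq_cintegral => x; rewrite /= in_itv /= => xT; congr (_ * _).
    have sxT : T - x <= T by have /andP[x0 _] := xT; rewrite lerBlDr lerDl.
    rewrite convolution_comm; last 2 first.
    - by apply: cmeasurableS m1; [exact: measurable_itv|exact: subset_itv0].
    - by apply: cmeasurableS mw; [exact: measurable_itv|exact: subset_itv0].
    by rewrite convolution_one pw.
  rewrite -cintegralZl; [|exact: measurable_itv|exact: ui].
  have e1 : cintegrable `[0, T] (fun x => u x * (expw p x - expw p T)).
    apply: (@eq_cintegrable _ _ (fun x => expw p x * u x - expw p T * u x) _ (measurable_itv _)).
      by move=> x _; ring.
    apply: cintegrableB; [exact: measurable_itv|exact: cintegrable_expw_mul|].
    by apply: cintegrableZl; [exact: measurable_itv|exact: ui].
  rewrite -cintegralD; [|exact: measurable_itv| |exact: e1].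
    by apply: eq_cintegral => x _; ring.
  by apply: cintegrableZl; [exact: measurable_itv|exact: ui].
congr (_ + _).
rewrite -(convolution_assoc ui i1 mw bw).
transitivity (cintegral `[0, T] (fun x => p * (expw p x * prim u x))).
  apply: eq_cintegral => x _; rewrite convolution_one /w opprB addrC subrK; ring.
rewrite cintegralZl; [by []|exact: measurable_itv|].
by apply: cintegrable_expw_mul; exact: cintegrable_prim.
Qed.

End Primitive.

(** * Averages at infinity *)

Section Limits.
Variable R : realType.
Notation mu := (@lebesgue_measure R).
Implicit Types (u v w k m : R -> R) (t x y T M : R).

Lemma Rintegral_le_const u a b M (D : set R) : 0 <= M -> a <= b ->
  measurable D -> D `<=` `[a, b] -> mu.-integrable `[a, b] (EFin \o u) ->
  (forall x, D x -> u x <= M) -> \int[mu]_(x in D) u x <= M * (b - a).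
Proof.
move=> M0 ab mD Dab ui uM.
have fin : (mu `[a, b]%classic = (b - a)%:E)%E.
  rewrite lebesgue_measure_itv/= lte_fin -EFinB.
  by move: ab; rewrite le_eqVlt => /predU1P[->|->//]; rewrite ltxx subrr.
have finD : (mu D <= (b - a)%:E)%E by rewrite -fin; apply: le_measure => //; rewrite inE.
have finD' : (mu D < +oo)%E by apply: le_lt_trans finD _; rewrite ltry.
apply: (@le_trans _ _ (\int[mu]_(x in D) M)).
  apply: le_Rintegral => //.
    by apply: integrableS ui => //.
  apply: measurable_bounded_integrable => //.
  exact: bounded_cst.
rewrite Rintegral_cst// ler_wpM2l// -lee_fin fineK// ge0_fin_numE//.
Qed.

Lemma Rintegral_reflect u T : measurable_fun (`[0, T]%classic : set (measurableTypeR R)) u ->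
  \int[mu]_(x in `[0, T]) u (T - x) = \int[mu]_(x in `[0, T]) u x.
Proof.
move=> mu_; rewrite Rintegral_mkcond [RHS]Rintegral_mkcond.
have mI : measurable (`[0, T]%classic : set (measurableTypeR R)) by exact: measurable_itv.
have h := (measurable_restrictT u mI).1 mu_.
have := Rintegral_image_density ler01 (image_density_reflect T) h.
rewrite mul1r => <-; apply: eq_Rintegral => x _; rewrite !patchE !mem_setE !in_itv /=.
by rewrite subr_ge0 lerBlDr lerDl andbC.
Qed.

(** Beyond some T1 the integrand is below e / 2, and the integral over [0, T1] is
negligible after division by T. *)
Lemma cesaro_norm w M : (forall T, mu.-integrable `[0, T] (EFin \o w)) ->
  (forall x, 0 <= x -> `|w x| <= M) -> w x @[x --> +oo] --> 0 ->
  T^-1 * \int[mu]_(x in `[0, T]) `|w x| @[T --> +oo] --> 0.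
Proof.
move=> wi wM w0; apply/cvgr0Pnorm_le => e e0.
have M0 : 0 <= M by exact: le_trans (wM 0 (lexx 0)).
have e20 : 0 < e / 2 by rewrite divr_gt0.
have /cvgr0Pnorm_le /(_ _ e20) [T0 [_ hT0]] := w0.
pose T1 := Num.max (T0 + 1) 1.
have T10 : 0 < T1 by rewrite lt_max ltr01 orbT.
near=> T.
have T0' : 0 < T by near: T; apply: nbhs_pinfty_gt; exact: num_real.
have T1T : T1 < T by near: T; apply: nbhs_pinfty_gt; exact: num_real.
have ni : mu.-integrable `[0, T] (EFin \o (fun x => `|w x|)) by exact: integrable_norm.
have ni1 : mu.-integrable `[0, T1] (EFin \o (fun x => `|w x|)) by exact: integrable_norm.
rewrite normrM gtr0_norm ?invr_gt0// ger0_norm; last exact: Rintegral_ge0.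
rewrite mulrC ler_pdivrMr//.
have := @Rintegral_itvB R _ (BLeft 0) (BRight T) T1 ni.
rewrite !bnd_simp (ltW T10) => /(_ isT (ltW T1T)) /eqP; rewrite subr_eq => /eqP ->.
have h1 : \int[mu]_(x in `[0, T1]) `|w x| <= M * (T1 - 0).
  apply: Rintegral_le_const => //; first exact: ltW.
  by move=> x; rewrite /= in_itv /= => /andP[/wM].
have h2 : \int[mu]_(x in `]T1, T]) `|w x| <= e / 2 * (T - 0).
  apply: (@Rintegral_le_const (fun x => `|w x|) 0 T (e / 2) _ (ltW e20) (ltW T0') (measurable_itv _) _ ni).
    move=> x; rewrite /= !in_itv /= => /andP[x1 ->]; rewrite andbT.
    by rewrite (le_trans (ltW T10))// ltW.
  move=> x; rewrite /= in_itv /= => /andP[x1 _]; apply: hT0.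
  by apply: le_lt_trans x1; rewrite le_max lerDl ler01.
have h3 : M * T1 <= e / 2 * T.
  rewrite mulrC -ler_pdivrMl//; near: T; apply: nbhs_pinfty_ge; exact: num_real.
rewrite !subr0 in h1 h2.
apply: (le_trans (lerD h2 h1)).
by apply: (le_trans (lerD (lexx _) h3)); rewrite -mulrDl -splitr.
Unshelve. all: by end_near. Qed.

(** u(x) v(T - x) - U V = (u(x) - U) v(T - x) + U (v(T - x) - V), and the average
of each term on the right is controlled by cesaro_norm; for the second one the
variable is reflected. *)
Lemma conv_cesaro u v (U V : R) M :
  (forall T, measurable_fun (`[0, T]%classic : set (measurableTypeR R)) u) ->
  (forall T, measurable_fun (`[0, T]%classic : set (measurableTypeR R)) v) ->
  (forall x, 0 <= x -> `|u x| <= M) -> (forall x, 0 <= x -> `|v x| <= M) ->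
  u x @[x --> +oo] --> U -> v x @[x --> +oo] --> V ->
  T^-1 * \int[mu]_(x in `[0, T]) (u x * v (T - x)) @[T --> +oo] --> U * V.
Proof.
move=> mU mV uM vM uU vV.
have M0 : 0 <= M by exact: le_trans (uM 0 (lexx 0)).
have bi (w : R -> R) C T : measurable_fun (`[0, T]%classic : set (measurableTypeR R)) w ->
    (forall x, 0 <= x <= T -> `|w x| <= C) -> mu.-integrable `[0, T] (EFin \o w).
  move=> mw wC.
  have fin : (mu `[0%R, T]%classic < +oo)%E.
    by rewrite lebesgue_measure_itv/=; case: ifPn => // _; rewrite -EFinB ltry.
  apply: measurable_bounded_integrable => //.
  exists C; split; first exact: num_real.
  move=> y Cy x; rewrite /= in_itv /= => /wC h; exact: le_trans (ltW Cy).
have bw (w : R -> R) (W : R) : (forall x, 0 <= x -> `|w x| <= M) ->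
    forall x, 0 <= x -> `|w x - W| <= M + `|W|.
  by move=> wM x /wM h; rewrite (le_trans (ler_normB _ _))// lerD2r.
have sub (w : R -> R) (W : R) : w x @[x --> +oo] --> W -> w x - W @[x --> +oo] --> 0.
  by move=> wW; rewrite -(subrr W); apply: cvgB => //; exact: cvg_cst.
have uUi T : mu.-integrable `[0, T] (EFin \o (fun x => u x - U)).
  apply: (bi _ (M + `|U|)); first by apply: measurable_funB.
  by move=> x /andP[x0 _]; exact: bw.
have vVi T : mu.-integrable `[0, T] (EFin \o (fun x => v x - V)).
  apply: (bi _ (M + `|V|)); first by apply: measurable_funB.
  by move=> x /andP[x0 _]; exact: bw.
have cu := cesaro_norm uUi (bw u U uM) (sub _ _ uU).
have cv := cesaro_norm vVi (bw v V vM) (sub _ _ vV).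
apply/subr_cvg0.
apply: (@norm_cvg0 _ _ _ _ _).
apply: (@squeeze_cvgr _ _ _ _ (cst 0) (fun T =>
   M * (T^-1 * \int[mu]_(x in `[0, T]) `|u x - U|) +
   `|U| * (T^-1 * \int[mu]_(x in `[0, T]) `|v x - V|))).
- near=> T; rewrite normr_ge0 /=.
  have T0 : 0 < T by near: T; apply: nbhs_pinfty_gt; exact: num_real.
  have rfl x : 0 <= x <= T -> 0 <= T - x <= T.
    by move=> /andP[x0 xT]; rewrite subr_ge0 xT lerBlDr lerDl.
  have mVT : measurable_fun (`[0, T]%classic : set (measurableTypeR R)) (fun x => v (T - x)).
    apply: (measurable_comp _ _ (mV T)); [exact: measurable_itv| |by apply: measurable_funB].
    by move=> _ [x /= xT <-]; move: xT; rewrite !in_itv /=; exact: rfl.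
  have vTi : mu.-integrable `[0, T] (EFin \o (fun x => v (T - x) - V)).
    apply: (bi _ (M + `|V|)); first by apply: measurable_funB.
    by move=> x /rfl/andP[x0 _]; exact: bw.
  have p1 : mu.-integrable `[0, T] (EFin \o (fun x => (u x - U) * v (T - x))).
    apply: (@integrableMb _ _ _ _ M) => //.
    by move=> x; rewrite /= in_itv /= => /rfl/andP[x0 _]; exact: vM.
  have -> : \int[mu]_(x in `[0, T]) (u x * v (T - x)) =
     \int[mu]_(x in `[0, T]) ((u x - U) * v (T - x)) +
     U * \int[mu]_(x in `[0, T]) (v (T - x) - V) + T * (U * V).
    rewrite -RintegralZl// -RintegralD//; last exact: RintegrableZl.
    have -> : T * (U * V) = \int[mu]_(x in `[0, T]) (U * V).
      have muT : (mu `[0%R, T]%classic = T%:E)%E by rewrite lebesgue_measure_itv /= lte_fin T0 -EFinB subr0.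
      rewrite Rintegral_cst//; transitivity (U * V * fine (mu `[0%R, T]%classic)); last by [].
      by rewrite muT mulrC.
    rewrite -RintegralD//; last 2 first.
    - by apply: RintegrableD => //; exact: RintegrableZl.
    - by apply: (bi _ `|U * V|).
    by apply: eq_Rintegral => x _; ring.
  have -> : T^-1 * (\int[mu]_(x in `[0, T]) ((u x - U) * v (T - x)) +
     U * \int[mu]_(x in `[0, T]) (v (T - x) - V) + T * (U * V)) - U * V =
     T^-1 * \int[mu]_(x in `[0, T]) ((u x - U) * v (T - x)) +
     U * (T^-1 * \int[mu]_(x in `[0, T]) (v (T - x) - V)).
    by field; rewrite gt_eqF.
  apply: (le_trans (ler_normD _ _)); rewrite !normrM (gtr0_norm (_ : 0 < T^-1)) ?invr_gt0//.
  apply: lerD.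
    rewrite [leRHS]mulrCA ler_wpM2l ?invr_ge0 ?(ltW T0)//.
    apply: (le_trans (le_normr_Rintegral _ p1)) => //.
    rewrite -RintegralZl//; last exact: integrable_norm.
    apply: le_Rintegral => //; first exact: integrable_norm.
      by apply: RintegrableZl => //; exact: integrable_norm.
    move=> x; rewrite /= in_itv /= => /rfl/andP[x0 _].
    by rewrite normrM mulrC ler_wpM2r// vM.
  rewrite ler_wpM2l// ler_wpM2l ?invr_ge0 ?(ltW T0)//.
  apply: (le_trans (le_normr_Rintegral _ vTi)) => //.
  rewrite (@Rintegral_reflect (fun x => `|v x - V|) T)//.
  by apply: measurableT_comp => //; apply: measurable_funB.
- exact: cvg_cst.
- rewrite -[X in _ --> X](addr0 0) -[X in _ --> X + _](mulr0 M) -[X in _ --> _ + X](mulr0 `|U|).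
  by apply: cvgD; apply: cvgM => //; exact: cvg_cst.
Unshelve. all: by end_near. Qed.

(** Dominated convergence along the continuous parameter T, reduced to sequences. *)
Lemma dominated_itvy (F : R -> R -> R) (k l : R -> R) :
  mu.-integrable `[0, +oo[ (EFin \o k) ->
  (forall T, measurable_fun (`[0, +oo[%classic : set (measurableTypeR R)) (F T)) ->
  measurable_fun (`[0, +oo[%classic : set (measurableTypeR R)) l ->
  (forall T x, 0 <= x -> `|F T x| <= k x) ->
  (forall x, 0 <= x -> F T x @[T --> +oo] --> l x) ->
  \int[mu]_(x in `[0, +oo[) F T x @[T --> +oo] --> \int[mu]_(x in `[0, +oo[) l x.
Proof.
move=> ki mF ml Fk Fl; apply/cvg_pinftyP => s soo.
have m1 n : measurable_fun (`[0, +oo[%classic : set (measurableTypeR R)) (fun x => (F (s n) x)%:E).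
  exact/measurable_EFinP.
have m2 : measurable_fun (`[0, +oo[%classic : set (measurableTypeR R)) (EFin \o l).
  exact/measurable_EFinP.
have c1 : {ae mu, forall x, `[0, +oo[%classic x -> (F (s n) x)%:E @[n --> \oo] --> (EFin \o l) x}.
  apply: aeW => x; rewrite /= in_itv /= andbT => x0.
  apply: cvg_EFin; first exact: nearW.
  exact: (cvg_pinftyP (fun T => F T x) (l x)).1 (Fl x x0) s soo.
have d1 : {ae mu, forall x n, `[0, +oo[%classic x -> (`|(F (s n) x)%:E| <= (EFin \o k) x)%E}.
  by apply: aeW => x n; rewrite /= in_itv /= andbT => x0; rewrite lee_fin; exact: Fk.
have [li _ cv] := @dominated_convergence _ _ _ mu _ (measurable_itv _)
  (fun n x => (F (s n) x)%:E) (EFin \o l) (EFin \o k) m1 m2 c1 ki d1.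
apply: fine_cvg; rewrite /Rintegral fineK; first exact: cv.
exact: (@integrable_fin_num _ _ _ mu _ _ _ li).
Qed.

Lemma itvS0y T : `[0, T]%classic `<=` (`[0, +oo[%classic : set R).
Proof. by move=> x; rewrite /= !in_itv /= => /andP[->]. Qed.

Lemma cvg_Rintegral_itvy (h : R -> R) : mu.-integrable `[0, +oo[ (EFin \o h) ->
  \int[mu]_(x in `[0, T]) h x @[T --> +oo] --> \int[mu]_(x in `[0, +oo[) h x.
Proof.
move=> hi; have mh : measurable_fun (`[0, +oo[%classic : set (measurableTypeR R)) h.
  by apply/measurable_EFinP; exact: measurable_int hi.
have E T : \int[mu]_(x in `[0, T]) h x = \int[mu]_(x in `[0, +oo[) (h \_ `[0, T]) x.
  by rewrite -Rintegral_mkcondr; congr (Rintegral _ _ _); apply/esym/setIidr/itvS0y.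
under eq_fun do rewrite E.
apply: (@dominated_itvy _ (fun x => `|h x|)) => //.
- exact: integrable_norm.
- move=> T; apply/(measurable_restrict _ _ _).1; [exact: measurable_itv|exact: measurable_itv|].
  by apply: measurable_funS mh => //; exact: subIsetl.
- by move=> T x _; rewrite patchE; case: ifP => // _; rewrite normr0.
- move=> x x0; apply: (@cvg_near_cst).
  near=> T; rewrite patchE mem_setE in_itv /= x0 /=.
  have -> // : x <= T by near: T; apply: nbhs_pinfty_ge; exact: num_real.
Unshelve. all: by end_near. Qed.

(** Divided by T, the integrand tends to k(x) Q and is dominated by C |k(x)|. *)
Lemma conv_kernel_cesaro (k m : R -> R) (Q C : R) : mu.-integrable `[0, +oo[ (EFin \o k) ->
  (forall T, measurable_fun (`[0, T]%classic : set (measurableTypeR R)) m) ->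
  (forall x, 0 <= x -> `|m x| <= C * x) ->
  x^-1 * m x @[x --> +oo] --> Q ->
  T^-1 * \int[mu]_(x in `[0, T]) (k x * m (T - x)) @[T --> +oo] -->
    Q * \int[mu]_(x in `[0, +oo[) k x.
Proof.
move=> ki mm mC mQ.
have C0 : 0 <= C by have := le_trans (normr_ge0 _) (mC 1 ler01); rewrite mulr1.
have mk : measurable_fun (`[0, +oo[%classic : set (measurableTypeR R)) k.
  by apply/measurable_EFinP; exact: measurable_int ki.
have mI T : measurable (`[0, T]%classic : set (measurableTypeR R)) by exact: measurable_itv.
have rfl T x : 0 <= x <= T -> 0 <= T - x <= T.
  by move=> /andP[x0 xT]; rewrite subr_ge0 xT lerBlDr lerDl.
have mkT T : measurable_fun (`[0, T]%classic : set (measurableTypeR R)) (fun x => k x * m (T - x)).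
  apply: measurable_funM; first by apply: measurable_funS mk => //; exact: itvS0y.
  apply: (measurable_comp (mI T) _ (mm T)); last by apply: measurable_funB.
  by move=> _ [x /= xT <-]; move: xT; rewrite !in_itv /=; exact: rfl.
pose F T x := ((fun x => T^-1 * (k x * m (T - x))) \_ `[0, T]) x.
have bnd T x : 0 <= x -> `|F T x| <= C * `|k x|.
  move=> x0; rewrite /F patchE mem_setE in_itv /= x0 /=; case: ifPn => [xT|_]; last first.
    by rewrite normr0 mulr_ge0.
  have : 0 <= T by exact: le_trans xT.
  rewrite le_eqVlt => /predU1P[<-|T0]; first by rewrite invr0 mul0r normr0 mulr_ge0.
  rewrite !normrM mulrCA [leRHS]mulrC ler_wpM2l//.
  rewrite gtr0_norm ?invr_gt0// mulrC ler_pdivrMr//.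
  by apply: (le_trans (mC _ _)); rewrite ?subr_ge0// ler_wpM2l// lerBlDr lerDl.
apply: (@cvg_trans _ ((\int[mu]_(x in `[0, +oo[) F T x) @[T --> +oo])).
  apply: near_eq_cvg; near=> T.
  have T0 : 0 < T by near: T; apply: nbhs_pinfty_gt; exact: num_real.
  rewrite -Rintegral_mkcondr.
  have -> : `[0, +oo[%classic `&` `[0, T]%classic = `[0, T]%classic :> set R.
    exact/setIidr/itvS0y.
  rewrite RintegralZl//.
  apply: (@le_integrable _ _ _ mu _ (mI T) _ (fun x => (C * T * `|k x|)%:E)).
  - exact/measurable_EFinP.
  - move=> x; rewrite /= in_itv /= => xT; rewrite lee_fin !normrM.
    rewrite (ger0_norm C0) (gtr0_norm T0) normr_id mulrC ler_wpM2r//.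
    have /andP[h1 h2] := rfl _ _ xT.
    by apply: (le_trans (mC _ h1)); rewrite ler_wpM2l.
  - apply: RintegrableZl => //; apply: integrable_norm.
    by apply: integrableS ki => //; exact: itvS0y.
rewrite -RintegralZl//.
apply: (@dominated_itvy _ (fun x => C * `|k x|)) => //.
- by apply: RintegrableZl => //; exact: integrable_norm.
- move=> T; apply/(measurable_restrict _ _ _).1; [exact: mI|exact: measurable_itv|].
  have -> : `[0, +oo[%classic `&` `[0, T]%classic = `[0, T]%classic :> set R.
    exact/setIidr/itvS0y.
  by apply: measurable_funM; [exact: measurable_cst|exact: mkT].
- by apply: measurable_funM.
- move=> x x0.
  have tT : (fun T => T - x) @ +oo --> +oo.
    apply/cvgryPge => A; near=> T; rewrite lerBrDr; near: T.
    by apply: nbhs_pinfty_ge; exact: num_real.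
  have c1 : (T - x)^-1 * m (T - x) @[T --> +oo] --> Q.
    exact: (cvg_comp _ _ tT mQ).
  have c2 : x * T^-1 @[T --> +oo] --> x * 0.
    apply: cvgM; first exact: cvg_cst.
    apply/gtr0_cvgV0; first by near=> T; near: T; apply: nbhs_pinfty_gt; exact: num_real.
    exact: cvg_id.
  have c3 : k x * ((T - x)^-1 * m (T - x) * (1 - x * T^-1)) @[T --> +oo] --> k x * (Q * (1 - x * 0)).
    apply: cvgM; first exact: cvg_cst.
    by apply: cvgM => //; apply: cvgB => //; exact: cvg_cst.
  rewrite mulr0 subr0 mulr1 mulrC in c3.
  apply: cvg_trans c3; apply: near_eq_cvg; near=> T.
  have xT : x < T by near: T; apply: nbhs_pinfty_gt; exact: num_real.
  have T0 : 0 < T by exact: le_lt_trans xT.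
  rewrite /F patchE mem_setE in_itv /= x0 (ltW xT) /=.
  by field; rewrite subr_eq0 !gt_eqF.
Unshelve. all: by end_near. Qed.

End Limits.

(** * Complex limits and bounds for convolutions *)

Section MoreConvolution.
Variable R : realType.
Notation mu := (@lebesgue_measure R).
Notation Re := complex.Re.
Notation Im := complex.Im.
Implicit Types (a b u v w k m : R -> R[i]) (t x y T M : R) (U V Q L s z : R[i]).

Lemma cmeasurable_convolution a b T : cintegrable `[0, T] a -> cintegrable `[0, T] b ->
  cmeasurable `[0, T] (convolution a b).
Proof.
move=> ai bi.
have mI : measurable (`[0, T]%classic : set (measurableTypeR R)) by exact: measurable_itv.
have [A1 A2] := cintegrable_mkcond mI ai.
have [B1 B2] := cintegrable_mkcond mI bi.
pose A := cutoff `[0, T] a; pose B := cutoff `[0, T] b.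
pose Psi (p : R * R) := A p.1 * B (p.2 - p.1).
have m1 : measurable_fun [set: measurableTypeR R] (fun _ : R => 1 : R) by [].
have b1 (x : R) : `|1 : R| <= 1 by rewrite normr1.
have PsiR : (mu \x mu)%E.-integrable setT (EFin \o (fun p => Re (Psi p))).
  have := integrableB measurableT (integrable_convolution_triple 0 A1 B1 m1 b1) (integrable_convolution_triple 0 A2 B2 m1 b1).
  congr (integrable _ _ _); apply/funext => p.
  by rewrite /= /Psi !cE /Re_fun /Im_fun !mulr1.
have PsiI : (mu \x mu)%E.-integrable setT (EFin \o (fun p => Im (Psi p))).
  have := integrableD measurableT (integrable_convolution_triple 0 A1 B2 m1 b1) (integrable_convolution_triple 0 A2 B1 m1 b1).
  congr (integrable _ _ _); apply/funext => p.
  by rewrite /= /Psi !cE /Re_fun /Im_fun !mulr1.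
have [_ mR _] := Rintegral_fubini PsiR.
have [_ mJ _] := Rintegral_fubini PsiI.
have E y : `[0, T]%classic y -> cintegral setT (fun x => Psi (x, y)) = convolution a b y.
  by rewrite /= in_itv /= => /andP[_ yT]; rewrite (convolution_line _ _ yT).
split.
- apply: (@eq_measurable_fun _ _ _ _ _ (fun y => \int[mu]_x Re (Psi (x, y)))).
    by move=> y /set_mem/E; rewrite /Re_fun /Im_fun => <-.
  exact: measurable_funTS.
- apply: (@eq_measurable_fun _ _ _ _ _ (fun y => \int[mu]_x Im (Psi (x, y)))).
    by move=> y /set_mem/E; rewrite /Re_fun /Im_fun => <-.
  exact: measurable_funTS.
Qed.

Lemma reflect_sub t : (fun x => t - x) @` `[0, t]%classic `<=` (`[0, t]%classic : set R).
Proof.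
move=> _ [x /= xt <-]; move: xt; rewrite !in_itv /= subr_ge0 lerBlDr lerDl.
by rewrite andbC.
Qed.

Lemma cmeasurable_reflect b t : cmeasurable `[0, t] b -> cmeasurable `[0, t] (fun x => b (t - x)).
Proof.
move=> [b1 b2]; split.
- by apply: (measurable_comp _ (@reflect_sub t) b1); [exact: measurable_itv|apply: measurable_funB].
- by apply: (measurable_comp _ (@reflect_sub t) b2); [exact: measurable_itv|apply: measurable_funB].
Qed.

Lemma cbounded_reflect b t M : cbounded `[0, t] b M -> cbounded `[0, t] (fun x => b (t - x)) M.
Proof. by move=> bM x xt; apply: bM; apply: reflect_sub; exists x. Qed.

Lemma cboundedS (D E : set R) b M : E `<=` D -> cbounded D b M -> cbounded E b M.
Proof. by move=> ED bM x /ED; exact: bM. Qed.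

Lemma cintegrable_conv a b t M : cintegrable `[0, t] a -> cmeasurable `[0, t] b ->
  cbounded `[0, t] b M -> cintegrable `[0, t] (fun x => a x * b (t - x)).
Proof.
move=> ai mb bM; apply: (cintegrableMb (G := fun x => b (t - x)) (M := M) (measurable_itv _) ai).
- exact: cmeasurable_reflect.
- exact: cbounded_reflect.
Qed.

Lemma convolution_parts a b t M : cintegrable `[0, t] a -> cmeasurable `[0, t] b ->
  cbounded `[0, t] b M ->
  Re (convolution a b t) = \int[mu]_(x in `[0, t]) (Re_fun a x * Re_fun b (t - x)) -
     \int[mu]_(x in `[0, t]) (Im_fun a x * Im_fun b (t - x)) /\
  Im (convolution a b t) = \int[mu]_(x in `[0, t]) (Re_fun a x * Im_fun b (t - x)) +
     \int[mu]_(x in `[0, t]) (Im_fun a x * Re_fun b (t - x)).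
Proof.
move=> [a1 a2] mb bM.
have [b1 b2] := cmeasurable_reflect mb.
have bR := cbounded_reflect bM.
have c1 x : `[0, t]%classic x -> `|Re_fun b (t - x)| <= M by move=> /bR[].
have c2 x : `[0, t]%classic x -> `|Im_fun b (t - x)| <= M by move=> /bR[].
have mI : measurable (`[0, t]%classic : set (measurableTypeR R)) by exact: measurable_itv.
split.
- rewrite -RintegralB; last 3 first.
  + exact: mI.
  + exact: integrableMb mI a1 b1 c1.
  + exact: integrableMb mI a2 b2 c2.
  by apply: eq_Rintegral => x _; rewrite /Re_fun /Im_fun cE.
- rewrite -RintegralD; last 3 first.
  + exact: mI.
  + exact: integrableMb mI a1 b2 c2.
  + exact: integrableMb mI a2 b1 c1.
  by apply: eq_Rintegral => x _; rewrite /Re_fun /Im_fun cE.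
Qed.

Lemma Rintegral_conv_bound (f g : R -> R) t T M : 0 <= M -> t <= T ->
  mu.-integrable `[0, T] (EFin \o f) ->
  measurable_fun (`[0, T]%classic : set (measurableTypeR R)) g ->
  (forall x, `[0, T]%classic x -> `|g x| <= M) ->
  `|\int[mu]_(x in `[0, t]) (f x * g (t - x))| <= M * \int[mu]_(x in `[0, T]) `|f x|.
Proof.
move=> M0 tT fi mg gM.
have sub := @subset_itv0 R t T tT.
have mI y : measurable (`[0, y]%classic : set (measurableTypeR R)) by exact: measurable_itv.
have fti : mu.-integrable `[0, t] (EFin \o f) by exact: integrableS fi.
have mgt : measurable_fun (`[0, t]%classic : set (measurableTypeR R)) (fun x => g (t - x)).
  apply: (measurable_comp _ (@reflect_sub t)); [exact: mI| |by apply: measurable_funB].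
  exact: measurable_funS mg.
have gtM x : `[0, t]%classic x -> `|g (t - x)| <= M.
  by move=> xt; apply: gM; apply: sub; apply: reflect_sub; exists x.
have pi := integrableMb (mI t) fti mgt gtM.
apply: (le_trans (le_normr_Rintegral (mI t) pi)).
apply: (@le_trans _ _ (M * \int[mu]_(x in `[0, t]) `|f x|)).
  rewrite -RintegralZl; [|exact: mI|exact: integrable_norm].
  apply: le_Rintegral; [exact: mI|exact: integrable_norm| |].
    by apply: RintegrableZl; [exact: mI|exact: integrable_norm].
  by move=> x xt; rewrite normrM mulrC ler_wpM2r//; exact: gtM.
rewrite ler_wpM2l//.
have := Rintegral_norm_le tT (integrable_norm fi).
rewrite ger0_norm; last by apply: Rintegral_ge0 => x _; rewrite /= normr_ge0.
by under [X in _ <= X -> _]eq_Rintegral do rewrite /= normr_id.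
Qed.

Lemma cbounded_convolution a b T M : 0 <= M -> cintegrable `[0, T] a -> cmeasurable `[0, T] b ->
  cbounded `[0, T] b M -> exists M', cbounded `[0, T] (convolution a b) M'.
Proof.
move=> M0 ai mb bM; have [a1 a2] := ai; have [b1 b2] := mb.
exists (M * \int[mu]_(x in `[0, T]) `|Re_fun a x| + M * \int[mu]_(x in `[0, T]) `|Im_fun a x|).
move=> t tT; have /andP[_ tT'] : 0 <= t <= T by move: tT; rewrite /= in_itv.
have sub := @subset_itv0 R t T tT'.
have [-> ->] := @convolution_parts a b t M (cintegrable_sub tT' ai)
   (cmeasurableS (measurable_itv _) sub mb) (cboundedS sub bM).
have c1 x : `[0, T]%classic x -> `|Re_fun b x| <= M by move=> /bM[].
have c2 x : `[0, T]%classic x -> `|Im_fun b x| <= M by move=> /bM[].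
split.
- by apply: (le_trans (ler_normB _ _)); apply: lerD; exact: Rintegral_conv_bound.
- by apply: (le_trans (ler_normD _ _)); apply: lerD; exact: Rintegral_conv_bound.
Qed.

Lemma eq_cintegral_oc (F G : R -> R[i]) T : cmeasurable `[0, T] F -> cmeasurable `[0, T] G ->
  (forall x, 0 < x <= T -> F x = G x) -> cintegral `[0, T] F = cintegral `[0, T] G.
Proof.
move=> [F1 F2] [G1 G2] FG.
have E (f g : R -> R) : measurable_fun (`[0, T]%classic : set (measurableTypeR R)) f ->
    measurable_fun (`[0, T]%classic : set (measurableTypeR R)) g ->
    (forall x, 0 < x <= T -> f x = g x) ->
    \int[mu]_(x in `[0, T]) f x = \int[mu]_(x in `[0, T]) g x.
  have sub : `]0, T]%classic `<=` (`[0, T]%classic : set R).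
    by move=> x; rewrite /= !in_itv /= => /andP[/ltW-> ->].
  move=> mf mg fg; rewrite /Rintegral -!integral_itv_obnd_cbnd; last 2 first.
  - by apply/measurable_EFinP; exact: measurable_funS mg.
  - by apply/measurable_EFinP; exact: measurable_funS mf.
  by congr fine; apply: eq_integral => x; rewrite inE /= in_itv /= => /fg ->.
rewrite /cintegral; congr Complex; apply: E => // x /FG; rewrite /Re_fun /Im_fun => -> //.
Qed.

(** Convergence at infinity, by components. *)
Definition ccvg u L := (Re (u T) @[T --> +oo] --> Re L) /\ (Im (u T) @[T --> +oo] --> Im L).

Lemma ccvgD u v U V : ccvg u U -> ccvg v V -> ccvg (fun T => u T + v T) (U + V).
Proof.
move=> [u1 u2] [v1 v2]; split; rewrite cE;
by under eq_fun do rewrite cE; exact: cvgD.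
Qed.

Lemma ccvgM u v U V : ccvg u U -> ccvg v V -> ccvg (fun T => u T * v T) (U * V).
Proof.
move=> [u1 u2] [v1 v2]; split; rewrite cE; under eq_fun do rewrite cE.
- by apply: cvgB; exact: cvgM.
- by apply: cvgD; exact: cvgM.
Qed.

Lemma ccvg_cst L : ccvg (fun=> L) L.
Proof. by split; exact: cvg_cst. Qed.

Lemma ccvgZ u U z : ccvg u U -> ccvg (fun T => z * u T) (z * U).
Proof. by move=> uU; apply: ccvgM => //; exact: ccvg_cst. Qed.

Lemma ccvg_unique u U V : ccvg u U -> ccvg u V -> U = V.
Proof.
move=> [u1 u2] [v1 v2]; apply: complexP.
- exact: (cvg_unique _ u1 v1).
- exact: (cvg_unique _ u2 v2).
Qed.

Lemma ccvg_eq u v U : (forall T, 0 < T -> u T = v T) -> ccvg u U -> ccvg v U.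
Proof.
move=> uv [u1 u2].
split; [apply: cvg_trans u1|apply: cvg_trans u2]; apply: near_eq_cvg; near=> T;
  rewrite uv//; near: T; apply: nbhs_pinfty_gt; exact: num_real.
Unshelve. all: by end_near. Qed.

(** Bounded near infinity by convergence, and on the remaining compact interval
because a primitive is bounded there. *)
Lemma ccvg_bounded u L : (forall T, cintegrable `[0, T] u) -> ccvg (prim u) L ->
  exists2 M, 0 <= M & forall x, 0 <= x -> `|Re (prim u x)| <= M /\ `|Im (prim u x)| <= M.
Proof.
move=> ui [p1 p2].
have bd (f : R -> R) (l : R) : f x @[x --> +oo] --> l -> exists T0 : R, forall x, T0 < x -> `|f x| <= `|l| + 1.
  move=> fl; have nf : `|f x| @[x --> +oo] --> `|l| by exact: cvg_norm.
  have /cvgrPdist_le/(_ 1 ltr01)[T0 [_ hT0]] := nf.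
  exists T0 => x /hT0 h; rewrite addrC -lerBlDr.
  by apply: le_trans h; rewrite distrC ler_norm.
have [T1 h1] := bd _ _ p1.
have [T2 h2] := bd _ _ p2.
pose T0 := Num.max T1 T2.
have [M hM] := cbounded_prim (ui T0).
exists (Num.max `|M| (Num.max (`|Re L| + 1) (`|Im L| + 1))); first by rewrite le_max normr_ge0.
move=> x x0; have [xT|xT] := leP x T0.
  have [] : `|Re (prim u x)| <= M /\ `|Im (prim u x)| <= M.
    by apply: hM; rewrite /= in_itv /= x0.
  by move=> a1 a2; rewrite !le_max !(le_trans _ (ler_norm M)).
by rewrite !le_max h1 ?h2 ?orbT//; apply: le_lt_trans xT; rewrite le_max lexx ?orbT.
Qed.

Lemma ccvg_convolution u v U V M :
  (forall T, cmeasurable `[0, T] u) -> (forall T, cmeasurable `[0, T] v) ->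
  (forall T, cbounded `[0, T] u M) -> (forall T, cbounded `[0, T] v M) ->
  ccvg u U -> ccvg v V ->
  ccvg (fun T => (T^-1)%:C * convolution u v T) (U * V).
Proof.
move=> mU mV uM vM [u1 u2] [v1 v2].
have ui T : cintegrable `[0, T] u by exact: bounded_cintegrable (mU T) (uM T).
have D x : 0 <= x -> `[0, x]%classic x by move=> x0; rewrite /= in_itv /= x0 lexx.
have uM1 x : 0 <= x -> `|Re_fun u x| <= M by move=> /D/uM[].
have uM2 x : 0 <= x -> `|Im_fun u x| <= M by move=> /D/uM[].
have vM1 x : 0 <= x -> `|Re_fun v x| <= M by move=> /D/vM[].
have vM2 x : 0 <= x -> `|Im_fun v x| <= M by move=> /D/vM[].
have mU1 T := (mU T).1. have mU2 T := (mU T).2.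
have mV1 T := (mV T).1. have mV2 T := (mV T).2.
have P T := @convolution_parts u v T M (ui T) (mV T) (vM T).
split; rewrite cE.
- under eq_fun do rewrite cReZ (P _).1 mulrBr.
  by apply: cvgB; [exact: (conv_cesaro mU1 mV1 uM1 vM1)|exact: (conv_cesaro mU2 mV2 uM2 vM2)].
- under eq_fun do rewrite cImZ (P _).2 mulrDr.
  by apply: cvgD; [exact: (conv_cesaro mU1 mV2 uM1 vM2)|exact: (conv_cesaro mU2 mV1 uM2 vM1)].
Qed.

Lemma ccvg_convolution_kernel k m Q (C : R) :
  cintegrable `[0, +oo[ k -> (forall T, cmeasurable `[0, T] m) ->
  (forall x, 0 <= x -> `|Re (m x)| <= C * x /\ `|Im (m x)| <= C * x) ->
  ccvg (fun x => (x^-1)%:C * m x) Q ->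
  ccvg (fun T => (T^-1)%:C * convolution k m T) (cintegral `[0, +oo[ k * Q).
Proof.
move=> ki mm mC [q1 q2]; have [k1 k2] := ki.
have C0 : 0 <= C by have [h _] := mC 1 ler01; have := le_trans (normr_ge0 _) h; rewrite mulr1.
have kT T : cintegrable `[0, T] k.
  by apply: cintegrableS ki; [exact: measurable_itv|exact: measurable_itv|exact: itvS0y].
have mb T : cbounded `[0, T] m (C * T).
  move=> x; rewrite /= in_itv /= => /andP[x0 xT]; have [h1 h2] := mC x x0.
  by split; [apply: (le_trans h1)|apply: (le_trans h2)]; rewrite ler_wpM2l.
have mm1 T := (mm T).1. have mm2 T := (mm T).2.
have mC1 x : 0 <= x -> `|Re_fun m x| <= C * x by move=> /mC[].
have mC2 x : 0 <= x -> `|Im_fun m x| <= C * x by move=> /mC[].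
have P T := @convolution_parts k m T _ (kT T) (mm T) (mb T).
have q1' : x^-1 * Re_fun m x @[x --> +oo] --> Re Q.
  by apply: cvg_trans q1; apply: near_eq_cvg; near=> x; rewrite cReZ.
have q2' : x^-1 * Im_fun m x @[x --> +oo] --> Im Q.
  by apply: cvg_trans q2; apply: near_eq_cvg; near=> x; rewrite cImZ.
rewrite [X in ccvg _ X]mulrC; split; rewrite cE.
- under eq_fun do rewrite cReZ (P _).1 mulrBr.
  by apply: cvgB; [exact: (conv_kernel_cesaro k1 mm1 mC1)|exact: (conv_kernel_cesaro k2 mm2 mC2)].
- rewrite addrC; under eq_fun do rewrite cImZ (P _).2 mulrDr.
  by apply: cvgD; [exact: (conv_kernel_cesaro k1 mm2 mC2)|exact: (conv_kernel_cesaro k2 mm1 mC1)].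
Unshelve. all: by end_near. Qed.

End MoreConvolution.

(** * The Laplace transform of the equation *)

Section Master.
Variable R : realType.
Notation mu := (@lebesgue_measure R).
Notation Re := complex.Re.
Notation Im := complex.Im.

Lemma ccvg_expw (p : R[i]) : 0 < Re p -> ccvg (expw p) 0.
Proof.
move=> p0.
have e0 : expR (- (Re p * t)) @[t --> +oo] --> 0.
  have h : (fun t => Re p * t) @ +oo --> +oo by apply: gt0_cvgMry => //; exact: cvg_id.
  exact: (cvg_comp _ _ h (@cvgr_expR R)).
split; apply: norm_cvg0; apply: (@squeeze_cvgr _ _ _ _ (cst 0) (fun t => expR (- (Re p * t))));
  rewrite ?e0 //; try exact: cvg_cst; apply: nearW => t; rewrite normr_ge0 /=; by have [] := expw_bound p t.
Qed.

Lemma cbounded_le (D : set R) (u : R -> R[i]) M N : M <= N -> cbounded D u M -> cbounded D u N.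
Proof. by move=> MN uM x /uM [h1 h2]; split; [exact: le_trans MN|exact: le_trans MN]. Qed.

(** Growth at infinity is at most linear by the convergence of the averages; near
0 the second primitive is bounded by a multiple of x.  The bound serves as a
dominating function in ccvg_convolution_kernel. *)
Lemma prim_linear_bound (q : R -> R[i]) (Q : R[i]) : (forall T, cintegrable `[0, T] q) ->
  ccvg (fun T => (T^-1)%:C * prim (prim q) T) Q ->
  exists C, forall x, 0 <= x -> `|Re (prim (prim q) x)| <= C * x /\ `|Im (prim (prim q) x)| <= C * x.
Proof.
move=> qi [q1 q2].
have bd (f : R -> R) (l : R) : f x @[x --> +oo] --> l -> exists T0 : R, forall x, T0 < x -> `|f x| <= `|l| + 1.
  move=> fl; have nf : `|f x| @[x --> +oo] --> `|l| by exact: cvg_norm.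
  have /cvgrPdist_le/(_ 1 ltr01)[T0 [_ hT0]] := nf.
  exists T0 => x /hT0 h; rewrite addrC -lerBlDr.
  by apply: le_trans h; rewrite distrC ler_norm.
have [T1 h1] := bd _ _ q1.
have [T2 h2] := bd _ _ q2.
pose T0 := Num.max 1 (Num.max T1 T2).
have [M hM] := cbounded_prim (qi T0).
pose C := Num.max `|M| (Num.max (`|Re Q| + 1) (`|Im Q| + 1)).
have C0 : 0 <= C by rewrite le_max normr_ge0.
exists C => x x0; have [xT|xT] := leP x T0.
  have [n1 n2] := cintegrable_prim (cintegrable_sub xT (qi T0)).
  have sm (y : R) : `[0, x]%classic y -> `|Re (prim q y)| <= C /\ `|Im (prim q y)| <= C.
    rewrite /= in_itv /= => /andP[y0 yx].
    have [] : `|Re (prim q y)| <= M /\ `|Im (prim q y)| <= M.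
      by apply: hM; rewrite /= in_itv /= y0 (le_trans yx).
    by move=> g1 g2; rewrite !le_max !(le_trans _ (ler_norm M)).
  have mI : measurable (`[0, x]%classic : set (measurableTypeR R)) by exact: measurable_itv.
  split.
  - apply: (le_trans (le_normr_Rintegral mI n1)); rewrite -[x in C * x]subr0.
    apply: (Rintegral_le_const C0 x0 mI) => //; first exact: integrable_norm.
    by move=> y /sm[].
  - apply: (le_trans (le_normr_Rintegral mI n2)); rewrite -[x in C * x]subr0.
    apply: (Rintegral_le_const C0 x0 mI) => //; first exact: integrable_norm.
    by move=> y /sm[].
have xp : 0 < x by apply: lt_trans xT; rewrite lt_max ltr01.
have k1 := h1 x (le_lt_trans _ xT).
have k2 := h2 x (le_lt_trans _ xT).
split.
- rewrite -ler_pdivrMr//; have := k1 _; rewrite cReZ normrM gtr0_norm ?invr_gt0// mulrC => h.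
  by apply: (le_trans (h _)); rewrite !le_max lexx ?orbT.
- rewrite -ler_pdivrMr//; have := k2 _; rewrite cImZ normrM gtr0_norm ?invr_gt0// mulrC => h.
  by apply: (le_trans (h _)); rewrite !le_max lexx ?orbT.
Qed.

Lemma cboundedM (D : set R) (u v : R -> R[i]) :
  (exists M, cbounded D u M) -> (exists M, cbounded D v M) ->
  exists M, 0 <= M /\ cbounded D (fun x => u x * v x) M.
Proof.
move=> [M uM] [N vN]; exists (`|M| * `|N| + `|M| * `|N|); split; first by rewrite addr_ge0// mulr_ge0.
have H (a b c d : R) : `|a| <= M -> `|b| <= N -> `|c| <= M -> `|d| <= N ->
  `|a * b - c * d| <= `|M| * `|N| + `|M| * `|N| /\ `|a * b + c * d| <= `|M| * `|N| + `|M| * `|N|.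
  move=> h1 h2 h3 h4.
  have g1 : `|a * b| <= `|M| * `|N| by rewrite normrM ler_pM// (le_trans _ (ler_norm _)).
  have g2 : `|c * d| <= `|M| * `|N| by rewrite normrM ler_pM// (le_trans _ (ler_norm _)).
  by split; [apply: (le_trans (ler_normB _ _))|apply: (le_trans (ler_normD _ _))]; apply: lerD.
move=> x xD; have [u1 u2] := uM x xD; have [v1 v2] := vN x xD.
by rewrite !cE; split; [have [] := H _ _ _ _ u1 v1 u2 v2|have [] := H _ _ _ _ u1 v2 u2 v1].
Qed.

Lemma cintegrable_convolution (a b : R -> R[i]) T M : 0 <= M -> cintegrable `[0, T] a ->
  cmeasurable `[0, T] b -> cbounded `[0, T] b M -> cintegrable `[0, T] (convolution a b).
Proof.
move=> M0 ai mb bM; have [M' bM'] := cbounded_convolution M0 ai mb bM.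
exact: bounded_cintegrable (cmeasurable_convolution ai (bounded_cintegrable mb bM)) bM'.
Qed.

(** h = e + lam k * e yields a * h = a * e + lam k * (a * e), since convolution is
associative and commutative.  With a = f', h = 1 and e the Mittag-Leffler
kernel, this eliminates e from the equation. *)
Lemma convolution_resolvent (a e k h : R -> R[i]) (lam : R[i]) T M : 0 <= M ->
  cintegrable `[0, T] a -> cintegrable `[0, T] k ->
  cmeasurable `[0, T] e -> cbounded `[0, T] e M ->
  (forall x, 0 <= x <= T -> e x + lam * convolution k e x = h x) ->
  convolution a h T = convolution a e T + lam * convolution k (convolution a e) T.
Proof.
move=> M0 ai ki me bM ek.
have mI x : measurable (`[0, x]%classic : set (measurableTypeR R)) by exact: measurable_itv.
have [M' bM'] := cbounded_convolution M0 ki me bM.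
have mke := cmeasurable_convolution ki (bounded_cintegrable me bM).
have p1 := cintegrable_conv ai me bM.
have p2 := cintegrable_conv ai mke bM'.
rewrite -(convolution_assoc ki ai me bM).
have -> : convolution (convolution k a) e T = convolution (convolution a k) e T.
  apply: eq_cintegral => x; rewrite /= in_itv /= => /andP[x0 xT]; congr (_ * _).
  by apply: convolution_comm; apply: cintegrable_meas; apply: cintegrable_sub xT _.
rewrite (convolution_assoc ai ki me bM).
rewrite /convolution -cintegralZl; [|exact: mI|exact: p2].
rewrite -cintegralD; [|exact: mI|exact: p1|by apply: cintegrableZl; [exact: mI|exact: p2]].
apply: eq_cintegral => x; rewrite /= in_itv /= => /andP[x0 xT].
rewrite -ek; last by rewrite subr_ge0 xT lerBlDr lerDl.
by rewrite mulrDr; congr (_ + _); rewrite mulrCA.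
Qed.

Lemma ccvg_cesaro (u : R -> R[i]) (L : R[i]) M : (forall T, cmeasurable `[0, T] u) ->
  (forall T, cbounded `[0, T] u M) -> ccvg u L -> ccvg (fun T => (T^-1)%:C * prim u T) L.
Proof.
move=> mu_ bu cu; rewrite -[L]mulr1.
have bu' T : cbounded `[0, T] u (Num.max M 1).
  by apply: cbounded_le (bu T); rewrite le_max lexx.
have m1 T : cmeasurable `[0, T] (@unitfun R) by have [] := unitfun_props T.
have b1' T : cbounded `[0, T] (@unitfun R) (Num.max M 1).
  have [_ h _] := unitfun_props T.
  by apply: cbounded_le h; rewrite le_max lexx orbT.
have := ccvg_convolution mu_ m1 bu' b1' cu (ccvg_cst 1).
by apply: ccvg_eq => T _; rewrite convolution_one.
Qed.

(** The functions fs, gs and so on are f, g and so on times the weight e^(-sx).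
The weighted equation reads q = g + A f * f with q = c f' * e, and
c (f - f0 w) = q + lam k * q by convolution_resolvent, where w is the weight
itself.  In its second primitive (E11) the averages of the second primitives of
fs, gs and w converge to F, G and 1 / s, that of the convolution of prim fs with
itself to F^2, and that of ks * m, where m is the second primitive of q, to the
transform of k times the limit of the averages of m. *)
Lemma laplace_transformed_equation (s c lam A f0 F G : R[i]) (f f' e k g : R -> R[i]) :
  0 < Re s ->
  (forall T, cintegrable `[0, T] f') ->
  (forall T, cmeasurable `[0, T] f) ->
  (forall T, exists M, cbounded `[0, T] f M) ->
  (forall t, 0 <= t -> f t - f0 = prim f' t) ->
  (forall T, cmeasurable `[0, T] e) ->
  (forall T, exists M, cbounded `[0, T] e M) ->
  (forall T, cintegrable `[0, T] k) ->
  (forall t, 0 <= t -> e t + lam * convolution k e t = 1) ->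
  cintegrable `[0, +oo[ (fun x => expw s x * k x) ->
  (forall t, 0 < t -> c * convolution f' e t - A * convolution f f t = g t) ->
  (forall T, cintegrable `[0, T] g) ->
  ccvg (prim (fun x => expw s x * f x)) F ->
  ccvg (prim (fun x => expw s x * g x)) G ->
  c * F - c * f0 / s = (G + A * F ^+ 2) * (1 + lam * cintegral `[0, +oo[ (fun x => expw s x * k x)).
Proof.
move=> s0 f'i mf bf f'f me be ki ek ksi eqn gi cF cG.
pose w := expw s.
pose fs x := w x * f x. pose f's x := w x * f' x. pose es x := w x * e x.
pose ks x := w x * k x. pose gs x := w x * g x.
pose qs x := c * convolution f's es x.
have mI T : measurable (`[0, T]%classic : set (measurableTypeR R)) by exact: measurable_itv.
have [M1 b1] : exists M : R, forall T, cbounded `[0, T] (@unitfun R) M.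
  by exists 1 => T; have [] := unitfun_props T.
have m1 T : cmeasurable `[0, T] (@unitfun R) by have [] := unitfun_props T.
have fi T : cintegrable `[0, T] f.
  by have [M bM] := bf T; exact: bounded_cintegrable (mf T) bM.
have ei T : cintegrable `[0, T] e.
  by have [M bM] := be T; exact: bounded_cintegrable (me T) bM.
have fsi T : cintegrable `[0, T] fs by exact: cintegrable_expw_mul.
have f'si T : cintegrable `[0, T] f's by exact: cintegrable_expw_mul.
have esi T : cintegrable `[0, T] es by exact: cintegrable_expw_mul.
have ksiT T : cintegrable `[0, T] ks by exact: cintegrable_expw_mul.
have gsi T : cintegrable `[0, T] gs by exact: cintegrable_expw_mul.
have mw T : cmeasurable `[0, T] w by apply: cmeasurable_expw; exact: mI.
have bw T := @cbounded_expw R s T.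
have bes T : exists M, 0 <= M /\ cbounded `[0, T] es M.
  by apply: cboundedM => //; eexists; exact: bw.
have bfs T : exists M, 0 <= M /\ cbounded `[0, T] fs M.
  by apply: cboundedM => //; eexists; exact: bw.
have E1 T : 0 <= T -> convolution f's w T = w T * (f T - f0).
  move=> T0; rewrite (f'f _ T0) -convolution_one -(convolution_expw s T0 (f'i T) (m1 T) (b1 T)).
  by apply: eq_cintegral => x _; rewrite mulr1.
have E2 T : 0 <= T -> convolution ks es T = w T * convolution k e T.
  by move=> T0; have [M bM] := be T; exact: (convolution_expw s T0 (ki T) (me T) bM).
have E4 T : 0 <= T -> convolution fs fs T = w T * convolution f f T.
  by move=> T0; have [M bM] := bf T; exact: (convolution_expw s T0 (fi T) (mf T) bM).
have E5 T : 0 <= T -> convolution f's es T = w T * convolution f' e T.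
  by move=> T0; have [M bM] := be T; exact: (convolution_expw s T0 (f'i T) (me T) bM).
have Eq T : 0 < T -> qs T = gs T + A * convolution fs fs T.
  move=> T0; rewrite /qs /gs E5 ?ltW// E4 ?ltW// -(eqn _ T0); ring.
have mes T : cmeasurable `[0, T] es by exact: cintegrable_meas.
have mcv T : cmeasurable `[0, T] (convolution f's es) by exact: cmeasurable_convolution.
have bcv T : exists M, cbounded `[0, T] (convolution f's es) M.
  by have [M [M0 bM]] := bes T; exact: cbounded_convolution M0 (f'si T) (mes T) bM.
have icv T : cintegrable `[0, T] (convolution f's es).
  by have [M bM] := bcv T; exact: bounded_cintegrable (mcv T) bM.
(* the resolvent equation of e and k, multiplied by the weight, has right-hand
   side w *)
have E6 T : 0 <= T -> convolution f's w T = convolution f's es T + lam * convolution ks (convolution f's es) T.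
  move=> T0; have [M [M0 bM]] := bes T.
  apply: (convolution_resolvent M0 (f'si T) (ksiT T) (mes T) bM) => x /andP[x0 xT].
  by rewrite E2// mulrCA -mulrDr ek// mulr1.
have E8 T : c * convolution ks (convolution f's es) T = convolution ks qs T.
  have [M bM] := bcv T; rewrite /convolution -cintegralZl; [|exact: mI|].
    by apply: eq_cintegral => x _; rewrite /qs mulrCA.
  exact: cintegrable_conv (ksiT T) (mcv T) bM.
have E9 T : 0 <= T -> c * fs T - c * f0 * w T = qs T + lam * convolution ks qs T.
  move=> T0; rewrite -E8 /qs.
  have -> : forall X Y, c * X + lam * (c * Y) = c * (X + lam * Y) by move=> X Y; ring.
  rewrite -E6// E1// /fs; ring.
have qsi T : cintegrable `[0, T] qs by apply: cintegrableZl; [exact: mI|exact: icv].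
have wi T : cintegrable `[0, T] w by exact: bounded_cintegrable (mw T) (bw T).
pose n := prim qs.
pose m := prim n.
have nE T : n T = prim gs T + A * prim (convolution fs fs) T.
  have [M [M0 bM]] := bfs T.
  have iff_ := cintegrable_convolution M0 (fsi T) (cintegrable_meas (fsi T)) bM.
  have iA : cintegrable `[0, T] (fun x => A * convolution fs fs x).
    by apply: cintegrableZl; [exact: mI|exact: iff_].
  rewrite /prim -cintegralZl; [|exact: mI|exact: iff_].
  rewrite -cintegralD; [|exact: mI|exact: gsi|exact: iA].
  apply: eq_cintegral_oc.
  - exact: cintegrable_meas.
  - by apply: cintegrable_meas; apply: cintegrableD; [exact: mI|exact: gsi|exact: iA].
  - by move=> x /andP[x0 _]; exact: Eq.
have ni T : cintegrable `[0, T] n by exact: cintegrable_prim.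
have pff T : prim (convolution fs fs) T = convolution fs (prim fs) T by exact: prim_convolution.
have ippf T : cintegrable `[0, T] (prim fs) by exact: cintegrable_prim.
have ifpf T : cintegrable `[0, T] (convolution fs (prim fs)).
  have [M bM] := cbounded_prim (fsi T).
  have bM' : cbounded `[0, T] (prim fs) `|M|.
    by move=> x /bM [h1 h2]; split; apply: (le_trans _ (ler_norm M)).
  exact: cintegrable_convolution (normr_ge0 M) (fsi T) (cintegrable_meas (ippf T)) bM'.
have mE T : m T = prim (prim gs) T + A * convolution (prim fs) (prim fs) T.
  have -> : convolution (prim fs) (prim fs) T = prim (convolution fs (prim fs)) T.
    rewrite -(prim_convolution (ippf T) (fsi T)); apply: eq_cintegral => x; rewrite /= in_itv /= => /andP[x0 xT].
    by apply: convolution_comm; exact: cintegrable_meas.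
  rewrite /m /prim -cintegralZl; [|exact: mI|exact: ifpf].
  rewrite -cintegralD; [|exact: mI|by apply: cintegrable_prim|by apply: cintegrableZl; [exact: mI|exact: ifpf]].
  by apply: eq_cintegral => x _; rewrite nE pff.
have kqi T : cintegrable `[0, T] (convolution ks qs).
  have [M [M0 bM]] : exists M, 0 <= M /\ cbounded `[0, T] qs M.
    apply: (@cboundedM _ (fun=> c)) => //.
    by exists (Num.max `|Re c| `|Im c|) => x _; rewrite !le_max !lexx orbT.
  exact: cintegrable_convolution M0 (ksiT T) (cintegrable_meas (qsi T)) bM.
have kni T : cintegrable `[0, T] (convolution ks n).
  have [M bM] := cbounded_prim (qsi T).
  have bM' : cbounded `[0, T] n `|M|.
    by move=> x /bM [h1 h2]; split; apply: (le_trans _ (ler_norm M)).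
  exact: cintegrable_convolution (normr_ge0 M) (ksiT T) (cintegrable_meas (ni T)) bM'.
have E10 T : 0 <= T -> c * prim fs T - c * f0 * prim w T = n T + lam * convolution ks n T.
  move=> T0; rewrite -(prim_convolution (ksiT T) (qsi T)) /n /prim.
  rewrite -(cintegralZl c (mI T) (fsi T)) -(cintegralZl (c * f0) (mI T) (wi T)) -(cintegralZl lam (mI T) (kqi T)).
  rewrite -cintegralB; [|exact: mI|by apply: cintegrableZl; [exact: mI|exact: fsi]|by apply: cintegrableZl; [exact: mI|exact: wi]].
  rewrite -cintegralD; [|exact: mI|exact: qsi|by apply: cintegrableZl; [exact: mI|exact: kqi]].
  by apply: eq_cintegral => x; rewrite /= in_itv /= => /andP[x0 xT]; exact: E9.
have E11 T : 0 <= T -> c * prim (prim fs) T - c * f0 * prim (prim w) T = m T + lam * convolution ks m T.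
  move=> T0; rewrite -(prim_convolution (ksiT T) (ni T)) /m /prim.
  have wpi := cintegrable_prim (wi T).
  rewrite -(cintegralZl c (mI T) (ippf T)) -(cintegralZl (c * f0) (mI T) wpi) -(cintegralZl lam (mI T) (kni T)).
  rewrite -cintegralB; [|exact: mI|by apply: cintegrableZl; [exact: mI|exact: ippf]|by apply: cintegrableZl; [exact: mI|exact: wpi]].
  rewrite -cintegralD; [|exact: mI|exact: ni|by apply: cintegrableZl; [exact: mI|exact: kni]].
  by apply: eq_cintegral => x; rewrite /= in_itv /= => /andP[x0 xT]; exact: E10.
have [MF MF0 bF] := ccvg_bounded fsi cF.
have [MG MG0 bG] := ccvg_bounded gsi cG.
have cbF T : cbounded `[0, T] (prim fs) MF.
  by move=> x; rewrite /= in_itv /= => /andP[/bF].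
have cbG T : cbounded `[0, T] (prim gs) MG.
  by move=> x; rewrite /= in_itv /= => /andP[/bG].
have mpf T : cmeasurable `[0, T] (prim fs) by exact: cmeasurable_prim.
have mpg T : cmeasurable `[0, T] (prim gs) by exact: cmeasurable_prim.
have LF : ccvg (fun T => (T^-1)%:C * prim (prim fs) T) F by exact: ccvg_cesaro mpf cbF cF.
have LG : ccvg (fun T => (T^-1)%:C * prim (prim gs) T) G by exact: ccvg_cesaro mpg cbG cG.
have LFF : ccvg (fun T => (T^-1)%:C * convolution (prim fs) (prim fs) T) (F * F).
  exact: (ccvg_convolution mpf mpf cbF cbF cF cF).
have sn0 : s != 0 by apply: contraTneq s0 => ->; rewrite ltxx.
have pwE T : 0 <= T -> prim w T = s^-1 * (1 - w T).
  move=> T0; have [wsi <-] := integral_expw s T0.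
  rewrite -cintegralZl; [|exact: mI|exact: wsi].
  by apply: eq_cintegral => x _; rewrite mulKf.
have cw : ccvg (prim w) (s^-1).
  have := ccvgZ s^-1 (ccvgD (ccvg_cst 1) (ccvgZ (-1) (ccvg_expw s0))).
  rewrite mulr0 addr0 mulr1; apply: ccvg_eq => T T0.
  by rewrite pwE ?ltW// mulN1r.
have [MW MW0 bW] := ccvg_bounded wi cw.
have cbW T : cbounded `[0, T] (prim w) MW.
  by move=> x; rewrite /= in_itv /= => /andP[/bW].
have LW : ccvg (fun T => (T^-1)%:C * prim (prim w) T) s^-1.
  by apply: ccvg_cesaro cbW cw => T; exact: cmeasurable_prim.
have LM : ccvg (fun T => (T^-1)%:C * m T) (G + A * F ^+ 2).
  have := ccvgD LG (ccvgZ A LFF); rewrite expr2; apply: ccvg_eq => T _.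
  by rewrite mE mulrDr; congr (_ + _); rewrite mulrCA.
have [C mC] : exists C, forall x, 0 <= x -> `|Re (m x)| <= C * x /\ `|Im (m x)| <= C * x.
  exact: prim_linear_bound qsi LM.
have LKM := ccvg_convolution_kernel ksi (fun T => cintegrable_meas (cintegrable_prim (ni T))) mC LM.
have L1 := ccvgD LM (ccvgZ lam LKM).
have L2 := ccvgD (ccvgZ c LF) (ccvgZ (- (c * f0)) LW).
have L3 : ccvg (fun T => (T^-1)%:C * m T + lam * ((T^-1)%:C * convolution ks m T)) (c * F - c * f0 / s).
  rewrite -mulNr; apply: ccvg_eq L2 => T T0.
  have -> : forall t u v : R[i], t * u + lam * (t * v) = t * (u + lam * v) by move=> *; ring.
  rewrite -(E11 _ (ltW T0)).
  by have -> : forall t u v : R[i], c * (t * u) + - (c * f0) * (t * v) = t * (c * u - c * f0 * v) by move=> *; ring.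
by rewrite (ccvg_unique L3 L1); ring.
Qed.

End Master.

(** * Integrals of derivatives that exist everywhere *)

Section FundamentalTheorem.
Variable R : realType.
Notation mu := (@lebesgue_measure R).
Implicit Types (f F g H : R -> R) (a b c x y : R).

(** Outer regularity gives open sets U_k containing N of measure at most
e / 2^(k+1); g is the sum of their indicators, which is at least K on the
intersection of the first K of them. *)
Lemma null_set_spike (N : set R) (e : R) : 0 < e -> mu.-negligible N ->
  exists g : R -> \bar R, [/\ measurable_fun [set: measurableTypeR R] g,
    forall x, (0 <= g x)%E, (\int[mu]_x g x <= e%:E)%E &
    forall x (K : nat), N x -> \forall y \near x, (K%:R%:E <= g y)%E].
Proof.
move=> e0 [A [mA A0 NA]].
have ek (k : nat) : 0 < e / (2 ^ k.+1)%:R by rewrite divr_gt0// ltr0n expn_gt0.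
have muA : (mu A < +oo)%E by rewrite A0.
have [U hU] := choice (fun k : nat => lebesgue_regularity_outer mA muA (ek k)).
have oU k : open (U k) by have [] := hU k.
have AU k : A `<=` U k by have [] := hU k.
have mU k : measurable (U k : set (measurableTypeR R)) by apply: open_measurable.
have eU k : (mu (U k) <= (e / (2 ^ k.+1)%:R)%:E)%E.
  have [_ _ h] := hU k.
  rewrite (measureDI mu (mU k) mA) -[leRHS]adde0; apply: leeD; first exact: ltW.
  rewrite -A0; apply: le_measure; rewrite ?inE//; first exact: measurableI.
exists (fun x => \sum_(k <oo) (\1_(U k) x)%:E)%E; split.
- apply: ge0_emeasurable_sum => [k x _ _|k _]; first by rewrite lee_fin.
  exact/measurable_EFinP/measurable_indic.
- by move=> x; apply: nneseries_ge0 => k _ _; rewrite lee_fin.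
- rewrite integral_nneseries//; last first.
    by move=> k; apply/measurable_EFinP; exact: measurable_indic.
  apply: (@le_trans _ _ (\sum_(k <oo) (e / (2 ^ k.+1)%:R)%:E)%E); last exact: epsilon_trick0 (ltW e0).
  apply: lee_nneseries => [k _ _|k _]; first by apply: integral_ge0 => x _; rewrite lee_fin.
  by rewrite integral_indic// setIT; exact: eU.
- move=> x K Nx.
  have : \forall y \near x, forall k, (k < K)%N -> U k y.
    elim: K => [|K IH]; first by apply: (@filterS _ (nbhs x) _ setT) => [y _ k|]; [rewrite ltn0|exact: filterT].
    have h : \forall y \near x, U K y by apply: open_nbhs_nbhs; split => //; apply: AU; exact: NA.
    apply: filterS2 IH h => y h1 h2 k; rewrite ltnS leq_eqVlt => /predU1P[->//|]; exact: h1.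
  apply: filterS => y Uy.
  apply: (@le_trans _ _ (\sum_(0 <= k < K) (\1_(U k) y)%:E)%E).
    rewrite (eq_big_nat _ _ (F2 := fun=> 1%:E)); last first.
      by move=> k /andP[_ kK]; rewrite indicE mem_set//; exact: Uy.
    by rewrite sumEFin sumr_const_nat subn0.
  by apply: nneseries_lim_ge => k _; rewrite lee_fin.
Qed.

(** The supremum of the points of [a, b] where P holds satisfies P by the closure
hypothesis, and would not be an upper bound if it were less than b. *)
Lemma real_induction (P : R -> Prop) a b : a <= b -> P a ->
  (forall c, a < c <= b -> (forall d, 0 < d -> exists x, [/\ a <= x <= c, c - d < x & P x]) -> P c) ->
  (forall c, a <= c < b -> P c -> exists2 d, 0 < d & forall y, c < y < c + d -> y <= b -> P y) ->
  P b.
Proof.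
move=> ab Pa Pcl Pop.
pose S := [set x | a <= x <= b /\ P x].
have Sa : S a by rewrite /S /= lexx ab.
have Sb : ubound S b by move=> x [/andP[_]].
have hS : has_sup S by split; [exists a|exists b].
set c := sup S.
have ac : a <= c by apply: ub_le_sup => //; case: hS.
have cb : c <= b by apply: ge_sup => //; exists a.
have Pc : P c.
  move: ac; rewrite le_eqVlt => /predU1P[<-//|ac].
  apply: Pcl; first by rewrite ac.
  move=> d d0; have [x [/andP[ax xb] Px] cx] := sup_adherent d0 hS.
  by exists x; split => //; rewrite ax /=; apply: ub_le_sup; [case: hS|split; [rewrite ax|]].
move: cb; rewrite le_eqVlt => /predU1P[<-//|cb].
have [d d0 hd] := Pop c (introT andP (conj ac cb)) Pc.
pose y := Num.min b (c + d / 2).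
have cy : c < y by rewrite lt_min cb ltrDl divr_gt0.
have yb : y <= b by rewrite ge_min lexx.
have Py : P y.
  apply: hd => //; rewrite cy gt_min ltrD2l ltr_pdivrMr// ltr_pMr// ?ltr1n ?orbT//.
have : y <= c by apply: ub_le_sup; [case: hS|split => //; rewrite yb andbT (le_trans ac)// ltW].
by rewrite leNgt cy.
Qed.

Lemma right_increment_le f c (eta : R) : derivable f c 1 -> derive1 f c < eta ->
  exists2 d, 0 < d & forall y, c < y < c + d -> f y - f c <= eta * (y - c).
Proof.
move=> df fe.
have [d /= d0 hd] : \forall h \near 0^', h^-1 *: (f (h + c) - f c) < eta.
  have := df => /cvg_ex [l hl].
  have El : derive1 f c = l.
    apply/cvg_lim; first exact: Rhausdorff.
    by apply: cvg_trans hl; apply: near_eq_cvg; near=> h; rewrite scaler1.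
  have : \forall h \near 0^', h^-1 *: (f (h *: 1 + c) - f c) < eta.
    by apply: (cvgr_lt l hl); rewrite -El.
  by apply: filterS => h; rewrite scaler1.
exists d => // y /andP[cy ycd].
have h0 : 0 < y - c by rewrite subr_gt0.
have := hd (y - c); rewrite /= sub0r normrN gtr0_norm// ltrBlDl => /(_ ycd).
rewrite gt_eqF// subrK => /(_ isT); rewrite /GRing.scale /= => /ltW.
by rewrite mulrC ler_pdivrMr.
Unshelve. all: by end_near. Qed.

Lemma Rintegral_split (h : R -> R) a c y : a <= c -> c <= y -> mu.-integrable `[a, y] (EFin \o h) ->
  \int[mu]_(x in `[a, y]) h x = \int[mu]_(x in `[a, c]) h x + \int[mu]_(x in `]c, y]) h x.
Proof.
move=> ac cy hi; have := @Rintegral_itvB R h (BLeft a) (BRight y) c hi.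
rewrite !bnd_simp => /(_ ac cy) <-; ring.
Qed.

Lemma mu_itvoc c y : c <= y -> fine (mu `]c, y]%classic) = y - c.
Proof.
rewrite le_eqVlt => /predU1P[->|cy].
  by rewrite set_itv_ge ?bnd_simp ?ltxx//= measure0 subrr.
by rewrite lebesgue_measure_itv /= lte_fin cy.
Qed.

Lemma mu_itvoc_lty c y : (mu `]c, y]%classic < +oo)%E.
Proof. by rewrite lebesgue_measure_itv /=; case: ifPn => // _; rewrite -EFinB ltry. Qed.

Lemma integrable_patch (D : set R) f : measurable D -> mu.-integrable D (EFin \o f) ->
  mu.-integrable setT (EFin \o (f \_ D)).
Proof.
move=> mD fi; rewrite -restrict_EFin.
have mD' : measurable (D : set (measurableTypeR R)) := mD.
exact: (@integrable_mkcond _ _ _ mu _ (EFin \o f) mD').1 fi.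
Qed.

Lemma Rintegral_ge_const (h : R -> R) (K : R) c y : c <= y -> mu.-integrable `]c, y] (EFin \o h) ->
  (forall x, c < x <= y -> K <= h x) -> K * (y - c) <= \int[mu]_(x in `]c, y]) h x.
Proof.
move=> cy hi hK; rewrite -(mu_itvoc cy) -Rintegral_cst//.
apply: le_Rintegral => //.
  apply: measurable_bounded_integrable => //; last exact: bounded_cst.
  exact: mu_itvoc_lty.
Qed.

(** The function f x - f a stays below F x + G x + eta (x - a), with F the primitive
of H and G that of a spike function g over the exceptional null set.  At a point
where F is differentiable with derivative H, the derivative of f - F is at most 0,
hence less than eta.  At an exceptional point G grows faster than any given slope, which
outweighs both f and the possible decrease of F, of slope at most n because H
is at least - n. *)
Lemma increment_le f H (n e eta : R) a b : a < b -> 0 < e -> 0 < eta ->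
  (forall x, a <= x <= b -> derivable f x 1) ->
  mu.-integrable `[a, b] (EFin \o H) ->
  (forall x, a <= x <= b -> derive1 f x <= H x /\ - n <= H x) -> 0 <= n ->
  f b - f a <= \int[mu]_(x in `[a, b]) H x + e + eta * (b - a).
Proof.
move=> ab e0 eta0 df Hi fH n0.
pose Hb := H \_ `[a, b].
have Hbi : mu.-integrable setT (EFin \o Hb).
  exact: integrable_patch (measurable_itv _) Hi.
have HbI (i : interval R) : mu.-integrable [set` i] (EFin \o Hb).
  by apply: integrableS Hbi => //; exact: measurable_itv.
have HbE x : a <= x <= b -> Hb x = H x.
  by move=> xab; rewrite /Hb patchE mem_setE in_itv /= xab.
pose F y := \int[mu]_(t in [set` Interval (BLeft a) (BRight y)]) Hb t.
have Fb : F b = \int[mu]_(x in `[a, b]) H x.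
  by apply: eq_Rintegral => x; rewrite inE /= in_itv /= => /HbE.
have aeF : Filter (almost_everywhere mu) := ae_filter_ringOfSetsType mu.
have FTC : {ae mu, forall x, a < x -> derivable F x 1 /\ derive1 F x = Hb x}.
  have Hloc : locally_integrable setT Hb by exact: integrable_locally.
  have h := @FTC1 R Hb (BLeft a) (fun y => HbI (Interval (BLeft a) (BRight y))) Hloc.
  by apply: filterS h => x hx ax; apply: hx; rewrite lte_fin.
pose good := [set x | a < x -> derivable F x 1 /\ derive1 F x = Hb x].
have Nnull : mu.-negligible (~` good `|` [set a]).
  apply: negligibleU; first exact: FTC.
  exists [set a]; split => //; exact: lebesgue_measure_set1.
have [g [mg g0 ge gN]] := null_set_spike e0 Nnull.
have gfin (i : interval R) : (\int[mu]_(x in [set` i]) g x <= e%:E)%E.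
  by apply: le_trans ge; apply: ge0_subset_integral => //; exact: measurable_itv.
have gfin' (i : interval R) : (\int[mu]_(x in [set` i]) g x \is a fin_num)%E.
  by rewrite ge0_fin_numE ?integral_ge0//; apply: le_lt_trans (gfin i) _; rewrite ltry.
pose G y := fine (\int[mu]_(x in `[a, y]) g x)%E.
have G0 y : 0 <= G y by apply: fine_ge0; apply: integral_ge0.
have Gsplit c y : a <= c -> c <= y -> G y = G c + fine (\int[mu]_(x in `]c, y]) g x)%E.
  move=> ac cy; rewrite /G -fineD; [|exact: gfin'|exact: gfin'].
  rewrite -ge0_integral_setU//=; last 2 first.
  - exact: measurable_funTS.
  - apply/disj_setPS => x [/=]; rewrite !in_itv/= => /andP[_ xc] /andP[].
    by rewrite ltNge xc.
  congr fine; congr (integral _ _ _).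
  apply/seteqP; split => x /=; rewrite !in_itv /=.
    by move=> /andP[-> xy]; case: (leP x c) => _; [left|right].
  by move=> [/andP[-> /le_trans->//]|/andP[/ltW cx ->]]; rewrite andbT (le_trans ac).
have Gmon c y : a <= c -> c <= y -> G c <= G y.
  by move=> ac cy; rewrite (Gsplit c y)// lerDl fine_ge0// integral_ge0.
have GK c y (K : nat) : a <= c -> c <= y -> (forall x, c < x <= y -> (K%:R%:E <= g x)%E) ->
    K%:R * (y - c) <= G y - G c.
  move=> ac cy h; rewrite (Gsplit c y)// addrAC subrr add0r.
  rewrite -(mu_itvoc cy) -lee_fin fineK; last exact: gfin'.
  have -> : (K%:R * fine (mu `]c, y]%classic))%:E = (\int[mu]_(x in `]c, y]) (K%:R)%:E)%E.
    rewrite integral_cst//= EFinM fineK//.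
    by rewrite ge0_fin_numE//; exact: mu_itvoc_lty.
  apply: ge0_le_integral => //.
  exact: measurable_funTS.
have Fsplit c y : a <= c -> c <= y -> F y = F c + \int[mu]_(x in `]c, y]) Hb x.
  by move=> ac cy; apply: Rintegral_split => //; exact: HbI.
have FN c y : a <= c -> c <= y -> y <= b -> - n * (y - c) <= F y - F c.
  move=> ac cy yb; rewrite (Fsplit c y)// addrAC subrr add0r.
  apply: (Rintegral_ge_const cy (HbI _)) => x /andP[cx xy].
  have xab : a <= x <= b by rewrite (le_trans xy yb) andbT (le_trans ac)// ltW.
  by rewrite HbE//; have [] := fH x xab.
have cf x : a <= x <= b -> {for x, continuous f}.
  by move=> /df h; apply/differentiable_continuous/derivable1_diffP.
have : f b - f a <= F b + G b + eta * (b - a).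
  apply: (@real_induction (fun x => f x - f a <= F x + G x + eta * (x - a)) a b (ltW ab)).
  - by rewrite !subrr mulr0 addr0 addr_ge0// /F set_itv1 Rintegral_set1.
  - move=> c /andP[ac cb] hc.
    apply/ler_addgt0Pr => d d0.
    have d20 : 0 < d / 2 by rewrite divr_gt0.
    have cfc : {for c, continuous f} by apply: cf; rewrite cb ltW.
    have [r /= r0 hr] : \forall x \near c, `|f c - f x| <= d / 2.
      by have /cvgrPdist_le/(_ _ d20) := cfc.
    pose r' := Num.min r (d / 2 / (n + 1)).
    have n1 : 0 < n + 1 by rewrite ltr_wpDl.
    have r'0 : 0 < r' by rewrite lt_min r0 divr_gt0.
    have [x [/andP[ax xc] cx Px]] := hc r' r'0.
    have cxr : c - x < r' by rewrite ltrBlDl -ltrBlDr.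
    have h1 : `|f c - f x| <= d / 2.
      by apply: hr; rewrite /= ger0_norm ?subr_ge0// (lt_le_trans cxr)// ge_min lexx.
    have h2 : n * (c - x) <= d / 2.
      apply: (@le_trans _ _ ((n + 1) * (c - x))); first by rewrite ler_wpM2r ?subr_ge0// lerDl.
      rewrite mulrC -ler_pdivlMr//; apply: (le_trans (ltW cxr)).
      by rewrite ge_min lexx orbT.
    have h3 := FN _ _ ax xc cb.
    have h4 := Gmon _ _ ax xc.
    have h5 : eta * (x - a) <= eta * (c - a) by rewrite ler_pM2l// lerD2r.
    have h6 := le_trans (ler_norm _) h1.
    rewrite mulNr in h3; lra.
  - move=> c /andP[ac cb] Pc.
    have cab : a <= c <= b by rewrite ac ltW.
    have [h1 h2] := fH c cab.
    suff [d d0 hd] : exists2 d, 0 < d & forall y, c < y < c + d -> y <= b ->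
        f y - f c <= F y - F c + (G y - G c) + eta * (y - c).
      by exists d => // y ycd yb; have := hd y ycd yb; lra.
    (* the endpoint a is treated as exceptional: FTC says nothing about the
       derivative of F there *)
    have [[gc ca]|ngc] := pselect (good c /\ c <> a).
      have [dF F'] : derivable F c 1 /\ derive1 F c = Hb c by apply: gc; rewrite lt_neqAle ac andbT eq_sym; apply/eqP.
      have dfF : derivable (f - F) c 1 by exact: derivableB (df c cab) dF.
      have : derive1 (f - F) c < eta.
        rewrite derive1E (deriveB (df c cab) dF).
        rewrite -!derive1E F' HbE//; lra.
      move=> /(right_increment_le dfF)[d d0 hd]; exists d => // y ycd yb.
      have [/andP[cy _]] := (ycd, hd y ycd).
      have := Gmon c y ac (ltW cy); rewrite /= !fctE; lra.
    (* a slope that compensates that of f, plus n for the decrease of F *)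
    pose K := (Num.trunc (derive1 f c + 1 + n)).+1.
    have hK : derive1 f c + 1 + n <= K%:R by rewrite ltW// truncnS_gt.
    have f1 : derive1 f c < derive1 f c + 1 by rewrite ltrDl.
    have [d1 d10 hd1] := right_increment_le (df c cab) f1.
    have ngc' : (~` good `|` [set a]) c.
      by have [gc|gc] := pselect (good c); [right; apply: contrapT => ca; apply: ngc|left].
    have [d2 /= d20 hd2] := gN c K ngc'.
    exists (Num.min d1 d2); first by rewrite lt_min d10.
    move=> y /andP[cy]; rewrite -ltrBDl lt_min => /andP[y1 y2] yb.
    have g1 : f y - f c <= (derive1 f c + 1) * (y - c).
      by apply: hd1; rewrite cy -ltrBDl.
    have g2 := FN c y ac (ltW cy) yb.
    have g3 : K%:R * (y - c) <= G y - G c.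
      apply: (GK c y K ac (ltW cy)) => x /andP[cx xy].
      apply: hd2; rewrite /= ltr0_norm ?subr_lt0// opprB.
      by apply: le_lt_trans y2; rewrite lerD2r.
    have cy' : 0 <= y - c by rewrite subr_ge0 ltW.
    have g4 : (derive1 f c + 1 + n) * (y - c) <= K%:R * (y - c) by rewrite ler_wpM2r.
    have g5 : 0 <= eta * (y - c) by rewrite mulr_ge0// ltW.
    rewrite [leLHS]mulrDl in g4; rewrite mulNr in g2; lra.
move=> h; apply: (le_trans h); rewrite Fb lerD2r lerD2l -lee_fin fineK; last exact: gfin'.
exact: gfin.
Qed.

Lemma cvg_truncation (h : R -> R) a b : mu.-integrable `[a, b] (EFin \o h) ->
  \int[mu]_(x in `[a, b]) Num.max (h x) (- n%:R) @[n --> \oo] --> \int[mu]_(x in `[a, b]) h x.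
Proof.
move=> hi; have mh : measurable_fun (`[a, b]%classic : set (measurableTypeR R)) h.
  by apply/measurable_EFinP; exact: measurable_int hi.
have m1 n : measurable_fun (`[a, b]%classic : set (measurableTypeR R))
    (fun x => (Num.max (h x) (- n%:R))%:E).
  by apply/measurable_EFinP; apply: measurable_maxr => //; exact: measurable_cst.
have m2 : measurable_fun (`[a, b]%classic : set (measurableTypeR R)) (EFin \o h).
  exact/measurable_EFinP.
have [||li _ cv] := @dominated_convergence _ _ _ mu _ (measurable_itv `[a, b])
  (fun n x => (Num.max (h x) (- n%:R))%:E) (EFin \o h) (EFin \o (fun x => `|h x|)) m1 m2 _
  (integrable_norm hi) _.
- apply: aeW => x _; apply: cvg_near_cst; near=> n; apply/eqP; rewrite eqe eq_maxl.
  have : `|h x| <= n%:R by near: n; exact: nbhs_infty_ger.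
  by rewrite ler_norml => /andP[].
- apply: aeW => x n _; rewrite lee_fin maxEle; case: ifPn => // hn.
  rewrite normrN (ger0_norm (ler0n _ n)) ler0_norm; first by rewrite lerNr.
  by rewrite (le_trans hn)// oppr_le0.
apply: fine_cvg; rewrite /Rintegral fineK; first exact: cv.
exact: (@integrable_fin_num _ _ _ mu _ _ _ li).
Unshelve. all: by end_near. Qed.

(** increment_le is applied to H = max(f', - N); as N grows the integral of H tends
to that of f'. *)
Lemma increment_le_integral f a b : a < b ->
  (forall x, a <= x <= b -> derivable f x 1) ->
  mu.-integrable `[a, b] (EFin \o derive1 f) ->
  f b - f a <= \int[mu]_(x in `[a, b]) derive1 f x.
Proof.
move=> ab df fi; apply/ler_addgt0Pr => e e0.
have e30 : 0 < e / 3 by rewrite divr_gt0.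
have mf : measurable_fun (`[a, b]%classic : set (measurableTypeR R)) (derive1 f).
  by apply/measurable_EFinP; exact: measurable_int fi.
have /cvgrPdist_le/(_ _ e30)[N _ hN] := cvg_truncation fi.
have := hN N (leqnn N); rewrite distrC => /(le_trans (ler_norm _)) {}hN.
pose H x := Num.max (derive1 f x) (- N%:R).
have Hi : mu.-integrable `[a, b] (EFin \o H).
  apply: (@le_integrable _ _ _ mu _ (measurable_itv _) _ (EFin \o (fun x => `|derive1 f x|))).
  - by apply/measurable_EFinP; apply: measurable_maxr => //; exact: measurable_cst.
  - move=> x _; rewrite lee_fin normr_id /H maxEle; case: ifPn => // hn.
    rewrite normrN (ger0_norm (ler0n _ N)) ler0_norm; first by rewrite lerNr.
    by rewrite (le_trans hn)// oppr_le0.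
  - exact: integrable_norm.
have eta0 : 0 < e / 3 / (b - a) by rewrite divr_gt0// subr_gt0.
have h := increment_le ab e30 eta0 df Hi.
have : forall x, a <= x <= b -> derive1 f x <= H x /\ - N%:R <= H x.
  by move=> x _; rewrite /H !le_max !lexx orbT.
move=> /h /(_ (ler0n _ _)); rewrite divfK; last by rewrite gt_eqF// subr_gt0.
rewrite -/(H) in hN; move: hN; rewrite -/H; lra.
Qed.

(** The reverse inequality is increment_le_integral for - f. *)
Lemma increment_eq_integral f a b : a < b ->
  (forall x, a <= x <= b -> derivable f x 1) ->
  mu.-integrable `[a, b] (EFin \o derive1 f) ->
  \int[mu]_(x in `[a, b]) derive1 f x = f b - f a.
Proof.
move=> ab df fi; apply/eqP; rewrite eq_le; apply/andP; split; last exact: increment_le_integral.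
have dN x : a <= x <= b -> derive1 (- f) x = - derive1 f x.
  by move=> xab; rewrite !derive1E deriveN//; exact: df.
have Ni : mu.-integrable `[a, b] (EFin \o (fun x => - derive1 f x)).
  exact: RintegrableN.
have Ni' : mu.-integrable `[a, b] (EFin \o derive1 (- f)).
  apply: eq_integrable Ni => // x; rewrite inE /= in_itv /= => /dN -> //.
have := @increment_le_integral (- f) a b ab _ Ni'.
have -> : \int[mu]_(x in `[a, b]) derive1 (- f) x = - \int[mu]_(x in `[a, b]) derive1 f x.
  have hZ : \int[mu]_(x in `[a, b]) (-1 * derive1 f x) = -1 * \int[mu]_(x in `[a, b]) derive1 f x.
    exact: (RintegralZl (-1) (measurable_itv `[a, b] : measurable (_ : set (measurableTypeR R))) fi).
  rewrite -[RHS]mulN1r -hZ; apply: eq_Rintegral => x; rewrite inE /= in_itv /= => /dN ->.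
  by rewrite mulN1r.
have dfN : forall x, a <= x <= b -> derivable (- f) x 1 by move=> x /df h; exact: derivableN.
move=> /(_ dfN); rewrite !fctE; lra.
Qed.

(** The formula on [a, T] is passed to the limit a -> 0, where f a tends to f 0 by
right continuity. *)
Lemma increment_eq_integral0 f T : 0 <= T ->
  (forall x, 0 < x -> derivable f x 1) -> f x @[x --> 0^'+] --> f 0 ->
  mu.-integrable `[0, T] (EFin \o derive1 f) ->
  \int[mu]_(x in `[0, T]) derive1 f x = f T - f 0.
Proof.
rewrite le_eqVlt => /predU1P[<-|T0] df f0 fi; first by rewrite set_itv1 Rintegral_set1 subrr.
pose I a := \int[mu]_(x in `[0, a]) derive1 f x.
have cI : I a @[a --> 0^'+] --> 0.
  have : {within `[0, T], continuous I} := parameterized_integral_continuous (ltW T0) fi.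
  move=> /(continuous_within_itvP _ T0)[_ + _].
  by rewrite /I set_itv1 Rintegral_set1.
have E a : 0 < a < T -> \int[mu]_(x in `[0, T]) derive1 f x = I a + (f T - f a).
  move=> /andP[a0 aT].
  rewrite (@Rintegral_split _ 0 a T)//; [|exact: ltW|exact: ltW].
  congr (_ + _).
  have sub : `[a, T]%classic `<=` (`[0, T]%classic : set R).
    by move=> x; rewrite /= !in_itv /= => /andP[ax ->]; rewrite andbT (le_trans _ ax)// ltW.
  have fia : mu.-integrable `[a, T] (EFin \o derive1 f) by apply: integrableS fi.
  rewrite -(increment_eq_integral aT)// => [|x /andP[ax _]]; last exact/df/lt_le_trans/ax.
  apply: Rintegral_itv_obnd_cbnd.
  apply: integrableS fia => // x; rewrite /= !in_itv /= => /andP[/ltW-> ->] //.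
have c1 : I a + (f T - f a) @[a --> 0^'+] --> 0 + (f T - f 0).
  by apply: cvgD => //; apply: cvgB => //; exact: cvg_cst.
rewrite add0r in c1.
apply: (cvg_unique _ _ c1); first exact: Rhausdorff.
apply: cvg_near_cst; near=> a; rewrite (E a)//; apply/andP; split; near: a.
  exact: nbhs_right_gt.
exact: nbhs_right_lt.
Unshelve. all: by end_near. Qed.

End FundamentalTheorem.

(** * Gamma and Beta integrals *)

Section GammaIntegral.
Variable R : realType.
Notation mu := (@lebesgue_measure R).
Implicit Types (a b p t x y T M : R).

Lemma measurable_powR_itv (D : set R) a : measurable_fun (D : set (measurableTypeR R)) (fun x => x `^ a).
Proof. by apply: measurable_funTS; exact: measurable_powR. Qed.

Lemma derive1_powR_pos a t : 0 < t -> derivable (fun x => x `^ a) t 1 /\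
  derive1 (fun x => x `^ a) t = a * t `^ (a - 1).
Proof.
move=> t0; have tp : t \in `]0, +oo[ by rewrite in_itv /= t0.
by split; [exact: derivable_powR|exact: powR_derive1].
Qed.

(** The integrals over [1/i, T] are bounded by T^a / a and increase to the integral
over ]0, T]. *)
Lemma integrable_powR a T : 0 < a -> mu.-integrable `[0, T] (EFin \o (fun x => x `^ (a - 1))).
Proof.
move=> a0.
have mf (D : set R) : measurable_fun (D : set (measurableTypeR R)) (fun x => (x `^ (a - 1))%:E).
  by apply/measurable_EFinP; exact: measurable_powR_itv.
have f0 x : (0 <= (x `^ (a - 1))%:E)%E by rewrite lee_fin powR_ge0.
have [T0|T0] := ltP 0 T; last first.
  apply: (@integrableS _ _ _ mu `[0, 0]%classic) => //.
    by move=> x; rewrite /= !in_itv /= => /andP[-> /le_trans]; apply.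
  rewrite set_itv1; apply: null_set_integrable => //; exact: lebesgue_measure_set1.
pose F (i : nat) := `[i.+1%:R^-1, T]%classic : set R.
have mF i : measurable (F i : set (measurableTypeR R)) by exact: measurable_itv.
have muF i : (mu (F i) < +oo)%E.
  by rewrite lebesgue_measure_itv/=; case: ifPn => // _; rewrite -EFinB ltry.
have bound i : (\int[mu]_(x in F i) (x `^ (a - 1))%:E <= (a^-1 * T `^ a)%:E)%E.
  have e0 : 0 < i.+1%:R^-1 :> R by rewrite invr_gt0.
  have [eT|Te] := ltP i.+1%:R^-1 T; last first.
    rewrite (_ : (\int[mu]_(x in F i) _ = 0)%E) ?lee_fin ?mulr_ge0 ?invr_ge0 ?powR_ge0 ?ltW//.
    apply: (@integral_Sset1 _ _ _ T) => x; rewrite /F /= in_itv /= => /andP[h1 h2].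
    by apply/eqP; rewrite eq_le h2 (le_trans Te).
  have int : mu.-integrable (F i) (EFin \o (fun x => x `^ (a - 1))).
    apply: (measurable_bounded_integrable (mF i) (muF i)).
      exact: measurable_powR_itv.
    exists (Num.max (i.+1%:R^-1 `^ (a - 1)) (T `^ (a - 1))); split; first exact: num_real.
    move=> M hM x; rewrite /F /= in_itv /= => /andP[h1 h2].
    rewrite ger0_norm ?powR_ge0//; apply: le_trans (ltW hM).
    have x0 : 0 < x by exact: lt_le_trans h1.
    rewrite le_max; have [a1|a1] := leP 0 (a - 1).
      by apply/orP; right; apply: (ge0_ler_powR a1) h2; rewrite nnegrE ltW.
    apply/orP; left; rewrite -[a - 1]opprK !(powRN _ (- (a - 1))) lef_pV2 ?posrE ?powR_gt0//.
    have a1' : 0 <= - (a - 1) by rewrite oppr_ge0 ltW.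
    by apply: (ge0_ler_powR a1') h1; rewrite nnegrE ltW.
  have d1 x : i.+1%:R^-1 <= x <= T -> derivable (fun x => x `^ a) x 1.
    by move=> /andP[h1 _]; have [] := @derive1_powR_pos a x (lt_le_trans e0 h1).
  have d2 x : i.+1%:R^-1 <= x <= T -> derive1 (fun x => x `^ a) x = a * x `^ (a - 1).
    by move=> /andP[h1 _]; have [] := @derive1_powR_pos a x (lt_le_trans e0 h1).
  have int' : mu.-integrable `[i.+1%:R^-1, T] (EFin \o derive1 (fun x => x `^ a)).
    apply: (@eq_integrable _ _ _ mu _ _ (EFin \o (fun x => a * x `^ (a - 1)))) => //.
      by move=> x; rewrite inE /= in_itv /= => /d2 ->.
    exact: RintegrableZl.
  have := increment_eq_integral eT d1 int'.
  have -> : \int[mu]_(x in `[i.+1%:R^-1, T]) derive1 (fun x => x `^ a) x =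
     a * \int[mu]_(x in F i) x `^ (a - 1).
    rewrite -RintegralZl//; apply: eq_Rintegral => x; rewrite inE /= in_itv /= => /d2 -> //.
  move=> h.
  rewrite -(@fineK _ (\int[mu]_(x in F i) (x `^ (a - 1))%:E)%E); last first.
    exact: (@integrable_fin_num _ _ _ mu _ _ _ int).
  rewrite lee_fin -ler_pdivrMl ?invr_gt0// invrK h lerBlDr lerDl powR_ge0//.
have U : \bigcup_i F i = `]0, T]%classic.
  apply/seteqP; split => x.
    by move=> [i _]; rewrite /F /= !in_itv /= => /andP[h ->]; rewrite andbT (lt_le_trans _ h)// invr_gt0.
  rewrite /= in_itv /= => /andP[x0 xT].
  exists (Num.trunc x^-1) => //; rewrite /F /= in_itv /= xT andbT invf_ple ?posrE ?ltr0Sn//.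
  by rewrite ltW// truncnS_gt.
have lim : (\int[mu]_(x in `]0%R, T]) (x `^ (a - 1))%:E <= (a^-1 * T `^ a)%:E)%E.
  have cv : (\int[mu]_(x in F i) (x `^ (a - 1))%:E)%E @[i --> \oo] -->
            (\int[mu]_(x in \bigcup_i F i) (x `^ (a - 1))%:E)%E.
    apply: ge0_nondecreasing_set_cvg_integral.
    - move=> i j ij; apply/subsetPset => x; rewrite /F /= !in_itv /= => /andP[h ->]; rewrite andbT.
      by apply: le_trans h; rewrite lef_pV2 ?posrE ?ltr0Sn// ler_nat.
    - exact: mF.
    - by move=> i; exact: mf.
    - by move=> i x _; exact: f0.
  by rewrite -U; apply: (cvge_to_le cv); exact: nearW.
apply/integrableP; split; first exact: mf.
have -> : (fun x : R => `|(EFin \o (fun x : R => x `^ (a - 1))%R) x|%E) = (fun x : R => (x `^ (a - 1))%:E).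
  by apply/funext => x; rewrite /= ger0_norm ?powR_ge0.
rewrite -integral_itv_obnd_cbnd; last exact: mf.
by apply: le_lt_trans lim _; rewrite ltry.
Qed.

Lemma integrable_expR_neg p : 0 < p -> mu.-integrable `[0, +oo[ (EFin \o (fun x => expR (- (p * x)))).
Proof.
move=> p0.
have := @integrable_exponential_pdf R p p0.
move=> /(@integrableS _ _ _ mu setT `[0, +oo[%classic _ measurableT (measurable_itv _)) => /(_ (fun _ _ => I)) h.
have := RintegrableZl p^-1 (measurable_itv _) h.
apply: eq_integrable => // x; rewrite inE /= => x0.
by rewrite /exponential_pdf patchE mem_set// mulKf ?gt_eqF// mulNr.
Qed.

Lemma powR_le_expR a q : 0 < q -> exists2 C, 0 <= C & forall t, 1 <= t -> t `^ a <= C * expR (q * t).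
Proof.
move=> q0; pose N := (Num.trunc a).+1.
exists (N`!%:R / q ^+ N); first by rewrite divr_ge0// exprn_ge0// ltW.
move=> t t1; have t0 : 0 <= t by exact: le_trans t1.
apply: (@le_trans _ _ (t ^+ N)).
  by rewrite -powR_mulrn//; apply: ler_powR => //; rewrite ltW// truncnS_gt.
have := @expR_ge1Dxn R (q * t) (Num.trunc a) (mulr_ge0 (ltW q0) t0).
rewrite -/N => h; rewrite mulrAC ler_pdivlMr ?exprn_gt0//.
rewrite -ler_pdivrMl ?ltr0n ?fact_gt0//.
apply: le_trans h; rewrite -exprMn mulrC [t * q]mulrC; exact: ltW (ltr_pwDl _ _).
Qed.

(** Near 0 the exponential is bounded; on [1, +oo[ the power is dominated by
exp(p x / 2).  The two dominating functions are added. *)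
Lemma integrable_gamma a p : 0 < a -> 0 < p ->
  mu.-integrable `[0, +oo[ (EFin \o (fun x => x `^ (a - 1) * expR (- (p * x)))).
Proof.
move=> a0 p0.
have mf : measurable_fun [set: measurableTypeR R] (fun x : R => x `^ (a - 1) * expR (- (p * x))).
  apply: measurable_funM; first exact: measurable_powR.
  by apply: measurableT_comp => //; apply: measurableT_comp => //; exact: measurable_funM.
have i1 : mu.-integrable `[0, 1] (EFin \o (fun x => x `^ (a - 1) * expR (- (p * x)))).
  apply: (@integrableMb _ _ _ _ 1) => //; first exact: integrable_powR.
    apply: measurable_funTS.
    by apply: measurableT_comp => //; apply: measurableT_comp => //; exact: measurable_funM.
  move=> x; rewrite /= in_itv /= => /andP[x0 _].
  by rewrite ger0_norm ?expR_ge0// expR_le1 oppr_le0 mulr_ge0// ltW.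
have p20 : 0 < p / 2 by rewrite divr_gt0.
have [C C0 hC] := powR_le_expR (a - 1) p20.
have i2 : mu.-integrable `[1, +oo[ (EFin \o (fun x => x `^ (a - 1) * expR (- (p * x)))).
  have S : `[1, +oo[%classic `<=` (`[0, +oo[%classic : set R).
    by move=> x; rewrite /= !in_itv /= !andbT; apply: le_trans.
  apply: (@le_integrable _ _ _ mu _ _ _ (EFin \o (fun x => C * expR (- (p / 2 * x))))) => //.
  - by apply/measurable_EFinP; exact: measurable_funTS.
  - move=> x; rewrite /= in_itv /= andbT => x1; rewrite lee_fin.
    rewrite ger0_norm ?mulr_ge0 ?powR_ge0 ?expR_ge0// ger0_norm ?mulr_ge0 ?expR_ge0//.
    have -> : - (p / 2 * x) = p / 2 * x + - (p * x) by field.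
    by rewrite expRD mulrA ler_wpM2r ?expR_ge0//; exact: hC.
  - apply: RintegrableZl => //.
    exact: integrableS (integrable_expR_neg p20).
pose f x := x `^ (a - 1) * expR (- (p * x)).
have j1 := integrable_patch (measurable_itv _) i1.
have j2 := integrable_patch (measurable_itv _) i2.
have j := RintegrableD measurableT j1 j2.
have j' := @integrableS _ _ _ mu setT `[0, +oo[%classic _ measurableT (measurable_itv _) (fun _ _ => I) j.
apply: (le_integrable _ _ _ j') => //.
  by apply/measurable_EFinP; exact: measurable_funTS.
move=> x; rewrite /= in_itv /= andbT => x0; rewrite lee_fin !patchE !mem_setE !in_itv /= x0 /= andbT.
have f0 : 0 <= x `^ (a - 1) * expR (- (p * x)) by rewrite mulr_ge0 ?powR_ge0 ?expR_ge0.
rewrite (ger0_norm f0); case: (leP x 1) => x1; case: (leP 1 x) => x2 //.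
- by rewrite ger0_norm ?addr_ge0// lerDl.
- by rewrite addr0 ger0_norm.
- by rewrite add0r ger0_norm.
by have := lt_trans x1 x2; rewrite ltxx.
Qed.

Definition gamma_integrand a : R -> R := (fun x => x `^ (a - 1) * expR (- x)) \_ `[0, +oo[.

Lemma integrable_gamma_integrand a : 0 < a -> mu.-integrable setT (EFin \o gamma_integrand a).
Proof.
move=> a0; apply: integrable_patch; first exact: measurable_itv.
have := integrable_gamma a0 ltr01.
by apply: eq_integrable => // x _ /=; rewrite mul1r.
Qed.

Lemma Gamma_itv0y a : 0 < a -> Gamma a = \int[mu]_(x in `[0, +oo[) (x `^ (a - 1) * expR (- x)).
Proof.
move=> a0; rewrite /Gamma Rintegral_itv_obnd_cbnd//.
have h := integrable_gamma a0 ltr01.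
have E : (fun x : R => x `^ (a - 1) * expR (- (1 * x))) = (fun x => x `^ (a - 1) * expR (- x)).
  by apply/funext => x; rewrite mul1r.
rewrite E in h; apply: integrableS h; [exact: measurable_itv|exact: measurable_itv|].
by move=> x; rewrite /= !in_itv /= !andbT => /ltW.
Qed.

Lemma GammaE a : 0 < a -> Gamma a = \int[mu]_x gamma_integrand a x.
Proof. by move=> a0; rewrite Gamma_itv0y// Rintegral_mkcond. Qed.

Lemma Gamma_scaling a p : 0 < a -> 0 < p ->
  \int[mu]_(x in `[0, +oo[) (x `^ (a - 1) * expR (- (p * x))) = Gamma a * p `^ (- a).
Proof.
move=> a0 p0; rewrite GammaE//.
have me : measurable_fun [set: measurableTypeR R] (gamma_integrand a).
  by have /integrableP[/measurable_EFinP] := integrable_gamma_integrand a0.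
have := @Rintegral_image_density R _ p^-1 (gamma_integrand a) _ (image_density_affine 0 p0) me.
rewrite invr_ge0 (ltW p0) => /(_ isT) h.
have E x : gamma_integrand a (p * x + 0) = p `^ (a - 1) * ((fun x => x `^ (a - 1) * expR (- (p * x))) \_ `[0, +oo[) x.
  rewrite addr0 /gamma_integrand !patchE !mem_setE !in_itv /= !andbT pmulr_rge0//.
  by case: ifPn => x0; rewrite ?mulr0// powRM// ?(ltW p0)// mulrA.
have j := integrable_patch (measurable_itv _) (integrable_gamma a0 p0).
rewrite (funext E) in h.
rewrite (RintegralZl _ measurableT j) -Rintegral_mkcond in h.
have pn : p `^ (a - 1) != 0 by rewrite gt_eqF// powR_gt0.
apply: (mulfI pn); rewrite h mulrCA -powRD; last by rewrite (gt_eqF p0) implybT.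
by rewrite addrAC subrr add0r powR_inv1 ?ltW// mulrC.
Qed.

Lemma Gamma_ge a c M : 0 < a -> 0 <= M ->
  (forall x, M < x <= M + 1 -> c <= x `^ (a - 1) * expR (- x)) -> c <= Gamma a.
Proof.
move=> a0 M0 hc; rewrite GammaE//.
have S : mu.-integrable `]M, (M + 1)] (EFin \o gamma_integrand a).
  by apply: integrableS (integrable_gamma_integrand a0) => //; exact: measurable_itv.
apply: (@le_trans _ _ (\int[mu]_(x in `]M, (M + 1)]) gamma_integrand a x)).
  have := @Rintegral_ge_const R (gamma_integrand a) c M (M + 1) _ S.
  rewrite lerDl ler01 addrAC subrr add0r mulr1; apply => // x /andP[h1 h2].
  rewrite /gamma_integrand patchE mem_setE in_itv /= (le_trans M0 (ltW h1)) /=.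
  by apply: hc; rewrite h1.
rewrite Rintegral_mkcond; apply: le_Rintegral => //.
- by apply: integrable_patch => //; exact: measurable_itv.
- exact: integrable_gamma_integrand.
- move=> x _; rewrite patchE; case: ifPn => // _.
  rewrite /gamma_integrand patchE; case: ifPn => // _.
  by rewrite mulr_ge0 ?powR_ge0 ?expR_ge0.
Qed.

(** On ]M, M + 1] the integrand is at least M^(a-1) e^(-(M+1)).  As a grows with M
fixed but arbitrary, Gamma grows faster than any geometric sequence, which gives
the Mittag-Leffler series an infinite radius of convergence. *)
Lemma Gamma_growth a M : 1 <= a -> 0 < M -> M `^ (a - 1) * expR (- (M + 1)) <= Gamma a.
Proof.
move=> a1 M0; have a1' : 0 <= a - 1 by rewrite subr_ge0.
apply: (@Gamma_ge _ _ M) => [||x /andP[h1 h2]].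
- exact: lt_le_trans a1.
- exact: ltW.
- apply: ler_pM; rewrite ?powR_ge0 ?expR_ge0 ?ler_expR ?lerN2//.
  by apply: (ge0_ler_powR a1') (ltW h1); rewrite nnegrE ltW// (lt_trans M0).
Qed.

(** On ]1, 2] the power t^(a-1) is at least 1 / 2, since t^a is at least 1. *)
Lemma Gamma_gt0 a : 0 < a -> 0 < Gamma a.
Proof.
move=> a0; apply: (@lt_le_trans _ _ (2^-1 * expR (- 2))).
  by rewrite mulr_gt0 ?invr_gt0 ?expR_gt0.
apply: (@Gamma_ge _ _ 1) => // x /andP[x1 x2].
have x0 : 0 < x by exact: lt_trans x1.
apply: ler_pM; rewrite ?invr_ge0 ?expR_ge0 ?ler_expR ?lerN2//.
rewrite powRB; last by rewrite (gt_eqF x0) implybT.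
rewrite (powRr1 (ltW x0)) -[2^-1]mul1r; apply: ler_pM => //.
  have : 1 `^ 0 <= x `^ a.
    by rewrite powRr0 -(powRr0 x); apply: ler_powR; rewrite ltW.
  by rewrite powRr0.
by rewrite lef_pV2 ?posrE.
Qed.

Lemma Gamma1 : Gamma 1 = 1 :> R.
Proof.
rewrite Gamma_itv0y//.
have := @integral_exponential_pdf R 1 ltr01.
have -> : (fun x : R => (exponential_pdf 1 x)%:E) = (fun x => ((fun x => x `^ (1 - 1) * expR (- x)) \_ `[0, +oo[ x)%:E).
  apply/funext => x; rewrite /exponential_pdf !patchE; case: ifPn => // _.
  by rewrite subrr powRr0 !mul1r mulN1r.
by rewrite Rintegral_mkcond /Rintegral => ->.
Qed.

Let betaf a b t : R -> R := fun x => x `^ (a - 1) * (t - x) `^ (b - 1).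

Let measurable_powRB (D : set R) t b : measurable_fun (D : set (measurableTypeR R)) (fun x => (t - x) `^ b).
Proof.
apply: measurable_funTS; apply: (measurableT_comp (measurable_powR b)).
exact: measurable_funB.
Qed.

Let integrable_betaf a b t : 0 < a -> 1 <= b -> mu.-integrable `[0, t] (EFin \o betaf a b t).
Proof.
move=> a0 b1; have b1' : 0 <= b - 1 by rewrite subr_ge0.
apply: (@integrableMb _ _ _ _ (t `^ (b - 1))); first exact: measurable_itv.
- exact: integrable_powR.
- exact: measurable_powRB.
- move=> x; rewrite /= in_itv /= => /andP[x0 xt].
  rewrite ger0_norm ?powR_ge0//; apply: (ge0_ler_powR b1'); rewrite ?nnegrE ?subr_ge0//.
    exact: le_trans xt.
  by rewrite lerBlDr lerDl.
Qed.

(** The condition b >= 1 keeps the second factor bounded. *)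
Lemma beta_scaling a b t : 0 < a -> 1 <= b -> 0 <= t ->
  \int[mu]_(x in `[0, t]) betaf a b t x = t `^ (a + b - 1) * \int[mu]_(x in `[0, 1]) betaf a b 1 x.
Proof.
move=> a0 b1; rewrite le_eqVlt => /predU1P[<-|t0].
  rewrite set_itv1 Rintegral_set1 powR0 ?mul0r// gt_eqF// -addrA ltr_wpDr ?subr_ge0//.
have tn : t `^ (a - 1 + (b - 1)) != 0 by rewrite gt_eqF// powR_gt0.
pose F := betaf a b t \_ `[0, t].
have mF : measurable_fun [set: measurableTypeR R] F.
  have := integrable_patch (measurable_itv _) (@integrable_betaf a b t a0 b1).
  by move=> /integrableP[/measurable_EFinP].
have := @Rintegral_image_density R _ t^-1 F _ (image_density_affine 0 t0) mF.
rewrite invr_ge0 (ltW t0) => /(_ isT) h.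
have E x : F (t * x + 0) = t `^ (a - 1 + (b - 1)) * (betaf a b 1 \_ `[0, 1]) x.
  rewrite addr0 /F !patchE !mem_setE !in_itv /= pmulr_rge0//.
  rewrite -[X in t * x <= X]mulr1 ler_pM2l//.
  case: ifPn; rewrite ?mulr0// => /andP[x0 x1].
  rewrite /betaf -[X in X - t * x]mulr1 -mulrBr !powRM ?subr_ge0// ?ltW//.
  by rewrite (@powRD _ t (a - 1) (b - 1)) ?(gt_eqF t0) ?implybT//; ring.
rewrite (funext E) in h.
rewrite (RintegralZl _ measurableT (integrable_patch (measurable_itv _) (@integrable_betaf a b 1 a0 b1))) in h.
rewrite -!Rintegral_mkcond in h.
have -> : a + b - 1 = a - 1 + (b - 1) + 1 by ring.
rewrite (@powRD _ t (a - 1 + (b - 1)) 1); last by rewrite (gt_eqF t0) implybT.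
by rewrite (powRr1 (ltW t0)) mulrAC h mulrC mulrA (mulfV (lt0r_neq0 t0)) mul1r.
Qed.

(** Fubini for gamma_integrand a (x) * gamma_integrand b (y - x): integrating in y
first gives Gamma a * Gamma b, and integrating in x first gives, by
beta_scaling, the Beta integral times gamma_integrand (a + b) (y). *)
Lemma beta_gamma a b : 0 < a -> 1 <= b ->
  (\int[mu]_(x in `[0, 1]) betaf a b 1 x) * Gamma (a + b) = Gamma a * Gamma b.
Proof.
move=> a0 b1; have b0 : 0 < b by exact: lt_le_trans b1.
have ea := integrable_gamma_integrand a0; have eb := integrable_gamma_integrand b0.
have ab0 : 0 < a + b by exact: addr_gt0.
have /Rintegral_fubini[+ _ _] := @integrable_convolution_triple R (gamma_integrand a) (gamma_integrand b) (cst 1) 0 1 ea eb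
  (measurable_cst _) (fun x => eq_ind_r (fun y => y <= 1) (lexx 1) (normr1 _)).
have meb : measurable_fun [set: measurableTypeR R] (gamma_integrand b).
  by have /integrableP[/measurable_EFinP] := eb.
have -> : (fun x => \int[mu]_y (gamma_integrand a (x, y).1 * gamma_integrand b ((x, y).2 - (x, y).1) * cst 1 (0 - (x, y).2))) =
  (fun x => Gamma b * gamma_integrand a x).
  apply/funext => x /=; rewrite (GammaE b0).
  have := Rintegral_image_density ler01 (image_density_shift (- x)) meb; rewrite mul1r => <-.
  rewrite mulrC -RintegralZl//; first by apply: eq_Rintegral => y _; rewrite mulr1.
  exact: (integrable_image_density ler01 (image_density_shift (- x)) eb).
have -> : (fun y => \int[mu]_x (gamma_integrand a (x, y).1 * gamma_integrand b ((x, y).2 - (x, y).1) * cst 1 (0 - (x, y).2))) =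
  (fun y => (\int[mu]_(x in `[0, 1]) betaf a b 1 x) * gamma_integrand (a + b) y).
  apply/funext => y /=.
  have [y0|y0] := leP 0 y; last first.
    rewrite [gamma_integrand (a + b) y]patchE mem_setE in_itv /= leNgt y0 /= mulr0.
    rewrite (eq_Rintegral mu (g := cst 0)) ?Rintegral_cst ?mul0r// => x _ /=.
    rewrite /gamma_integrand !patchE !mem_setE !in_itv /= !andbT subr_ge0.
    by case: ifPn; rewrite ?mul0r// => x0; rewrite leNgt (lt_le_trans y0 x0) /= mulr0 mul0r.
  rewrite [gamma_integrand (a + b) y]patchE mem_setE in_itv /= y0 /= mulrA.
  rewrite [X in X * expR _]mulrC -(beta_scaling a0 b1 y0) mulrC -RintegralZl//; last exact: integrable_betaf.
  rewrite [RHS]Rintegral_mkcond; apply: eq_Rintegral => x _.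
  rewrite mulr1 /gamma_integrand !patchE !mem_setE !in_itv /= !andbT subr_ge0.
  case: ifPn => x0; case: ifPn => xy; rewrite ?mulr0 ?mul0r//.
  have -> : expR (- y) = expR (- x) * expR (- (y - x)) by rewrite -expRD; congr expR; ring.
  by rewrite /betaf; ring.
rewrite (RintegralZl _ measurableT ea) (RintegralZl _ measurableT (integrable_gamma_integrand ab0)).
by rewrite -(GammaE a0) -(GammaE ab0) mulrC => ->.
Qed.

(** The Riemann-Liouville kernel: convolution with it is the fractional integral of
order a; these kernels form a semigroup under convolution (rl_kernel_conv). *)
Definition rl_kernel a x := x `^ (a - 1) / Gamma a.

Lemma rl_kernel_conv a b t : 0 < a -> 1 <= b -> 0 <= t ->
  \int[mu]_(x in `[0, t]) (rl_kernel a x * rl_kernel b (t - x)) = rl_kernel (a + b) t.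
Proof.
move=> a0 b1 t0; have b0 : 0 < b by exact: lt_le_trans b1.
have ab0 : 0 < a + b by exact: addr_gt0.
rewrite (eq_Rintegral mu (g := fun x => (Gamma a * Gamma b)^-1 * betaf a b t x)).
  rewrite RintegralZl//; last exact: integrable_betaf.
  rewrite (beta_scaling a0 b1 t0) -(beta_gamma a0 b1) /rl_kernel.
  have g0 : Gamma (a + b) != 0 by rewrite gt_eqF// Gamma_gt0.
  have c0 : \int[mu]_(x in `[0, 1]) betaf a b 1 x != 0.
    apply/eqP => E; have := beta_gamma a0 b1; rewrite E mul0r => /esym/eqP.
    by rewrite gt_eqF// mulr_gt0// Gamma_gt0.
  by field; rewrite g0 c0.
by move=> x _; rewrite /rl_kernel /betaf invfM; ring.
Qed.

End GammaIntegral.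

(** * The Mittag-Leffler kernel as a resolvent *)

Section MittagLeffler.
Variable R : realType.
Notation mu := (@lebesgue_measure R).
Implicit Types (al x t T M X lam : R).

Let mlterm al x (n : nat) : R := x ^+ n / Gamma (al * n%:R + 1).

Let mlarg al (n : nat) : 0 < al -> 1 <= al * n%:R + 1.
Proof. by move=> al0; rewrite lerDr mulr_ge0// ltW. Qed.

(** Gamma_growth with M^al = q = 2 X + 1 bounds Gamma (al n + 1) below by a multiple
of q^n, and X / q <= 1 / 2. *)
Lemma mlterm_bound al X : 0 < al -> 0 <= X -> exists2 C, 0 <= C &
  forall x n, `|x| <= X -> `|mlterm al x n| <= geometric C 2^-1 n.
Proof.
move=> al0 X0; pose q := 2 * X + 1; have q1 : 1 <= q by rewrite lerDr mulr_ge0.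
have q0 : 0 < q by exact: lt_le_trans q1.
pose M := q `^ al^-1; have M0 : 0 < M by rewrite powR_gt0.
exists (expR (M + 1)); first exact: expR_ge0.
move=> x n xX; rewrite /mlterm normrM normfV normrX.
have g := Gamma_growth (mlarg n al0) M0.
have g0 : 0 < Gamma (al * n%:R + 1) by apply: Gamma_gt0; exact: lt_le_trans (mlarg n al0).
have e : M `^ (al * n%:R) = q ^+ n.
  by rewrite /M -powRrM mulrA mulVf ?gt_eqF// mul1r powR_mulrn ?ltW.
rewrite addrK e in g.
rewrite (gtr0_norm g0) ler_pdivrMr//.
apply: (@le_trans _ _ (X ^+ n)); first by rewrite lerXn2r// nnegrE.
have : geometric (expR (M + 1)) 2^-1 n * (q ^+ n * expR (- (M + 1))) <=
       geometric (expR (M + 1)) 2^-1 n * Gamma (al * n%:R + 1).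
  by rewrite ler_wpM2l// /geometric /= mulr_ge0 ?expR_ge0// exprn_ge0// invr_ge0.
apply: le_trans; rewrite /geometric /=.
have -> : expR (M + 1) * 2^-1 ^+ n * (q ^+ n * expR (- (M + 1))) =
  expR (M + 1) * expR (- (M + 1)) * (2^-1 ^+ n * q ^+ n) by ring.
rewrite -expRD subrr expR0 mul1r -exprMn.
have qX : X <= 2^-1 * q by rewrite /q; lra.
by apply: lerXn2r qX; rewrite nnegrE// mulr_ge0 ?(ltW q0)// invr_ge0.
Qed.

Lemma mittag_leffler_series al X : 0 < al -> 0 <= X -> exists2 C, 0 <= C &
  forall x, `|x| <= X -> (forall N, `|series (mlterm al x) N| <= C) /\
    series (mlterm al x) n @[n --> \oo] --> mittag_leffler al x.
Proof.
move=> al0 X0; have [C C0 hC] := mlterm_bound al0 X0.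
exists (C / (1 - 2^-1)); first by rewrite divr_ge0// subr_ge0 invf_le1// ler1n.
move=> x xX.
have h2 : `|2^-1 : R| < 1 by rewrite ger0_norm ?invr_ge0// invf_lt1// ltr1n.
split.
  move=> N; apply: (le_trans (ler_norm_sum _ _ _)).
  apply: (@le_trans _ _ (series (geometric C 2^-1) N)).
    by apply: ler_sum => i _; exact: hC.
  have h2' : 2^-1 != 1 :> R by rewrite lt_eqF// -[X in X < _]ger0_norm ?invr_ge0.
  rewrite geometric_seriesE//= ler_wpM2r//; first by rewrite invr_ge0 subr_ge0 invf_le1// ler1n.
  by rewrite ler_piMr// gerBl exprn_ge0// invr_ge0.
apply: normed_cvg; apply: (@series_le_cvg _ _ (geometric C 2^-1)).
- by move=> n /=.
- by move=> n; rewrite /geometric /= mulr_ge0// exprn_ge0// invr_ge0.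
- by move=> n; exact: hC.
- exact: is_cvg_geometric_series.
Qed.

Variables (al lam : R).
Hypothesis al0 : 0 < al.
Let arg t := - lam * t `^ al.
Let S N t := series (mlterm al (arg t)) N.
(** E_al(- lam t^al), the kernel of the ABC derivative when lam = al / (1 - al). *)
Definition mlfun t := mittag_leffler al (arg t).

Let mlterm_kernel t n : 0 <= t -> mlterm al (arg t) n = (- lam) ^+ n * rl_kernel (al * n%:R + 1) t.
Proof.
by move=> t0; rewrite /mlterm /rl_kernel /arg addrK powRrM powR_mulrn ?powR_ge0// exprMn mulrA.
Qed.

Let arg_bound T t : 0 <= t <= T -> `|arg t| <= `|lam| * T `^ al.
Proof.
move=> /andP[t0 tT]; rewrite normrM normrN ler_wpM2l// ger0_norm ?powR_ge0//.
by apply: ge0_ler_powR; rewrite ?nnegrE ?(ltW al0) ?(le_trans t0 tT).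
Qed.

Let measurable_S N (D : set R) : measurable_fun (D : set (measurableTypeR R)) (S N).
Proof.
apply: measurable_funTS; rewrite /S /series /=.
apply: measurable_sum => n; rewrite /mlterm.
apply: measurable_funM => //; apply: measurable_funX.
by apply: measurable_funM => //; exact: measurable_powR.
Qed.

Lemma measurable_mlfun (D : set R) : measurable_fun (D : set (measurableTypeR R)) mlfun.
Proof.
apply: measurable_funTS; apply: (@measurable_fun_cvg _ (measurableTypeR R) _ _ S).
  by move=> N; exact: measurable_S.
move=> t _; have [C _ h] := mittag_leffler_series al0 (normr_ge0 (arg t)).
exact: (h _ (lexx _)).2.
Qed.

Lemma mlfun_bound T : 0 <= T -> exists2 C, 0 <= C & forall t, 0 <= t <= T -> `|mlfun t| <= C.
Proof.
move=> T0; have X0 : 0 <= `|lam| * T `^ al by rewrite mulr_ge0 ?powR_ge0.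
have [C C0 h] := mittag_leffler_series al0 X0; exists C => // t tT.
have [b cv] := h _ (arg_bound tT).
apply: (cvgr_to_le (cvg_norm cv)); exact: nearW.
Qed.

Lemma integrable_rl_kernel a T : 0 < a -> mu.-integrable `[0, T] (EFin \o (rl_kernel a : R -> R)).
Proof.
move=> a0; have := RintegrableZl (Gamma a)^-1 (measurable_itv _) (@integrable_powR R a T a0).
by apply: eq_integrable => // x _ /=; rewrite mulrC.
Qed.

(** Convolution with k shifts the series by one term: k * rl_kernel (al n + 1) is
rl_kernel (al (n + 1) + 1). *)
Let partial_resolvent N t : 0 <= t ->
  lam * \int[mu]_(x in `[0, t]) (rl_kernel al x * S N (t - x)) = 1 - S N.+1 t.
Proof.
move=> t0.
have ki := integrable_rl_kernel t al0.
have mI : measurable (`[0, t]%classic : set (measurableTypeR R)) by exact: measurable_itv.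
pose v n x := rl_kernel al x * rl_kernel (al * n%:R + 1) (t - x).
pose u n x := (- lam) ^+ n * v n x.
have vi n : mu.-integrable `[0, t] (EFin \o v n).
  apply: (@integrableMb _ _ _ _ (t `^ (al * n%:R) / Gamma (al * n%:R + 1)) mI ki).
    apply: measurable_funM => //.
    apply: measurable_funTS; apply: (measurableT_comp (measurable_powR _)).
    exact: measurable_funB.
  move=> x; rewrite /= in_itv /= => /andP[x0 xt]; rewrite /rl_kernel addrK.
  have g0 : 0 < Gamma (al * n%:R + 1) by apply: Gamma_gt0; exact: lt_le_trans (mlarg n al0).
  rewrite ger0_norm ?divr_ge0 ?powR_ge0 ?(ltW g0)//.
  rewrite ler_wpM2r ?invr_ge0 ?(ltW g0)//.
  by apply: ge0_ler_powR; rewrite ?nnegrE ?subr_ge0 ?mulr_ge0 ?(ltW al0)// lerBlDr lerDl.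
have ui n : mu.-integrable `[0, t] (EFin \o u n) by exact: RintegrableZl.
have E n : \int[mu]_(x in `[0, t]) u n x = (- lam) ^+ n * rl_kernel (al * n.+1%:R + 1) t.
  have -> : al * n.+1%:R + 1 = al + (al * n%:R + 1) by rewrite -natr1; ring.
  by rewrite -(rl_kernel_conv al0 (mlarg n al0) t0) (RintegralZl _ mI (vi n)).
have K (M : nat) : mu.-integrable `[0, t] (EFin \o (fun x => \sum_(0 <= n < M) u n x)) /\
   \int[mu]_(x in `[0, t]) (\sum_(0 <= n < M) u n x) = \sum_(0 <= n < M) \int[mu]_(x in `[0, t]) u n x.
  elim: M => [|M [i1 i2]].
    have -> : (fun x => \sum_(0 <= n < 0) u n x) = (fun=> 0).
      by apply/funext => x; rewrite big_geq.
    by rewrite big_geq// Rintegral_cst// mul0r; split => //; exact: integrable0.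
  have EM : (fun x => \sum_(0 <= n < M.+1) u n x) = (fun x => (\sum_(0 <= n < M) u n x) + u M x).
    by apply/funext => x; rewrite big_nat_recr.
  rewrite EM; split; first exact: RintegrableD.
  by rewrite RintegralD// i2 big_nat_recr.
have [_ KN] := K N.
have -> : \int[mu]_(x in `[0, t]) (rl_kernel al x * S N (t - x)) = \int[mu]_(x in `[0, t]) (\sum_(0 <= n < N) u n x).
  apply: eq_Rintegral => x; rewrite inE /= in_itv /= => /andP[x0 xt].
  rewrite /S /series /= mulr_sumr; apply: eq_bigr => n _.
  by rewrite mlterm_kernel ?subr_ge0// /u /v mulrCA.
rewrite KN /S /series /= big_nat_recl// mlterm_kernel//.
rewrite expr0 mulr0 add0r mul1r /rl_kernel subrr powRr0 Gamma1 invr1 mulr1 opprD addNKr.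
rewrite mulr_sumr -sumrN; apply: eq_bigr => n _.
by rewrite E mlterm_kernel// exprS; ring.
Qed.

(** partial_resolvent is passed to the limit; the partial sums are uniformly bounded
on [0, t], so that a multiple of k dominates. *)
Lemma mlfun_resolvent t : 0 <= t ->
  mlfun t + lam * \int[mu]_(x in `[0, t]) (rl_kernel al x * mlfun (t - x)) = 1.
Proof.
move=> t0; have ki := integrable_rl_kernel t al0.
have X0 : 0 <= `|lam| * t `^ al by rewrite mulr_ge0 ?powR_ge0.
have [C C0 h] := mittag_leffler_series al0 X0.
have mB : measurable_fun (`[0, t]%classic : set (measurableTypeR R)) (fun x : R => t - x).
  by apply: measurable_funTS; exact: measurable_funB.
have mk : measurable_fun (`[0, t]%classic : set (measurableTypeR R)) (rl_kernel al : R -> R).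
  by have /integrableP[/measurable_EFinP] := ki.
have tx x : `[0, t]%classic x -> 0 <= t - x <= t.
  by rewrite /= in_itv /= subr_ge0 lerBlDr lerDl andbC.
have k0 x : 0 <= rl_kernel al x by rewrite /rl_kernel divr_ge0 ?powR_ge0 ?(ltW (Gamma_gt0 al0)).
have kC : \int[mu]_(x in `[0, t]) (rl_kernel al x * S N (t - x)) @[N --> \oo] -->
   \int[mu]_(x in `[0, t]) (rl_kernel al x * mlfun (t - x)).
  have mS N : measurable_fun (`[0, t]%classic : set (measurableTypeR R)) (fun x => (rl_kernel al x * S N (t - x))%:E).
    apply/measurable_EFinP; apply: (measurable_funM mk).
    exact: (measurableT_comp (@measurable_S N setT) mB).
  have mE : measurable_fun (`[0, t]%classic : set (measurableTypeR R)) (fun x => (rl_kernel al x * mlfun (t - x))%:E).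
    apply/measurable_EFinP; apply: (measurable_funM mk).
    exact: (measurableT_comp (@measurable_mlfun setT) mB).
  have cS : {ae mu, forall x, `[0, t]%classic x ->
      (rl_kernel al x * S N (t - x))%:E @[N --> \oo] --> (rl_kernel al x * mlfun (t - x))%:E}.
    apply/aeW => x /tx xt; apply: cvg_EFin; first exact: nearW.
    by apply: cvgMl_tmp; exact: (h _ (arg_bound xt)).2.
  have bS : {ae mu, forall x N, `[0, t]%classic x -> (`|(rl_kernel al x * S N (t - x))%:E| <= (C * rl_kernel al x)%:E)%E}.
    apply/aeW => x N /tx xt; rewrite lee_fin normrM (ger0_norm (k0 x)) mulrC.
    by apply: ler_wpM2r => //; exact: (h _ (arg_bound xt)).1.
  have [ei _ cv] := @dominated_convergence _ _ R mu `[0, t]%classic (measurable_itv _)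
    _ _ _ mS mE cS (RintegrableZl C (measurable_itv _) ki) bS.
  apply: fine_cvg; rewrite fineK//.
  exact: (@integrable_fin_num _ _ _ mu _ _ _ ei).
have cvS : 1 - S N.+1 t @[N --> \oo] --> 1 - mlfun t.
  have tt : 0 <= t <= t by rewrite t0 lexx.
  have [_ c] := h (arg t) (arg_bound tt).
  apply: cvgB; first exact: cvg_cst.
  by move: c; rewrite -(cvg_shiftS (series (mlterm al (arg t)))).
have : lam * \int[mu]_(x in `[0, t]) (rl_kernel al x * S N (t - x)) @[N --> \oo] --> 1 - mlfun t.
  by under eq_fun do rewrite partial_resolvent//.
move=> c1; have c2 := cvgMl_tmp kC (a := lam).
have := cvg_unique _ c1 (c2 _) => <- //.
by rewrite addrC subrK.
Qed.

End MittagLeffler.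

(** * The transform of a power function *)

Section GammaTransform.
Variable R : realType.
Notation mu := (@lebesgue_measure R).
Implicit Types (a p t x y T K : R).

(** The two-sided derivative of F at 0 may fail to exist, so f is compared with
derive1 F on ]0, T] only. *)
Lemma integral_is_derive (F f : R -> R) T : 0 <= T ->
  (forall x, 0 < x -> is_derive x 1 F (f x)) -> F x @[x --> 0^'+] --> F 0 ->
  mu.-integrable `[0, T] (EFin \o f) -> \int[mu]_(x in `[0, T]) f x = F T - F 0.
Proof.
move=> T0 dF F0 fi.
have mI : measurable (`[0, T]%classic : set (measurableTypeR R)) by exact: measurable_itv.
have fE x : `]0, T]%classic x -> f x = derive1 F x.
  by rewrite /= in_itv /= => /andP[x0 _]; have [_ <-] := dF x x0; rewrite derive1E.
have fE' : {in (`]0, T]%classic : set R), f =1 derive1 F} by move=> x; rewrite inE => /fE.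
have mf : measurable_fun (`[0, T]%classic : set (measurableTypeR R)) f.
  by have /integrableP[/measurable_EFinP] := fi.
have md : measurable_fun (`[0, T]%classic : set (measurableTypeR R)) (derive1 F).
  apply/(measurable_fun_itv_obnd_cbndP 0 (BRight T)).
  by apply: (eq_measurable_fun _ fE'); exact/(measurable_fun_itv_obnd_cbndP 0 (BRight T)).
have di : mu.-integrable `[0, T] (EFin \o derive1 F).
  apply/integrableP; split; first exact/measurable_EFinP.
  have /integrableP[_] := fi.
  rewrite -!integral_itv_obnd_cbnd; last 2 first.
  - apply: measurableT_comp => //; apply/measurable_EFinP.
    exact/(measurable_fun_itv_obnd_cbndP 0 (BRight T)).
  - apply: measurableT_comp => //; apply/measurable_EFinP.
    exact/(measurable_fun_itv_obnd_cbndP 0 (BRight T)).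
  apply: le_lt_trans; rewrite le_eqVlt; apply/orP; left; apply/eqP.
  by apply: eq_integral => x xI /=; rewrite fE'.
rewrite -(increment_eq_integral0 T0 _ F0 di); last by move=> x /dF[].
rewrite /Rintegral -!integral_itv_obnd_cbnd; last 2 first.
- by apply/measurable_EFinP; exact/(measurable_fun_itv_obnd_cbndP 0 (BRight T)).
- by apply/measurable_EFinP; exact/(measurable_fun_itv_obnd_cbndP 0 (BRight T)).
by congr fine; apply: eq_integral => x xI /=; rewrite fE'.
Qed.

Variables (a p : R).
Hypotheses (a0 : 0 < a) (p0 : 0 < p).
Let m b t := t `^ (b - 1) * expR (- (p * t)).

Let m_ge0 b t : 0 <= m b t. Proof. by rewrite mulr_ge0 ?powR_ge0 ?expR_ge0. Qed.

Let mulm t : 0 <= t -> t * m a t = m (a + 1) t.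
Proof. by move=> t0; rewrite /m addrK mulrA mulr_powRB1. Qed.

Let mI : measurable (`[0, +oo[%classic : set (measurableTypeR R)).
Proof. exact: measurable_itv. Qed.

Let integrable_mw (b : R) (w : R -> R) K : 0 < b -> measurable_fun [set: measurableTypeR R] w ->
  (forall t, `|w t| <= K) -> mu.-integrable `[0, +oo[ (EFin \o (fun t => m b t * w t)).
Proof.
move=> b0 mw wK; apply: (integrableMb mI (integrable_gamma b0 p0)).
  exact: measurable_funTS.
by move=> t _; exact: wK.
Qed.

Lemma powR_expR_cvg0 b : t `^ b * expR (- (p * t)) @[t --> +oo] --> 0.
Proof.
have p20 : 0 < p / 2 by rewrite divr_gt0.
have [C C0 hC] := powR_le_expR b p20.
have e0 : C * expR (- (p / 2 * t)) @[t --> +oo] --> 0.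
  have h : (fun t => p / 2 * t) @ +oo --> +oo by apply: gt0_cvgMry => //; exact: cvg_id.
  have := cvgMl_tmp (cvg_comp _ _ h (@cvgr_expR R)) (a := C) _.
  by rewrite mulr0; apply.
apply: (@squeeze_cvgr _ _ _ _ (cst 0) (fun t => C * expR (- (p / 2 * t)))) => //; last exact: cvg_cst.
near=> t; rewrite mulr_ge0 ?powR_ge0 ?expR_ge0//=.
have -> : - (p / 2 * t) = p / 2 * t + - (p * t) by field.
rewrite expRD mulrA ler_wpM2r ?expR_ge0//; apply: hC.
near: t; exact: nbhs_pinfty_ge.
Unshelve. all: by end_near. Qed.

(** The function t^a e^(-pt) w(t) vanishes at 0 and at infinity, so the integral of
its derivative is zero. *)
Lemma gamma_by_parts (w w' : R -> R) K : (forall t, is_derive t 1 w (w' t)) ->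
  (forall t, `|w t| <= 1) -> (forall t, `|w' t| <= K) ->
  measurable_fun [set: measurableTypeR R] w -> measurable_fun [set: measurableTypeR R] w' ->
  a * \int[mu]_(t in `[0, +oo[) (m a t * w t) =
  p * (\int[mu]_(t in `[0, +oo[) (m (a + 1) t * w t)) - \int[mu]_(t in `[0, +oo[) (m (a + 1) t * w' t).
Proof.
move=> dw w1 wK mw mw'; have a1 : 0 < a + 1 by rewrite addr_gt0.
have i1 := integrable_mw a0 mw w1.
have i2 := integrable_mw a1 mw w1.
have i3 := integrable_mw a1 mw' wK.
pose F t := t `^ a * expR (- (p * t)) * w t.
pose f t := a * (m a t * w t) - (p * (m (a + 1) t * w t) - m (a + 1) t * w' t).
have j1 := RintegrableZl a mI i1.
have j2 := RintegrableB mI (RintegrableZl p mI i2) i3.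
have fi : mu.-integrable `[0, +oo[ (EFin \o f) := RintegrableB mI j1 j2.
have dF x : 0 < x -> is_derive x 1 F (f x).
  move=> x0.
  have d1 : is_derive x 1 (fun x => x `^ a) (a * x `^ (a - 1)).
    have [d e] := @derive1_powR_pos R a x x0.
    by apply: DeriveDef => //; rewrite -derive1E.
  have d2 : is_derive x 1 (fun t : R => - (p * t)) (- p).
    by apply: is_derive_eq; rewrite scaler1.
  have d3 := @is_derive1_comp _ (@expR R) (fun t : R => - (p * t)) x _ _ (is_derive_expR _) d2.
  have := is_deriveM (is_deriveM d1 d3) (dw x).
  have -> : (fun x => x `^ a) * (@expR R \o (fun t : R => - (p * t))) * w = F by [].
  move=> h; apply: (is_derive_eq h).
  by rewrite /GRing.scale /= /f /m addrK /= fctE/=; ring.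
have F00 : F 0 = 0 by rewrite /F powR0 ?gt_eqF// !mul0r.
have Fb t : 0 <= t -> `|F t| <= t `^ a * expR (- (p * t)).
  move=> t0; rewrite /F normrM ger0_norm ?mulr_ge0 ?powR_ge0 ?expR_ge0//.
  by rewrite ler_piMr// mulr_ge0 ?powR_ge0 ?expR_ge0.
have F0 : F x @[x --> 0^'+] --> F 0.
  rewrite F00; apply: norm_cvg0.
  apply: (@squeeze_cvgr _ _ _ _ (cst 0) (fun t => t `^ a)) => //; last 2 first.
  - exact: cvg_cst.
  - exact: powR_cvg0.
  near=> t; rewrite normr_ge0/=.
  have t0 : 0 <= t by [].
  apply: (le_trans (Fb _ t0)); rewrite ler_piMr ?powR_ge0// expR_le1 oppr_le0 mulr_ge0// ltW//.
have Foo : F x @[x --> +oo] --> 0.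
  apply: norm_cvg0.
  apply: (@squeeze_cvgr _ _ _ _ (cst 0) (fun t => t `^ a * expR (- (p * t)))) => //; last 2 first.
  - exact: cvg_cst.
  - exact: powR_expR_cvg0.
  by near=> t; rewrite normr_ge0/=; apply: Fb.
have c1 := cvg_Rintegral_itvy fi.
have c2 : \int[mu]_(x in `[0, T]) f x @[T --> +oo] --> 0.
  apply: cvg_trans Foo; apply: near_eq_cvg; near=> T.
  have T0 : 0 <= T by [].
  rewrite (integral_is_derive T0 dF F0) ?F00 ?subr0//.
  by apply: integrableS fi => //; exact: itvS0y.
have := cvg_unique _ c1 c2; rewrite /f RintegralB// RintegralB//.
  rewrite !RintegralZl// => h; apply/eqP; rewrite -subr_eq0; apply/eqP; exact: h.
exact: RintegrableZl.
Unshelve. all: by end_near. Qed.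

(** Differentiation under the integral sign, with t^a e^(-pt) as dominating
function. *)
Lemma is_derive_gamma_trig (w w' : R -> R) y : (forall t, is_derive t 1 w (w' t)) ->
  (forall t, `|w t| <= 1) -> (forall t, `|w' t| <= 1) ->
  measurable_fun [set: measurableTypeR R] w -> measurable_fun [set: measurableTypeR R] w' ->
  is_derive y 1 (fun y => \int[mu]_(t in `[0, +oo[) (m a t * w (y * t)))
    (\int[mu]_(t in `[0, +oo[) (m (a + 1) t * w' (y * t))).
Proof.
move=> dw w1 w'1 mw mw'; have a1 : 0 < a + 1 by rewrite addr_gt0.
pose f z t := m a t * w (z * t).
have dwz (z t : R) : is_derive z 1 (f ^~ t) (m a t * (w' (z * t) * t)).
  have d1 : is_derive z 1 (fun z : R => z * t) t.
    have d0 := is_deriveM (is_derive_id z 1) (is_derive_cst t z 1).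
    by apply: (is_derive_eq d0); rewrite scaler0 add0r /GRing.scale /= mulr1.
  have d2 := @is_derive1_comp _ w (fun z : R => z * t) z _ _ (dw _) d1.
  exact: (is_deriveZ (m a t) d2).
have mwz z : measurable_fun [set: measurableTypeR R] (fun t => w (z * t)).
  by apply: (measurableT_comp mw); exact: measurable_funM.
have Iy : `]y - 1, y + 1[%classic y by rewrite /= in_itv /= ltrBlDr ltrDl ltr01.
have h1 z : `]y - 1, y + 1[%classic z -> mu.-integrable `[0, +oo[ (EFin \o f z).
  by move=> _; apply: integrable_mw (mwz z) _ => // t; exact: w1.
have h2 z t : `]y - 1, y + 1[%classic z -> `[0, +oo[%classic t -> derivable (f ^~ t) z 1.
  by move=> _ _; have [] := dwz z t.
have h4 z t : `]y - 1, y + 1[%classic z -> `[0, +oo[%classic t -> `|partial1of2 f z t| <= m (a + 1) t.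
  move=> _; rewrite /= in_itv /= andbT => t0; rewrite partial1of2E.
  have [_ ->] := dwz z t; rewrite -mulm// mulrCA mulrC normrM.
  have mt0 : 0 <= t * m a t by rewrite mulr_ge0.
  have -> : `|m a t * t| = t * m a t by rewrite mulrC ger0_norm.
  by rewrite ler_piMr.
have d := derivable_under_integral mI Iy h1 h2 (m_ge0 (a + 1)) (integrable_gamma a1 p0) h4.
have e := differentiation_under_integral mI Iy h1 h2 (m_ge0 (a + 1)) (integrable_gamma a1 p0) h4.
apply: DeriveDef; first exact: d.
rewrite -derive1E e; apply: eq_Rintegral => t; rewrite inE /= in_itv /= andbT => t0.
by rewrite partial1of2E; have [_ ->] := dwz y t; rewrite -mulm//; ring.
Qed.

Let C b y := \int[mu]_(t in `[0, +oo[) (m b t * cos (y * t)).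
Let S b y := \int[mu]_(t in `[0, +oo[) (m b t * sin (y * t)).

Let mcos : measurable_fun [set: measurableTypeR R] (@cos R).
Proof. by apply: continuous_measurable_fun; exact: continuous_cos. Qed.
Let msin : measurable_fun [set: measurableTypeR R] (@sin R).
Proof. by apply: continuous_measurable_fun; exact: continuous_sin. Qed.
Let mcosy y : measurable_fun [set: measurableTypeR R] (fun t => cos (y * t)).
Proof. by apply: (measurableT_comp mcos); exact: measurable_funM. Qed.
Let msiny y : measurable_fun [set: measurableTypeR R] (fun t => sin (y * t)).
Proof. by apply: (measurableT_comp msin); exact: measurable_funM. Qed.
Let cos1 t : `|cos t| <= 1 :> R. Proof. by rewrite ler_norml cos_geN1 cos_le1. Qed.
Let sin1 t : `|sin t| <= 1 :> R. Proof. by rewrite ler_norml sin_geN1 sin_le1. Qed.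

Let d_C y : is_derive y 1 (C a) (- S (a + 1) y).
Proof.
have mN : measurable_fun [set: measurableTypeR R] (fun t : R => - sin t) by exact: measurableT_comp.
have b t : `|- sin t| <= 1 :> R by rewrite normrN.
have d := is_derive_gamma_trig y (@is_derive_cos R) cos1 b mcos mN.
apply: (is_derive_eq d).
have i : mu.-integrable `[0, +oo[ (EFin \o (fun t => m (a + 1) t * sin (y * t))).
  by apply: integrable_mw (msiny y) (fun t => sin1 _); rewrite addr_gt0.
rewrite -mulN1r -RintegralZl//; apply: eq_Rintegral => t _; ring.
Qed.

Let d_S y : is_derive y 1 (S a) (C (a + 1) y).
Proof. exact: is_derive_gamma_trig y (@is_derive_sin R) sin1 cos1 msin mcos. Qed.

Let trig_d y t : is_derive t 1 (fun t : R => y * t) y.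
Proof. by apply: is_derive_eq; rewrite scaler1. Qed.

Let rel_C y : a * C a y = p * C (a + 1) y + y * S (a + 1) y.
Proof.
have d t : is_derive t 1 (fun t => cos (y * t)) (- sin (y * t) * y).
  exact: (@is_derive1_comp _ (@cos R) _ t _ _ (is_derive_cos _) (trig_d y t)).
have m' : measurable_fun [set: measurableTypeR R] (fun t => - sin (y * t) * y).
  by apply: measurable_funM => //; exact: measurableT_comp.
have b t : `|- sin (y * t) * y| <= `|y| by rewrite normrM normrN ler_piMl.
rewrite (gamma_by_parts d (fun t => cos1 _) b (mcosy y) m').
have i : mu.-integrable `[0, +oo[ (EFin \o (fun t => m (a + 1) t * sin (y * t))).
  by apply: integrable_mw (msiny y) (fun t => sin1 _); rewrite addr_gt0.
congr (_ + _); rewrite -mulN1r -[LHS]RintegralZl//.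
  rewrite -RintegralZl//; apply: eq_Rintegral => t _; ring.
apply: integrable_mw m' b; by rewrite addr_gt0.
Qed.

Let rel_S y : a * S a y = p * S (a + 1) y - y * C (a + 1) y.
Proof.
have d t : is_derive t 1 (fun t => sin (y * t)) (cos (y * t) * y).
  exact: (@is_derive1_comp _ (@sin R) _ t _ _ (is_derive_sin _) (trig_d y t)).
have m' : measurable_fun [set: measurableTypeR R] (fun t => cos (y * t) * y).
  by apply: measurable_funM.
have b t : `|cos (y * t) * y| <= `|y| by rewrite normrM ler_piMl.
rewrite (gamma_by_parts d (fun t => sin1 _) b (msiny y) m').
have i : mu.-integrable `[0, +oo[ (EFin \o (fun t => m (a + 1) t * cos (y * t))).
  by apply: integrable_mw (mcosy y) (fun t => cos1 _); rewrite addr_gt0.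
congr (_ - _); rewrite -RintegralZl//; apply: eq_Rintegral => t _; ring.
Qed.

Let r y := p ^+ 2 + y ^+ 2.
Let r0 y : 0 < r y. Proof. by rewrite ltr_wpDr ?sqr_ge0// exprn_gt0. Qed.
Let L y := ln (r y) / 2.
Let th y : R := atan (y / p).
Let Wc y := expR (a * L y) * cos (a * th y).
Let Ws y := expR (a * L y) * sin (a * th y).

Let d_L y : is_derive y 1 L (y / r y).
Proof.
have d1 : is_derive y 1 r (2 * y).
  have d := is_deriveD (is_derive_cst (p ^+ 2) y 1) (is_deriveM (is_derive_id y 1) (is_derive_id y 1)).
  by apply: (is_derive_eq d); rewrite /GRing.scale /=; ring.
have := is_deriveZ 2^-1 (@is_derive1_comp _ (@ln R) r y _ _ (is_derive1_ln (r0 y)) d1).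
have -> : 2^-1 \*: (@ln R \o r) = L by apply/funext => z; rewrite /L /= mulrC.
move=> d; apply: (is_derive_eq d); rewrite /GRing.scale /=; field.
by rewrite gt_eqF.
Qed.

Let d_th y : is_derive y 1 th (p / r y).
Proof.
have d1 : is_derive y 1 (fun y : R => y / p) p^-1.
  have := is_deriveZ p^-1 (is_derive_id y 1).
  have -> : p^-1 \*: (id : R -> R) = (fun y => y / p) by apply/funext => z; rewrite /= mulrC.
  by move=> d; apply: (is_derive_eq d); rewrite /GRing.scale /= mulr1.
have d := @is_derive1_comp _ (@atan R) (fun y : R => y / p) y _ _ (is_derive1_atan _) d1.
apply: (is_derive_eq d); rewrite /r; field.
by rewrite -/(r y) !gt_eqF.
Qed.

Let d_e y : is_derive y 1 (fun y => expR (a * L y)) (expR (a * L y) * (a * (y / r y))).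
Proof. exact: (@is_derive1_comp _ (@expR R) (fun y => a * L y) y _ _ (is_derive_expR _) (is_deriveZ a (d_L y))). Qed.

Let d_Wc y : is_derive y 1 Wc (a * (y * Wc y - p * Ws y) / r y).
Proof.
have := is_deriveM (d_e y) (@is_derive1_comp _ (@cos R) (fun y => a * th y) y _ _ (is_derive_cos _) (is_deriveZ a (d_th y))).
move=> d; apply: (is_derive_eq d); rewrite /GRing.scale /= /Wc /Ws; ring.
Qed.

Let d_Ws y : is_derive y 1 Ws (a * (y * Ws y + p * Wc y) / r y).
Proof.
have := is_deriveM (d_e y) (@is_derive1_comp _ (@sin R) (fun y => a * th y) y _ _ (is_derive_sin _) (is_deriveZ a (d_th y))).
move=> d; apply: (is_derive_eq d); rewrite /GRing.scale /= /Wc /Ws; ring.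
Qed.

Let init : C a 0 = Gamma a * p `^ (- a) /\ S a 0 = 0.
Proof.
split.
  rewrite -(Gamma_scaling a0 p0); apply: eq_Rintegral => t _.
  by rewrite mul0r cos0 mulr1.
rewrite /S (eq_Rintegral mu (g := cst 0)) ?Rintegral_cst ?mul0r// => t _.
by rewrite mul0r sin0 mulr0.
Qed.

Let initW : Wc 0 = p `^ a /\ Ws 0 = 0.
Proof.
rewrite /Wc /Ws /th mul0r atan0 mulr0 cos0 sin0 mulr1 mulr0; split => //.
rewrite /L /r expr0n addr0 lnXn// /powR gt_eqF//; by congr expR; field.
Qed.

(** With H = C - i S the integral of t^(a-1) e^(-st), s = p + i y, and W = Wc + i Ws the
principal power s^a, the claim is H W = Gamma a.  Integration by parts (rel_C,
rel_S) turns the derivative of H in y into - i a H / s, while that of W is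
i a W / s; hence H W is constant, and at y = 0 it is given by Gamma_scaling. *)
Lemma gamma_trig y :
  C a y * Wc y + S a y * Ws y = Gamma a /\ C a y * Ws y - S a y * Wc y = 0.
Proof.
have rn z : r z != 0 by rewrite gt_eqF.
have e1 z : C a z = a^-1 * (p * C (a + 1) z + z * S (a + 1) z) by rewrite -rel_C mulKf// gt_eqF.
have e2 z : S a z = a^-1 * (p * S (a + 1) z - z * C (a + 1) z) by rewrite -rel_S mulKf// gt_eqF.
have an : a != 0 by rewrite gt_eqF.
have [C0 S0] := init; have [Wc0 Ws0] := initW.
have pa : p `^ (- a) * p `^ a = 1 by rewrite powRN mulVf// gt_eqF// powR_gt0.
split.
  have d (z : R) : is_derive z 1 (C a * Wc + S a * Ws) 0.
    have d := is_deriveD (is_deriveM (d_C z) (d_Wc z)) (is_deriveM (d_S z) (d_Ws z)).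
    apply: (is_derive_eq d); rewrite /GRing.scale /= e1 e2 /r; field.
    by rewrite an -/(r z) rn.
  have := is_derive_0_is_cst 0 y d; rewrite !fctE /= => <-.
  by rewrite C0 S0 Wc0 Ws0 mulr0 addr0 -mulrA pa mulr1.
have d (z : R) : is_derive z 1 (C a * Ws - S a * Wc) 0.
  have d := is_deriveB (is_deriveM (d_C z) (d_Ws z)) (is_deriveM (d_S z) (d_Wc z)).
  apply: (is_derive_eq d); rewrite /GRing.scale /= e1 e2 /r; field.
  by rewrite an -/(r z) rn.
have := is_derive_0_is_cst 0 y d; rewrite !fctE /= => <-.
by rewrite C0 S0 Wc0 Ws0 mulr0 mul0r subr0.
Qed.

End GammaTransform.

(** * Complex powers in the right half-plane *)

Section ComplexPower.
Variable R : realType.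
Local Notation Re := complex.Re.
Local Notation Im := complex.Im.
Notation mu := (@lebesgue_measure R).
Implicit Types (s z : R[i]) (al : R).

Lemma Re_normc z : Re `|z| = Num.sqrt (Re z ^+ 2 + Im z ^+ 2).
Proof. by rewrite normc_def. Qed.

Lemma ln_Re_normc z : 0 < Re z -> ln (Re `|z|) = ln (Re z ^+ 2 + Im z ^+ 2) / 2.
Proof.
move=> z0; rewrite Re_normc -powR12_sqrt ?ln_powR 1?mulrC//.
by rewrite addr_ge0 ?sqr_ge0.
Qed.

(** In the right half-plane the argument lies in ]- pi / 2, pi / 2[, where acos is
inverted on each half separately. *)
Lemma carg_atan z : 0 < Re z -> carg z = atan (Im z / Re z).
Proof.
move=> z0; rewrite /carg.
have -> : Re z / Re `|z| = cos (atan (Im z / Re z)).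
  rewrite cos_atan Re_normc.
  have -> : Re z ^+ 2 + Im z ^+ 2 = Re z ^+ 2 * (1 + (Im z / Re z) ^+ 2) by field; rewrite gt_eqF.
  rewrite sqrtrM ?sqr_ge0// sqrtr_sqr gtr0_norm// invfM mulrA mulfV ?mul1r// gt_eqF//.
have pi0 : (0 : R) < pi := pi_gt0 R.
have piE : pi / 2 <= pi :> R by lra.
have a1 := atan_gtNpi2 (Im z / Re z); have a2 := atan_ltpi2 (Im z / Re z).
case: ifPn => [i0|]; last rewrite -ltNge => i0.
  have a0 : 0 <= atan (Im z / Re z).
    by rewrite -[X in X <= _](atan0 R) le_atan// divr_ge0// ltW.
  by rewrite cosK// in_itv /= a0 (le_trans (ltW a2)).
have a0 : atan (Im z / Re z) <= 0.
  rewrite -[X in _ <= X](atan0 R); apply: le_atan.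
  by rewrite ltW// pmulr_llt0// invr_gt0.
rewrite cosKN ?opprK// a0 andbT (le_trans _ (ltW a1))// lerN2//.
Qed.

Lemma cpow_half s al : 0 < Re s ->
  cpow s al = (expR (al * (ln (Re s ^+ 2 + Im s ^+ 2) / 2)) * cos (al * atan (Im s / Re s))) +i*
              (expR (al * (ln (Re s ^+ 2 + Im s ^+ 2) / 2)) * sin (al * atan (Im s / Re s))).
Proof.
move=> s0; rewrite /cpow /cexp /clog cReZ cImZ /=.
by rewrite -ln_Re_normc// -carg_atan.
Qed.

Let integrable_gamma_trig s al (w : R -> R) : 0 < al -> 0 < Re s ->
  measurable_fun [set: measurableTypeR R] w -> (forall t, `|w t| <= 1) ->
  mu.-integrable `[0, +oo[ (EFin \o (fun t => t `^ (al - 1) * expR (- (Re s * t)) * w t)).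
Proof.
move=> al0 s0 mw w1; apply: (@integrableMb _ _ _ _ 1 _ (integrable_gamma al0 s0)).
- exact: measurable_itv.
- exact: measurable_funTS.
- by move=> t _; exact: w1.
Qed.

Let expw_mul_kernel s al t : expw s t * (rl_kernel al t)%:C =
  ((Gamma al)^-1 * (t `^ (al - 1) * expR (- (Re s * t)) * cos (Im s * t))) +i*
  ((Gamma al)^-1 * - (t `^ (al - 1) * expR (- (Re s * t)) * sin (Im s * t))).
Proof.
apply: complexP; rewrite mulrC ?cReZ ?cImZ ?Re_expw ?Im_expw /rl_kernel /=; ring.
Qed.

Lemma laplace_kernel s al : 0 < al -> 0 < Re s ->
  cintegrable `[0, +oo[ (fun t => expw s t * (rl_kernel al t)%:C) /\
  cintegral `[0, +oo[ (fun t => expw s t * (rl_kernel al t)%:C) * cpow s al = 1.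
Proof.
move=> al0 s0.
have g0 : Gamma al != 0 by rewrite gt_eqF// Gamma_gt0.
have mI : measurable (`[0, +oo[%classic : set (measurableTypeR R)) by exact: measurable_itv.
have mt : measurable_fun [set: measurableTypeR R] (fun t : R => Im s * t) by exact: measurable_funM.
have mc : measurable_fun [set: measurableTypeR R] (fun t => cos (Im s * t)).
  by apply: (measurableT_comp _ mt); apply: continuous_measurable_fun; exact: continuous_cos.
have ms : measurable_fun [set: measurableTypeR R] (fun t => sin (Im s * t)).
  by apply: (measurableT_comp _ mt); apply: continuous_measurable_fun; exact: continuous_sin.
have c1 t : `|cos (Im s * t)| <= 1 by rewrite ler_norml cos_geN1 cos_le1.
have s1 t : `|sin (Im s * t)| <= 1 by rewrite ler_norml sin_geN1 sin_le1.
have ic := integrable_gamma_trig al0 s0 mc c1.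
have iS := integrable_gamma_trig al0 s0 ms s1.
have iN : mu.-integrable `[0, +oo[ (EFin \o (fun t => - (t `^ (al - 1) * expR (- (Re s * t)) * sin (Im s * t)))).
  exact: RintegrableN.
rewrite (funext (expw_mul_kernel s al)); split.
  apply: (cintegrable_comp (RintegrableZl (Gamma al)^-1 mI ic) (RintegrableZl (Gamma al)^-1 mI iN)) => //.
have key (c d W1 W2 : R) : c * W1 + d * W2 = Gamma al -> c * W2 - d * W1 = 0 ->
    (((Gamma al)^-1 * c) +i* ((Gamma al)^-1 * - d)) * (W1 +i* W2) = 1.
  move=> E1 E2; apply: complexP; rewrite cE /=.
  - by rewrite -(mulVf g0) -E1; ring.
  - by rewrite -(mulr0 (Gamma al)^-1) -E2; ring.
rewrite cpow_half//.
have [E1 E2] := gamma_trig al0 s0 (Im s).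
rewrite /cintegral /Re_fun /Im_fun /= (RintegralZl _ mI ic) (RintegralZl _ mI iN).
have -> : \int[mu]_(t in `[0, +oo[) (- (t `^ (al - 1) * expR (- (Re s * t)) * sin (Im s * t))) =
  - \int[mu]_(t in `[0, +oo[) (t `^ (al - 1) * expR (- (Re s * t)) * sin (Im s * t)).
  by rewrite -[RHS]mulN1r -[RHS](RintegralZl _ mI iS); apply: eq_Rintegral => t _; rewrite mulN1r.
exact: key E1 E2.
Qed.

Lemma cpow_neq0 s al : cpow s al != 0.
Proof.
apply/eqP => h; have := congr1 (fun z => Re z ^+ 2 + Im z ^+ 2) h.
rewrite /cpow /cexp /= !exprMn -mulrDr cos2Dsin2 mulr1 expr0n addr0 => /eqP.
by rewrite expf_eq0 gt_eqF// expR_gt0.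
Qed.

Lemma cpow_subr1 s al : 0 < Re s -> cpow s (al - 1) * s = cpow s al.
Proof.
move=> s0; rewrite !cpow_half//.
have h : s = (expR (ln (Re s ^+ 2 + Im s ^+ 2) / 2) * cos (atan (Im s / Re s))) +i*
   (expR (ln (Re s ^+ 2 + Im s ^+ 2) / 2) * sin (atan (Im s / Re s))).
  have tn : Im s / Re s = tan (atan (Im s / Re s)) by rewrite atanK.
  have cn : cos (atan (Im s / Re s)) != 0.
    by rewrite gt_eqF// cos_gt0_pihalf// atan_gtNpi2 atan_ltpi2.
  have r0 : 0 < Re `|s|.
    by rewrite Re_normc sqrtr_gt0 ltr_wpDr ?sqr_ge0// exprn_gt0.
  have R1 : Re s = expR (ln (Re s ^+ 2 + Im s ^+ 2) / 2) * cos (atan (Im s / Re s)).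
    rewrite -ln_Re_normc// lnK// cos_atan Re_normc.
    have -> : Re s ^+ 2 + Im s ^+ 2 = Re s ^+ 2 * (1 + (Im s / Re s) ^+ 2) by field; rewrite gt_eqF.
    rewrite sqrtrM ?sqr_ge0// sqrtr_sqr gtr0_norm// mulfK// gt_eqF// sqrtr_gt0.
    by rewrite ltr_wpDr ?sqr_ge0.
  apply: complexP => //=; rewrite -[LHS](@mulfVK _ (Re s)) ?gt_eqF// {1}tn {2}R1 /tan mulrA.
  by rewrite mulrAC mulfVK// mulrC.
rewrite [X in _ * X]h; set l := ln _ / 2; set t := atan _.
have El : expR (al * l) = expR ((al - 1) * l) * expR l by rewrite -expRD; congr expR; ring.
have Et : al * t = (al - 1) * t + t by ring.
apply: complexP; rewrite cE /= El Et ?cosD ?sinD; ring.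
Qed.

(** The argument of s^al is al arg s, still in ]- pi / 2, pi / 2[. *)
Lemma Re_cpow_gt0 s al : 0 < Re s -> 0 < al < 1 -> 0 < Re (cpow s al).
Proof.
move=> s0 /andP[al0 al1]; rewrite cpow_half//= mulr_gt0 ?expR_gt0//.
have a1 := atan_gtNpi2 (Im s / Re s); have a2 := atan_ltpi2 (Im s / Re s).
have pi2 : 0 < pi / 2 :> R by rewrite divr_gt0// pi_gt0.
apply: cos_gt0_pihalf; rewrite -ltr_norml normrM (gtr0_norm al0).
apply: le_lt_trans (_ : `|atan (Im s / Re s)| < _); last by rewrite ltr_norml a1.
by rewrite ler_piMl// ltW.
Qed.

End ComplexPower.

(** * Functions with vanishing exponential moments *)

Section ExponentialMoments.
Variable R : realType.
Notation mu := (@lebesgue_measure R).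
Implicit Types (t x T : R) (n N : nat).

(** Lebesgue differentiation, applied to the truncation of u to [0, n] for every
n. *)
Lemma ae_eq0_prim (u : R -> R) : (forall T, mu.-integrable `[0, T] (EFin \o u)) ->
  (forall T, 0 <= T -> \int[mu]_(x in `[0, T]) u x = 0) -> {ae mu, forall t, 0 < t -> u t = 0}.
Proof.
move=> ui u0; have aeF : Filter (almost_everywhere mu) := ae_filter_ringOfSetsType mu.
have H n : {ae mu, forall t, 0 < t -> t <= n%:R -> u t = 0}.
  pose f := u \_ `[0, n%:R].
  have fi : mu.-integrable setT (EFin \o f) := integrable_patch (measurable_itv _) (ui n%:R).
  have fl : locally_integrable [set: R] f.
    exact: (integrable_locally (measurable_itv _) (ui n%:R)).
  have fy (y : R) : mu.-integrable [set` Interval (BLeft 0) (BRight y)] (EFin \o f).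
    by apply: integrableS fi => //; exact: measurable_itv.
  have F0 (x : R) : \int[mu]_(t in [set` Interval (BLeft 0) (BRight x)]) f t = 0.
    rewrite /f -Rintegral_mkcondr.
    have [x0|x0] := ltP x 0.
      by rewrite set_itv_ge ?set0I ?Rintegral_set0// bnd_simp -ltNge.
    have -> : `[0, x] `&` `[0, n%:R] = `[0, Num.min x n%:R]%classic :> set R.
      apply/seteqP; split => z /=; rewrite !in_itv /= le_min.
        by move=> [/andP[-> ->] /andP[_ ->]].
      by move=> /andP[-> /andP[-> ->]].
    by apply: u0; rewrite le_min x0 ler0n.
  have := FTC1 fy fl; apply: filterS => t /= ht t0 tn.
  have [|_] := ht _; first by rewrite lte_fin.
  rewrite (funext F0) /f patchE mem_setE in_itv /= (ltW t0) tn /= => <-.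
  by rewrite derive1_cst.
have := ae_foralln H; apply: filterS => t /= ht t0.
apply: (ht (Num.trunc t).+1) => //; exact: ltW (truncnS_gt t).
Qed.

Variables (psi : R -> R) (M : R).
Hypothesis psiM : forall t, 0 <= t -> `|psi t| <= M.
Hypothesis mpsi : measurable_fun (`[0, +oo[%classic : set (measurableTypeR R)) psi.
Hypothesis psi0 : forall n, (0 < n)%N -> \int[mu]_(t in `[0, +oo[) (expR (- (n%:R * t)) * psi t) = 0.

Let mI : measurable (`[0, +oo[%classic : set (measurableTypeR R)).
Proof. exact: measurable_itv. Qed.

(** With x = e^(-t), this is Landau's kernel 1 - (x - x0)^2: it is maximal at x = x0, and
its powers concentrate there. *)
Let landau x0 t := 1 - (expR (- t) - x0) ^+ 2.

Let landau_bound x0 t : 0 <= x0 <= 1 -> 0 <= t -> 0 <= landau x0 t <= 1.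
Proof.
move=> /andP[x00 x01] t0; rewrite /landau.
have e0 := expR_ge0 (- t); have e1 : expR (- t) <= 1 by rewrite expR_le1 oppr_le0.
have : 0 <= (1 - (expR (- t) - x0)) * (1 + (expR (- t) - x0)) by apply: mulr_ge0; lra.
have -> : (1 - (expR (- t) - x0)) * (1 + (expR (- t) - x0)) = 1 - (expR (- t) - x0) ^+ 2 by ring.
by move=> ->; rewrite gerBl sqr_ge0.
Qed.

Let measurable_landau x0 N n : measurable_fun [set: measurableTypeR R] (fun t => expR (- (n%:R * t)) * landau x0 t ^+ N).
Proof.
apply: measurable_funM.
  by apply: measurableT_comp => //; apply: measurableT_comp => //; exact: measurable_funM.
apply: measurable_funX; apply: measurable_funB => //; apply: measurable_funX; apply: measurable_funB => //.
by apply: measurableT_comp => //; exact: measurableT_comp.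
Qed.

Let integrable_landau x0 N n : 0 <= x0 <= 1 -> (0 < n)%N ->
  mu.-integrable `[0, +oo[ (EFin \o (fun t => expR (- (n%:R * t)) * landau x0 t ^+ N * psi t)).
Proof.
move=> x01 n0; have n0' : 0 < n%:R :> R by rewrite ltr0n.
have M0 : 0 <= M := le_trans (normr_ge0 _) (psiM (lexx 0)).
apply: (le_integrable mI _ _ (RintegrableZl M mI (integrable_expR_neg n0'))).
  apply/measurable_EFinP; apply: measurable_funM => //.
  by apply: measurable_funTS; exact: measurable_landau.
move=> t; rewrite /= in_itv /= andbT => t0; rewrite lee_fin.
have /andP[l0 l1] := landau_bound x01 t0.
rewrite !normrM (ger0_norm (expR_ge0 _)) [`|M|]ger0_norm// mulrC ler_pM// ?psiM//.
by rewrite ler_piMr ?expR_ge0// normrX ger0_norm// exprn_ile1.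
Qed.

(** landau x0 is a polynomial of degree 2 in e^(-t), so its powers reduce the integral
to the moments; the induction uses all n at once because multiplication by
e^(-t) increases n. *)
Let integral_landau x0 N n : 0 <= x0 <= 1 -> (0 < n)%N ->
  \int[mu]_(t in `[0, +oo[) (expR (- (n%:R * t)) * landau x0 t ^+ N * psi t) = 0.
Proof.
move=> x01; elim: N n => [|N IH] n n0.
  by rewrite -[RHS](psi0 n0); apply: eq_Rintegral => t _; rewrite expr0 mulr1.
pose g k t := expR (- (k%:R * t)) * landau x0 t ^+ N * psi t.
have gi k : (0 < k)%N -> mu.-integrable `[0, +oo[ (EFin \o g k) by exact: integrable_landau.
have g0 k : (0 < k)%N -> \int[mu]_(t in `[0, +oo[) g k t = 0 by exact: IH.
have i1 := RintegrableZl (1 - x0 ^+ 2) mI (gi n n0).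
have i2 := RintegrableZl (2 * x0) mI (gi n.+1 isT).
have i3 := gi n.+2 isT.
rewrite (eq_Rintegral mu (g := fun t => (1 - x0 ^+ 2) * g n t + 2 * x0 * g n.+1 t - g n.+2 t)).
  rewrite (RintegralB mI (RintegrableD mI i1 i2) i3) (RintegralD mI i1 i2).
  by rewrite (RintegralZl _ mI (gi n n0)) (RintegralZl _ mI (gi n.+1 isT)) !g0// !mulr0 addr0 subr0.
move=> t _; rewrite /g exprS /landau.
have e1 : expR (- (n.+1%:R * t)) = expR (- (n%:R * t)) * expR (- t).
  by rewrite -expRD; congr expR; rewrite -natr1; ring.
have e2 : expR (- (n.+2%:R * t)) = expR (- (n%:R * t)) * expR (- t) * expR (- t).
  by rewrite -!expRD; congr expR; rewrite -!natr1; ring.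
rewrite e1 e2; ring.
Qed.

(** Suppose psi >= c > 0 near t0.  The integral of e^(-t) landau^N psi vanishes; near
t0 it is at least of order c A^N, and away from t0 at least of order - M Bd^N with
constants 0 < Bd < A, a contradiction for large N. *)
Lemma moments_not_gt0 t0 : 0 < t0 -> {for t0, continuous psi} -> ~ 0 < psi t0.
Proof.
move=> t00 cpsi p0.
pose c := psi t0 / 2; have c0 : 0 < c by rewrite divr_gt0.
have [d /= d0 hd] : exists2 d : R, 0 < d & forall t, `|t - t0| < d -> c <= psi t.
  have /cvgrPdist_le/(_ c c0) := cpsi.
  move=> /nbhs_ballP[d /= d0 hd]; exists d => // t td.
  have /hd : ball t0 d t by rewrite /ball /= distrC.
  rewrite /= ler_norml => /andP[_]; rewrite lerBlDr -lerBlDl => h; apply: le_trans h.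
  by rewrite /c; lra.
(* inside the radius d1 psi is at least c; inside the smaller radius d3 landau is at
   least A; outside d1 it is at most Bd *)
pose d1 := Num.min d t0; have d10 : 0 < d1 by rewrite lt_min d0.
pose x0 := expR (- t0).
have x01 : 0 <= x0 <= 1 by rewrite expR_ge0 expR_le1 oppr_le0 ltW.
pose eta := Num.min (x0 - expR (- (t0 + d1))) (expR (- (t0 - d1)) - x0).
have eta0 : 0 < eta.
  by rewrite lt_min !subr_gt0 !ltr_expR; apply/andP; split; lra.
have far t : 0 <= t -> d1 <= `|t - t0| -> landau x0 t <= 1 - eta ^+ 2.
  move=> t_0; rewrite ler_normr => /orP[h|h]; rewrite /landau lerB//.
    have : expR (- t) <= expR (- (t0 + d1)) by rewrite ler_expR; lra.
    have : eta <= x0 - expR (- (t0 + d1)) by rewrite ge_min lexx.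
    by move=> h1 h2; rewrite -[leRHS]sqrrN; apply: lerXn2r; rewrite ?nnegrE; lra.
  have : expR (- (t0 - d1)) <= expR (- t) by rewrite ler_expR; lra.
  have : eta <= expR (- (t0 - d1)) - x0 by rewrite ge_min lexx orbT.
  by move=> h1 h2; apply: lerXn2r; rewrite ?nnegrE; lra.
have eta1 : eta < 1.
  have : eta <= x0 - expR (- (t0 + d1)) by rewrite ge_min lexx.
  have := expR_gt0 (- (t0 + d1)); move: x01; lra.
have [d2 /= d20 near] : exists2 d2 : R, 0 < d2 & forall t, `|t - t0| <= d2 -> `|expR (- t) - x0| <= eta / 2.
  have ce : {for t0, continuous (fun t : R => expR (- t))}.
    by apply: continuous_comp; [exact: continuousN|exact: continuous_expR].
  have e2 : 0 < eta / 2 by rewrite divr_gt0.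
  have /cvgrPdist_le/(_ _ e2) := ce.
  move=> /nbhs_ballP[r /= r0 h]; exists (r / 2); first by rewrite divr_gt0.
  move=> t td; rewrite distrC; apply: h; rewrite /ball /= distrC (le_lt_trans td)//.
  by rewrite ltr_pdivrMr// ltr_pMr// ltr1n.
pose d3 := Num.min d2 (d1 / 2).
have d30 : 0 < d3 by rewrite lt_min d20 divr_gt0.
have d3d2 : d3 <= d2 by rewrite ge_min lexx.
have d3d1 : d3 <= d1 / 2 by rewrite ge_min lexx orbT.
have d1t0 : d1 / 2 <= t0.
  have : d1 <= t0 by rewrite ge_min lexx orbT.
  by lra.
have d1d : d1 <= d by rewrite ge_min lexx.
pose A := 1 - eta ^+ 2 / 4; pose Bd := 1 - eta ^+ 2.
have e20 : 0 < eta ^+ 2 by rewrite exprn_gt0.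
have e21 : eta ^+ 2 < 1 by rewrite exprn_ilt1// ltW.
have AB : Bd < A by rewrite /A /Bd; lra.
have B0 : 0 < Bd by rewrite /Bd; lra.
have A0 : 0 < A := lt_trans B0 AB.
have M0 : 0 < M := lt_le_trans p0 (le_trans (ler_norm _) (psiM (ltW t00))).
pose c' := c * expR (- (t0 + d3)).
have c'0 : 0 < c' by rewrite mulr_gt0// expR_gt0.
have key N : c' * A ^+ N * (2 * d3) <= M * Bd ^+ N.
  (* a minorant of the integrand on the whole half-line *)
  pose bump : R -> R := (fun=> 1 : R) \_ `](t0 - d3), (t0 + d3)].
  pose lo t := c' * A ^+ N * bump t - M * Bd ^+ N * expR (- (1 * t)).
  have i1 : mu.-integrable `[0, +oo[ (EFin \o bump).
    apply: (@integrableS _ _ _ mu setT `[0, +oo[%classic _ measurableT mI (fun _ _ => I)).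
    apply: integrable_patch; first exact: measurable_itv.
    apply: measurable_bounded_integrable => //; last exact: bounded_cst.
    exact: mu_itvoc_lty.
  have i2 := integrable_expR_neg (@ltr01 R).
  have i3 := integrable_landau N x01 (isT : (0 < 1)%N).
  have := @le_Rintegral _ _ _ mu _ lo _ mI (RintegrableB mI (RintegrableZl (c' * A ^+ N) mI i1) (RintegrableZl (M * Bd ^+ N) mI i2)) i3.
  rewrite (@integral_landau x0 N 1%N x01 isT).
  rewrite (RintegralB mI (RintegrableZl (c' * A ^+ N) mI i1) (RintegrableZl (M * Bd ^+ N) mI i2)).
  rewrite (RintegralZl _ mI i1) (RintegralZl _ mI i2).
  have -> : \int[mu]_(x in `[0, +oo[) expR (- (1 * x)) = 1.
    rewrite -[RHS](@Gamma1 R) Gamma_itv0y//; apply: eq_Rintegral => t _.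
    by rewrite mul1r subrr powRr0 mul1r.
  have -> : \int[mu]_(x in `[0, +oo[) bump x = 2 * d3.
    rewrite /bump -Rintegral_mkcondr setIidr; last first.
      move=> z; rewrite /= !in_itv /= andbT => /andP[z1 _]; apply: ltW; apply: le_lt_trans z1.
      by rewrite subr_ge0 (le_trans d3d1).
    rewrite Rintegral_cst// mul1r mu_itvoc; first by ring.
    by lra.
  rewrite mulr1 subr_le0; apply => t; rewrite /= in_itv /= andbT => t_0.
  have /andP[l0 l1] := landau_bound x01 t_0.
  have E0 := expR_ge0 (- (1 * t)).
  have PE0 : 0 <= expR (- (1 * t)) * landau x0 t ^+ N by rewrite mulr_ge0// exprn_ge0.
  have MB0 : 0 <= M * Bd ^+ N * expR (- (1 * t)).
    by rewrite mulr_ge0// mulr_ge0 ?(ltW M0)// exprn_ge0// ltW.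
  rewrite /lo /bump patchE; case: ifPn => [|_].
    rewrite mem_setE in_itv /= => /andP[h1 h2]; rewrite mulr1.
    have td : `|t - t0| <= d3 by rewrite ler_norml; apply/andP; split; lra.
    have lA : A <= landau x0 t.
      have := near t (le_trans td d3d2); rewrite /landau /A ler_norml => /andP[k1 k2].
      have : 0 <= (eta / 2 - (expR (- t) - x0)) * (eta / 2 + (expR (- t) - x0)).
        by apply: mulr_ge0; lra.
      have -> : (eta / 2 - (expR (- t) - x0)) * (eta / 2 + (expR (- t) - x0)) =
         eta ^+ 2 / 4 - (expR (- t) - x0) ^+ 2 by field.
      by rewrite subr_ge0 => k; rewrite lerB.
    have lc : c <= psi t by apply: hd; rewrite (le_lt_trans td)// (lt_le_trans _ d1d)//; lra.
    have E1 : expR (- (t0 + d3)) <= expR (- (1 * t)) by rewrite ler_expR; lra.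
    apply: (@le_trans _ _ (c' * A ^+ N)); first by rewrite gerBl.
    have AN0 : 0 <= A ^+ N by rewrite exprn_ge0// ltW.
    have AN : A ^+ N <= landau x0 t ^+ N by apply: lerXn2r lA; rewrite nnegrE// ltW.
    have -> : c' * A ^+ N = expR (- (t0 + d3)) * A ^+ N * c by rewrite /c'; ring.
    apply: ler_pM; [|exact: ltW| |exact: lc].
      by rewrite mulr_ge0// expR_ge0.
    by apply: ler_pM => //; exact: expR_ge0.
  rewrite mulr0 sub0r; have [td|td] := ltP `|t - t0| d1.
    have lc : 0 <= psi t by rewrite (le_trans (ltW c0))// hd// (lt_le_trans td).
    by rewrite (@le_trans _ _ 0)// ?oppr_le0// mulr_ge0.
  have lB := far t t_0 td.
  have LB : landau x0 t ^+ N <= Bd ^+ N by rewrite lerXn2r// nnegrE// ltW.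
  have pM : - M <= psi t by have := psiM t_0; rewrite ler_norml => /andP[].
  apply: (@le_trans _ _ (expR (- (1 * t)) * landau x0 t ^+ N * - M)); last by rewrite ler_wpM2l.
  rewrite mulrN lerN2 mulrC -mulrA ler_wpM2l ?(ltW M0)// mulrC ler_wpM2r//.
have [N hN] : exists N, (Bd / A) ^+ N < c' * (2 * d3) / M.
  have q1 : `|Bd / A| < 1.
    by rewrite ger0_norm ?divr_ge0 ?(ltW A0) ?(ltW B0)// ltr_pdivrMr// mul1r.
  have q0 : 0 < c' * (2 * d3) / M.
    by apply: divr_gt0 => //; apply: mulr_gt0 => //; apply: mulr_gt0.
  have /cvgrPdist_lt/(_ _ q0)[N _ h] := cvg_expr q1.
  exists N; have := h N (leqnn N); rewrite /= sub0r normrN; exact: le_lt_trans (ler_norm _).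
have := key N; rewrite leNgt => /negP; apply.
move: hN; rewrite expr_div_n ltr_pdivlMr// mulrAC ltr_pdivrMr ?exprn_gt0//.
by rewrite mulrC mulrAC.
Qed.

End ExponentialMoments.

Lemma exponential_moments_eq0 (R : realType) (psi : R -> R) M :
  (forall t, 0 <= t -> `|psi t| <= M) ->
  measurable_fun (`[0, +oo[%classic : set (measurableTypeR R)) psi ->
  (forall t, 0 < t -> {for t, continuous psi}) ->
  (forall n, (0 < n)%N ->
    \int[@lebesgue_measure R]_(t in `[0, +oo[) (expR (- (n%:R * t)) * psi t) = 0) ->
  forall t, 0 < t -> psi t = 0.
Proof.
move=> pM mp cp p0 t t0; apply/eqP; rewrite eq_le; apply/andP; split; rewrite leNgt; apply/negP.
  exact: (moments_not_gt0 pM mp p0 t0 (cp t t0)).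
rewrite -oppr_gt0; apply: (@moments_not_gt0 _ (fun t => - psi t) M) => //.
- by move=> x x0; rewrite normrN; exact: pM.
- exact: measurableT_comp.
- move=> n n0; have n0' : 0 < n%:R :> R by rewrite ltr0n.
  transitivity (-1 * \int[@lebesgue_measure R]_(x in `[0, +oo[) (expR (- (n%:R * x)) * psi x)); last by rewrite p0// mulr0.
  rewrite -RintegralZl//.
    by apply: eq_Rintegral => x _; rewrite mulN1r mulrN.
  apply: (@integrableMb _ _ _ _ M _ (integrable_expR_neg n0')) => //.
  by move=> x; rewrite /= in_itv /= andbT => /pM.
- by apply: continuousN; exact: cp.
Qed.

(** * Convergence and uniqueness of the Laplace transform *)

Section HalfPlane.
Variable R : realType.
Notation mu := (@lebesgue_measure R).
Local Notation Re := complex.Re.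
Local Notation Im := complex.Im.
Implicit Types (f u : R -> R[i]) (s p : R[i]) (t x T : R).

Lemma continuous_prim u t : (forall T, cintegrable `[0, T] u) -> 0 < t ->
  {for t, continuous (Re_fun (prim u))} /\ {for t, continuous (Im_fun (prim u))}.
Proof.
move=> ui t0; have T0 : 0 <= t + 1 by rewrite addr_ge0// ltW.
have [c1 c2] := within_continuous_prim T0 (ui (t + 1)).
have tI : t \in `]0, (t + 1)[ by rewrite in_itv /= t0 ltrDl ltr01.
have I0 : 0 < t + 1 by rewrite addr_gt0.
split.
- by have [h _ _] := (continuous_within_itvP (Re_fun (prim u)) I0).1 c1; exact: h.
- by have [h _ _] := (continuous_within_itvP (Im_fun (prim u)) I0).1 c2; exact: h.
Qed.

Lemma cmeasurable_prim_itvy u : (forall T, cintegrable `[0, T] u) -> cmeasurable `[0, +oo[ (prim u).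
Proof.
move=> ui.
have U : `[0, +oo[%classic = \bigcup_n `[0, n%:R]%classic :> set R.
  apply/seteqP; split => x; rewrite /= in_itv /= ?andbT.
    move=> x0; exists (Num.trunc x).+1 => //; rewrite /= in_itv /= x0 ltW//.
    exact: truncnS_gt.
  by move=> [n _]; rewrite /= in_itv /= => /andP[].
have mI n : measurable (`[0, n%:R]%classic : set (measurableTypeR R)) by exact: measurable_itv.
rewrite U; split; apply/(measurable_fun_bigcup _ mI) => n.
- exact: (cmeasurable_prim (ui n%:R)).1.
- exact: (cmeasurable_prim (ui n%:R)).2.
Qed.

(** After integration by parts the integrand carries the bounded function prim u, so the
weight e^(-pt) makes the integral absolutely convergent, and the boundary term
tends to 0. *)
Lemma ccvg_expw_mul u L p : (forall T, cintegrable `[0, T] u) -> ccvg (prim u) L -> 0 < Re p ->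
  cintegrable `[0, +oo[ (fun t => expw p t * prim u t) /\
  ccvg (prim (fun t => expw p t * u t)) (p * cintegral `[0, +oo[ (fun t => expw p t * prim u t)).
Proof.
move=> ui uL p0; have [M M0 hM] := ccvg_bounded ui uL.
have mI : measurable (`[0, +oo[%classic : set (measurableTypeR R)) by exact: measurable_itv.
have Ei : cintegrable `[0, +oo[ (expw p).
  have [m1 m2] := cmeasurable_expw p mI.
  by split; [apply: (le_integrable mI _ _ (integrable_expR_neg p0)) => //; first exact/measurable_EFinP
    |apply: (le_integrable mI _ _ (integrable_expR_neg p0)) => //; first exact/measurable_EFinP];
   move=> t _; rewrite lee_fin (ger0_norm (expR_ge0 _)); have [] := expw_bound p t.
have Epi : cintegrable `[0, +oo[ (fun t => expw p t * prim u t).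
  apply: (cintegrableMb mI Ei (cmeasurable_prim_itvy ui) (M := M)).
  by move=> t; rewrite /= in_itv /= andbT => /hM.
split=> //.
have c1 : ccvg (fun T => expw p T * prim u T) 0.
  by rewrite -(mul0r L); apply: ccvgM => //; exact: ccvg_expw.
have c2 : ccvg (prim (fun t => expw p t * prim u t)) (cintegral `[0, +oo[ (fun t => expw p t * prim u t)).
  by split; [exact: cvg_Rintegral_itvy Epi.1|exact: cvg_Rintegral_itvy Epi.2].
have := ccvgD c1 (ccvgZ p c2); rewrite add0r; apply: ccvg_eq => T T0.
by rewrite (integral_expw_mul p (ltW T0) (ui T)).
Qed.

Lemma laplace_cvgE f s : laplace_cvg f s ->
  (forall T, cintegrable `[0, T] f) /\ ccvg (prim (fun t => expw s t * f t)) (laplace f s).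
Proof.
move=> [fi [c1 c2]]; split; last exact: (conj c1 c2).
move=> T; have [/fi|T0] := ltP 0 T; first exact.
apply: (cintegrableS _ _ _ (fi 1 ltr01)); try exact: measurable_itv.
by apply: subset_itv0; rewrite (le_trans T0).
Qed.

Lemma laplace_ccvg f s L : (forall T, cintegrable `[0, T] f) ->
  ccvg (prim (fun t => expw s t * f t)) L -> laplace_cvg f s /\ laplace f s = L.
Proof.
move=> fi [c1 c2]; split.
  split; first by move=> T _; exact: fi.
  by split; [exact: (cvgP _ c1)|exact: (cvgP _ c2)].
by apply: complexP; [exact: (cvg_lim _ c1)|exact: (cvg_lim _ c2)].
Qed.

(** e^(-st) f = e^(-(s - s0)t) (e^(-s0 t) f), to which ccvg_expw_mul applies. *)
Lemma laplace_half_plane f s0 s : laplace_cvg f s0 -> Re s0 < Re s -> laplace_cvg f s.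
Proof.
move=> /laplace_cvgE[fi fL] ss.
have p0 : 0 < Re (s - s0) by rewrite cReD cReN subr_gt0.
have [_ c] := ccvg_expw_mul (fun T => cintegrable_expw_mul s0 (fi T)) fL p0.
have E : (fun t => expw (s - s0) t * (expw s0 t * f t)) = (fun t => expw s t * f t).
  by apply/funext => t; rewrite mulrA -expwDl subrK.
rewrite E in c; exact: (laplace_ccvg fi c).1.
Qed.

(** For a real s0 to the right of sigma let u = e^(-s0 t) f.  By ccvg_expw_mul the
transform of f at s0 + n is n times the n-th exponential moment of prim u; so
prim u vanishes, and u with it almost everywhere. *)
Lemma laplace_unique f (sigma : R) : (forall s, sigma < Re s -> laplace_cvg f s /\ laplace f s = 0) ->
  {ae mu, forall t, 0 < t -> f t = 0}.
Proof.
move=> fs; have aeF : Filter (almost_everywhere mu) := ae_filter_ringOfSetsType mu.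
pose s0 : R[i] := (sigma + 1)%:C.
have s0s : sigma < Re s0 by rewrite /= ltrDl.
have [/laplace_cvgE[fi fL] f0] := fs s0 s0s; rewrite f0 in fL.
pose u t := expw s0 t * f t.
have ui T : cintegrable `[0, T] u by exact: cintegrable_expw_mul.
have [M M0 hM] := ccvg_bounded ui fL.
have [m1 m2] := cmeasurable_prim_itvy ui.
have mom n : (0 < n)%N -> cintegral `[0, +oo[ (fun t => expw n%:R t * prim u t) = 0.
  move=> n0; have p0 : 0 < Re (n%:R : R[i]).
    by rewrite -(rmorph_nat (real_complex R)) /= ltr0n.
  have [_ c] := ccvg_expw_mul ui fL p0.
  have E : (fun t => expw n%:R t * u t) = (fun t => expw (n%:R + s0) t * f t).
    by apply/funext => t; rewrite mulrA -expwDl.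
  rewrite E in c.
  have [_ e] := laplace_ccvg fi c.
  have [|_ e'] := fs (n%:R + s0); first by rewrite cReD ltr_wpDl// ltW.
  have := e; rewrite e' => /esym/eqP; rewrite mulf_eq0 => /orP[|/eqP//].
  by rewrite pnatr_eq0 => /eqP n00; rewrite n00 in n0.
have En n t : expw n%:R t = (expR (- (n%:R * t)))%:C.
  have -> : n%:R = (n%:R)%:C :> R[i] by rewrite rmorph_nat.
  by apply: complexP; rewrite ?Re_expw ?Im_expw /= mul0r ?cos0 ?sin0 ?mulr1 ?mulr0 ?oppr0.
have H t : 0 < t -> prim u t = 0.
  move=> t0; apply: complexP.
  - apply: (@exponential_moments_eq0 R (Re_fun (prim u)) M) => //.
    + by move=> x /hM[].
    + by move=> x x0; have [] := continuous_prim ui x0.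
    + move=> n n0; have /(congr1 (fun z : R[i] => Re z))/= := mom n n0; rewrite /cintegral /= => h.
      rewrite -[RHS]h; by apply: eq_Rintegral => x _; rewrite /Re_fun En cReZ.
  - apply: (@exponential_moments_eq0 R (Im_fun (prim u)) M) => //.
    + by move=> x /hM[].
    + by move=> x x0; have [] := continuous_prim ui x0.
    + move=> n n0; have /(congr1 (fun z : R[i] => Im z))/= := mom n n0; rewrite /cintegral /= => h.
      rewrite -[RHS]h; by apply: eq_Rintegral => x _; rewrite /Im_fun En cImZ.
have prim0 T : 0 <= T -> prim u T = 0.
  rewrite le_eqVlt => /predU1P[<-|/H//].
  by rewrite /prim set_itv1 /cintegral !Rintegral_set1.
have h1 : {ae mu, forall t, 0 < t -> Re_fun u t = 0}.
  by apply: ae_eq0_prim; [move=> T; exact: (ui T).1|move=> T /prim0/(congr1 (fun z : R[i] => Re z))].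
have h2 : {ae mu, forall t, 0 < t -> Im_fun u t = 0}.
  by apply: ae_eq0_prim; [move=> T; exact: (ui T).2|move=> T /prim0/(congr1 (fun z : R[i] => Im z))].
apply: filterS2 h1 h2 => t k1 k2 t0.
have : u t = 0 by apply: complexP; [exact: k1|exact: k2].
have e0 : expw (- s0) t * expw s0 t = 1.
  by rewrite -expwDl addNr /expw oppr0 mul0r /cexp /= expR0 cos0 sin0 mulr1 mulr0.
by move=> /(congr1 ( *%R (expw (- s0) t))); rewrite /u mulrA e0 mul1r mulr0.
Qed.

End HalfPlane.

(** * The equation for the ABC derivative *)

Section Transform.
Variable R : realType.
Notation mu := (@lebesgue_measure R).
Local Notation Re := complex.Re.
Local Notation Im := complex.Im.
Implicit Types (f g : R -> R[i]) (s : R[i]) (t x T al : R).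

Lemma cderive1_cintegrable f T : ABC_domain f -> cintegrable `[0, T] (cderive1 f).
Proof.
move=> [_ _ _ fi]; have [/fi|T0] := ltP 0 T; first exact.
apply: (cintegrableS _ _ _ (fi 1 ltr01)); try exact: measurable_itv.
by apply: subset_itv0; rewrite (le_trans T0).
Qed.

Lemma increment_eq_prim f t : ABC_domain f -> 0 <= t -> f t - f 0 = prim (cderive1 f) t.
Proof.
move=> fD t0; have [i1 i2] := cderive1_cintegrable t fD; have [df c1 c2 _] := fD.
have d1 x : 0 < x -> derivable (Re_fun f) x 1 by move=> /df[].
have d2 x : 0 < x -> derivable (Im_fun f) x 1 by move=> /df[].
apply: complexP; rewrite !cE; apply/esym.
- have h := @increment_eq_integral0 R (Re_fun f) t t0 d1 c1 i1.
  exact: h.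
- have h := @increment_eq_integral0 R (Im_fun f) t t0 d2 c2 i2.
  exact: h.
Qed.

Lemma ABC_domain_regular f T : ABC_domain f ->
  cmeasurable `[0, T] f /\ exists M, cbounded `[0, T] f M.
Proof.
move=> fD; have fi := cderive1_cintegrable T fD.
have mI : measurable (`[0, T]%classic : set (measurableTypeR R)) by exact: measurable_itv.
have [m1 m2] := cmeasurable_prim fi; have [M hM] := cbounded_prim fi.
have E x : `[0, T]%classic x -> f x = f 0 + prim (cderive1 f) x.
  by rewrite /= in_itv /= => /andP[x0 _]; rewrite -(increment_eq_prim fD x0) addrC subrK.
split.
  split.
  - apply: (eq_measurable_fun (fun x => Re (f 0) + Re_fun (prim (cderive1 f)) x)).
      by move=> x; rewrite inE => /E e; rewrite [in RHS]/Re_fun e cE.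
    exact: (measurable_funD (measurable_cst _) m1).
  - apply: (eq_measurable_fun (fun x => Im (f 0) + Im_fun (prim (cderive1 f)) x)).
      by move=> x; rewrite inE => /E e; rewrite [in RHS]/Im_fun e cE.
    exact: (measurable_funD (measurable_cst _) m2).
exists (Num.max `|Re (f 0)| `|Im (f 0)| + M) => x xT; have [h1 h2] := hM x xT.
rewrite (E x xT) !cE; split; apply: (le_trans (ler_normD _ _)); apply: lerD.
- by rewrite le_max lexx.
- exact: h1.
- by rewrite le_max lexx orbT.
- exact: h2.
Qed.

Lemma mlfun_props al lam : 0 < al ->
  [/\ forall T, cmeasurable `[0, T] (fun x : R => (mlfun al lam x)%:C),
      forall T, exists M, cbounded `[0, T] (fun x : R => (mlfun al lam x)%:C) M,
      forall T, cintegrable `[0, T] (fun x : R => (rl_kernel al x)%:C)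
    & forall t, 0 <= t -> (mlfun al lam t)%:C + lam%:C *
        convolution (fun x => (rl_kernel al x)%:C) (fun x => (mlfun al lam x)%:C) t = 1].
Proof.
move=> al0; split=> [T|T|T|t t0].
- by split; [exact: measurable_mlfun|exact: measurable_cst].
- have [M M0 hM] := mlfun_bound lam al0 (normr_ge0 T).
  exists M => x; rewrite /= in_itv /= => /andP[x0 xT]; rewrite normr0; split=> //.
  by apply: hM; rewrite x0 (le_trans xT)// ler_norm.
- by split; [exact: integrable_rl_kernel|exact: integrable0].
- apply: complexP; rewrite !cE /=.
  + rewrite mul0r subr0 -[RHS](mlfun_resolvent lam al0 t0); congr (_ + _ * _).
    by apply: eq_Rintegral => x _; rewrite /Re_fun cReZ.
  + rewrite mul0r addr0 add0r (eq_Rintegral mu (g := cst 0)) ; last first.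
      by move=> x _; rewrite /Im_fun cImZ mulr0.
    by rewrite Rintegral_cst ?mul0r ?mulr0//; exact: measurable_itv.
Qed.

Lemma ABC_convolution (B : R -> R) al f t : ABC B al f t =
  (B al / (1 - al))%:C *
  convolution (cderive1 f) (fun x => (mlfun al (al / (1 - al)) x)%:C) t.
Proof.
rewrite /ABC; congr (_ * _); apply: eq_cintegral => x _.
by rewrite /mlfun -mulNr.
Qed.

(** laplace_transformed_equation multiplied by s^al / (s^al + lam); the denominator is
nonzero because the real part of s^al is positive. *)
Lemma ABC_transform_quadratic (B : R -> R) al (A : R[i]) f g s : 0 < al < 1 -> ABC_domain f ->
  (forall t, 0 < t -> ABC B al f t - A * convolution f f t = g t) ->
  0 < Re s -> laplace_cvg f s -> laplace_cvg g s ->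
  ABC_symbol B al al s * laplace f s - ABC_symbol B al (al - 1) s * f 0 =
  laplace g s + A * laplace f s ^+ 2.
Proof.
move=> /[dup] al01 /andP[al0 al1] fD eqn s0 /laplace_cvgE[fi fL] /laplace_cvgE[gi gL].
pose lam := al / (1 - al); have lam0 : 0 < lam by rewrite divr_gt0// subr_gt0.
have [me be ki ek] := mlfun_props lam al0.
have [ksi ks] := laplace_kernel al0 s0.
have eqn' t : 0 < t -> (B al / (1 - al))%:C *
    convolution (cderive1 f) (fun x => (mlfun al lam x)%:C) t - A * convolution f f t = g t.
  by move=> t0; rewrite -(eqn t t0) ABC_convolution.
have := laplace_transformed_equation s0 (fun T => cderive1_cintegrable T fD)
  (fun T => (ABC_domain_regular T fD).1) (fun T => (ABC_domain_regular T fD).2)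
  (fun t => @increment_eq_prim f t fD) me be ki ek ksi eqn' gi fL gL.
set c := (B al / (1 - al))%:C; set K := cintegral _ _; set S := cpow s al => h.
have S0 : S != 0 := cpow_neq0 s al.
have D0 : S + lam%:C != 0.
  apply/eqP => /(congr1 (fun z : R[i] => Re z)); rewrite cE /=.
  by apply/eqP; rewrite gt_eqF// addr_gt0// Re_cpow_gt0.
have sn0 : s != 0 by apply/eqP => s00; rewrite s00 ltxx in s0.
have S1 : cpow s (al - 1) = S / s by rewrite /S -(cpow_subr1 al s0) mulfK.
have KS : K = S^-1 by apply: (mulIf S0); rewrite ks mulVf.
rewrite /ABC_symbol -/lam -/c -/S S1.
have -> : laplace g s + A * laplace f s ^+ 2 =
   (laplace g s + A * laplace f s ^+ 2) * (1 + lam%:C * K) * (S / (S + lam%:C)).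
  by rewrite KS; field; rewrite S0 D0.
by rewrite -h; clearbody S c K; field; rewrite D0 sn0.
Qed.

(** The quadratic equation makes (2 A F - P)^2 equal to the discriminant. *)
Lemma ABC_transform_solution (B : R -> R) al (A : R[i]) f g s : 0 < al < 1 -> A != 0 -> ABC_domain f ->
  (forall t, 0 < t -> ABC B al f t - A * convolution f f t = g t) ->
  0 < Re s -> laplace_cvg f s -> laplace_cvg g s ->
  exists b, laplace f s = laplace_solution B al A (laplace g) (f 0) b s.
Proof.
move=> al01 A0 fD eqn s0 fL gL.
have := ABC_transform_quadratic al01 fD eqn s0 fL gL.
rewrite /laplace_solution; set P := ABC_symbol B al al s; set Q := ABC_symbol _ _ _ _.
set F := laplace f s; set G := laplace g s => h; set D := P ^+ 2 - _.
have A20 : 2 * A != 0 by rewrite mulf_neq0// pnatr_eq0.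
have : (2 * A * F - P) ^+ 2 == sqrtc D ^+ 2.
  rewrite sqr_sqrtc /D; apply/eqP.
  have -> : G + Q * f 0 = P * F - A * F ^+ 2.
    have -> : P * F = G + A * F ^+ 2 + Q * f 0 by rewrite -h subrK.
    ring.
  ring.
rewrite eqf_sqr => /orP[/eqP e|/eqP e]; [exists false|exists true].
- by rewrite expr0 mul1r -e addrC subrK mulrC mulKf.
- by rewrite expr1 mulN1r -e addrC subrK mulrC mulKf.
Qed.

Lemma laplaceB f g s : laplace_cvg f s -> laplace_cvg g s ->
  laplace_cvg (fun t => f t - g t) s /\
  laplace (fun t => f t - g t) s = laplace f s - laplace g s.
Proof.
move=> /laplace_cvgE[fi fL] /laplace_cvgE[gi gL].
have mI T : measurable (`[0, T]%classic : set (measurableTypeR R)) by exact: measurable_itv.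
apply: laplace_ccvg => [T|]; first exact: cintegrableB (mI T) (fi T) (gi T).
have := ccvgD fL (ccvgZ (-1) gL); rewrite mulN1r; apply: ccvg_eq => T _.
rewrite mulN1r -(cintegralB (mI T) (cintegrable_expw_mul s (fi T)) (cintegrable_expw_mul s (gi T))).
by apply: eq_cintegral => x _; rewrite mulrBr.
Qed.

End Transform.

Theorem mainTheorem7 (R : realType) (B : R -> R)
  (B_gt0 : forall x : R, 0 <= x <= 1 -> 0 < B x) (B0 : B 0 = 1) (B1 : B 1 = 1)
  (alpha : R) (alpha01 : 0 < alpha < 1) (A : R[i]) (A_neq0 : A != 0)
  (f g : R -> R[i])
  (f_ABC : ABC_domain f)
  (f_laplace : laplace_transformable f) (g_laplace : laplace_transformable g)
  (f_eq : forall t : R, 0 < t -> ABC B alpha f t - A * convolution f f t = g t) :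
  exists sgn : R[i] -> bool,
    [/\ forall s : R[i], 0 < complex.Re s ->
          laplace_cvg f s -> laplace_cvg g s ->
          laplace f s =
            laplace_solution B alpha A (laplace g) (f 0) (sgn s) s,
        inverse_laplace
          (fun s => laplace_solution B alpha A (laplace g) (f 0) (sgn s) s) f
      & forall h : R -> R[i],
          inverse_laplace
            (fun s => laplace_solution B alpha A (laplace g) (f 0) (sgn s) s) h ->
          {ae lebesgue_measure, forall t : R, 0 < t -> h t = f t}].
Proof.
pose sol b s := laplace_solution B alpha A (laplace g) (f 0) b s.
have [sgn sgnP] : exists sgn : R[i] -> bool, forall s, 0 < complex.Re s ->
    laplace_cvg f s -> laplace_cvg g s -> laplace f s = sol (sgn s) s.
  exists (fun s => ~~ `[< laplace f s = sol false s >]) => s s0 fs gs.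
  case: asboolP => //= nf.
  by have [[] // e] := ABC_transform_solution alpha01 A_neq0 f_ABC f_eq s0 fs gs.
have [sf fsf] := f_laplace; have [sg gsg] := g_laplace.
pose sigma := Num.max 0 (Num.max (complex.Re sf) (complex.Re sg)).
have f_inv s : sigma < complex.Re s -> laplace_cvg f s /\ laplace f s = sol (sgn s) s.
  rewrite !gt_max => /andP[s0 /andP[sfs sgs]].
  have fs := laplace_half_plane fsf sfs; have gs := laplace_half_plane gsg sgs.
  by split=> //; exact: sgnP.
exists sgn; split; [exact: sgnP|by exists sigma|].
move=> h [sigma' h_inv].
have hf0 s : Num.max sigma sigma' < complex.Re s ->
    laplace_cvg (fun t => h t - f t) s /\ laplace (fun t => h t - f t) s = 0.
  rewrite gt_max => /andP[/f_inv[fs eF] /h_inv[hs eH]].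
  by have [hfs ->] := laplaceB hs fs; rewrite eF eH subrr.
have aeF : Filter (almost_everywhere (@lebesgue_measure R)) := ae_filter_ringOfSetsType _.
apply: filterS (laplace_unique hf0) => t ht t0.
by apply/eqP; rewrite -subr_eq0; apply/eqP; exact: ht.
Qed.
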